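(* Let $A$ be a semisimple Hopf algebra over $\Bbbk$ and let $K, L$ be two normal Hopf subalgebras of $A$ such that $B(K,L)=(A//K)^{*\mathrm{cop}}\bowtie L$ is a normal Hopf subalgebra of the Drinfeld double $D(A)$. Then $$\mathcal{D}(K,L)'=\mathcal{D}(L,K)$$ as fusion subcategories of $\mathrm{Rep}(D(A))$, where $'$ denotes the Müger centralizer in $\mathrm{Rep}(D(A))$.
   Context: $\Bbbk$ is an algebraically closed field of characteristic zero; Sweedler notation $\Delta(a)=a_1\otimes a_2$; $S$ is the antipode and $\epsilon$ the counit. $\mathrm{Rep}(H)$ is the category of finite dimensional representations of $H$. A Hopf subalgebra $K\subseteq A$ is normal if it is stable under the left adjoint action $x\cdot a=x_1aS(x_2)$ of $A$; then $AK^+=K^+A$ (with $K^+=K\cap\ker\epsilon$) is a Hopf ideal and $A//K:=A/AK^+$ is the quotient Hopf algebra. Dualizing the projection $A\to A//K$, $(A//K)^*$ is identified with the Hopf subalgebra $\{f\in A^*: f(ak)=f(a)\epsilon(k)\ \forall a\in A,k\in K\}$ of $A^*$. The Drinfeld double $D(A)$ is $A^{*\mathrm{cop}}\otimes A$ as a coalgebra (elements $f\bowtie a$), with multiplication $(g\bowtie a)(f\bowtie b)=g(a_1\rightharpoonup f\leftharpoonup S^{-1}(a_3))\bowtie a_2b$, where $(a\rightharpoonup f\leftharpoonup b)(x)=f(bxa)$. It is a semisimple factorizable Hopf algebra with $R$-matrix $R=\sum_i(\epsilon\bowtie b_i)\otimes(b_i^*\bowtie 1)$, where $\{b_i\}$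 is a basis of $A$ with dual basis $\{b_i^*\}$; thus $\mathrm{Rep}(D(A))$ is a modular fusion category with braiding $c_{M,N}(m\otimes n)=R_{21}(n\otimes m)$. For normal Hopf subalgebras $K,L$ of $A$, $B(K,L):=(A//K)^{*\mathrm{cop}}\bowtie L$ is the subspace of $D(A)$ spanned by the $f\bowtie l$ with $f\in(A//K)^*$, $l\in L$; correspondingly $B(L,K)=(A//L)^{*\mathrm{cop}}\bowtie K$. $\mathcal{D}(K,L):=\mathrm{Rep}(D(A)//B(K,L))$, viewed as the fusion subcategory of $\mathrm{Rep}(D(A))$ whose objects are the $D(A)$-modules on which $B(K,L)$ acts trivially (i.e. through the counit); similarly $\mathcal{D}(L,K):=\mathrm{Rep}(D(A)//B(L,K))$. A fusion subcategory is a full replete tensor (fusion) subcategory. The Müger centralizer $\mathcal{K}'$ of a fusion subcategory $\mathcal{K}$ of a braided fusion category is the fusion subcategory generated by all simple objects $X$ such that $c_{Y,X}\circ c_{X,Y}=\mathrm{id}_{X\otimes Y}$ for all objects $Y$ of $\mathcal{K}$. *)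

(* Defs.v *)
From HB Require Import structures.
From mathcomp Require Import all_boot all_order all_algebra.

Set Implicit Arguments.
Unset Strict Implicit.
Unset Printing Implicit Defensive.

Import GRing.Theory.
Local Open Scope ring_scope.

Reserved Notation "u \ox v" (at level 40, left associativity).

(** * Tensor products of finite dimensional vector spaces

    [tensor U V] is the space of coefficient matrices with respect to the
    bases [vbasis {:U}] and [vbasis {:V}]. *)

Definition tensor (k : fieldType) (U V : vectType k) : vectType k :=
  'M[k]_(\dim {:U}, \dim {:V}).

Definition tens (k : fieldType) (U V : vectType k) (u : U) (v : V) :
    tensor U V :=
  \matrix_(i, j) (coord (vbasis {:U}) i u * coord (vbasis {:V}) j v).

Notation "u \ox v" := (tens u v) : ring_scope.

(* The linear map U (x) V -> W that a bilinear map f : U -> V -> W induces;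
   thus [tlift F (comul a)] is the Sweedler sum F(a_1, a_2). *)
Definition tlift (k : fieldType) (U V W : vectType k) (f : U -> V -> W) :
    'Hom(tensor U V, W) :=
  linfun (fun t : 'M[k]_(\dim {:U}, \dim {:V}) =>
    \sum_i \sum_j t i j *: f (vbasis {:U})`_i (vbasis {:V})`_j).

Lemma tliftE (k : fieldType) (U V W : vectType k) (f : U -> V -> W) :
  (forall v, linear (fun u => f u v)) -> (forall u, linear (f u)) ->
  forall u v, tlift f (u \ox v) = f u v.
Proof.
move=> fl fr u v.
pose g (t : 'M[k]_(\dim {:U}, \dim {:V})) : W :=
  \sum_i \sum_j t i j *: f (vbasis {:U})`_i (vbasis {:V})`_j.
have g_lin : linear g.
  move=> a s t; rewrite /g scaler_sumr -big_split; apply: eq_bigr => i _ /=.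
  rewrite scaler_sumr -big_split; apply: eq_bigr => j _ /=.
  by rewrite !mxE scalerDl scalerA.
pose gL := GRing.isLinear.Build _ _ _ _ g g_lin.
pose gl : {linear _ -> _} := HB.pack g gL.
rewrite /tlift (lfunE gl) /= /g.
have sumL (I : finType) (h : U -> W) (hl : linear h) (c : I -> k) (x : I -> U) :
    h (\sum_i c i *: x i) = \sum_i c i *: h (x i).
  pose hl' : {linear _ -> _} := HB.pack h (GRing.isLinear.Build _ _ _ _ h hl).
  apply: etrans (linear_sum hl' _ _ _) _.
  by apply: eq_bigr => i _; exact: (linearZ_LR hl').
have sumR (I : finType) (h : V -> W) (hl : linear h) (c : I -> k) (x : I -> V) :
    h (\sum_i c i *: x i) = \sum_i c i *: h (x i).
  pose hl' : {linear _ -> _} := HB.pack h (GRing.isLinear.Build _ _ _ _ h hl).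
  apply: etrans (linear_sum hl' _ _ _) _.
  by apply: eq_bigr => i _; exact: (linearZ_LR hl').
rewrite [in RHS](coord_vbasis (memvf u)) (sumL _ (fun u => f u v)) //.
apply: eq_bigr => i _; rewrite [in RHS](coord_vbasis (memvf v)) sumR //.
by rewrite scaler_sumr; apply: eq_bigr => j _; rewrite mxE scalerA.
Qed.

Definition tmap (k : fieldType) (U V U' V' : vectType k)
    (f : 'Hom(U, U')) (g : 'Hom(V, V')) : 'Hom(tensor U V, tensor U' V') :=
  tlift (fun u v => f u \ox g v).

Definition tflip (k : fieldType) (U V : vectType k) :
    'Hom(tensor U V, tensor V U) :=
  tlift (fun u v => v \ox u).

Definition tensv (k : fieldType) (U V : vectType k)
    (X : {vspace U}) (Y : {vspace V}) : {vspace tensor U V} :=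
  <<[seq u \ox v | u <- vbasis X, v <- vbasis Y]>>%VS.

(** * Hopf algebras

    The structure maps are separated from the axioms, so that the Drinfeld
    double can be defined by its formulas. *)

Record hopf_data (k : fieldType) := HopfData {
  hopf_space :> vectType k;
  hone : hopf_space;
  hmulm : 'Hom(tensor hopf_space hopf_space, hopf_space);
  comul : 'Hom(hopf_space, tensor hopf_space hopf_space);
  counit : 'Hom(hopf_space, k^o);
  antip : 'End(hopf_space)
}.

Arguments hone {k} h.
Arguments comul {k} h.
Arguments counit {k} h.
Arguments antip {k} h.

Definition hmul (k : fieldType) (H : hopf_data k) (x y : H) : H :=
  hmulm H (x \ox y).

Section Hopf.
Variables (k : fieldType) (H : hopf_data k).

(* F(a_1, a_2) and F(a_1, a_2, a_3) *)
Definition sweedler2 (W : vectType k) (F : H -> H -> W) (a : H) : W :=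
  tlift F (comul H a).
Definition sweedler3 (W : vectType k) (F : H -> H -> H -> W) (a : H) : W :=
  sweedler2 (fun x y => sweedler2 (F x) y) a.

Record is_hopf_algebra : Prop := IsHopfAlgebra {
  hmulA : forall x y z : H, hmul x (hmul y z) = hmul (hmul x y) z;
  hmul1l : forall x : H, hmul (hone H) x = x;
  hmul1r : forall x : H, hmul x (hone H) = x;
  comulA : forall x : H,
    sweedler2 (fun x1 x2 =>
      sweedler2 (fun x11 x12 => x11 \ox (x12 \ox x2)) x1) x =
    sweedler2 (fun x1 x2 => x1 \ox comul H x2) x;
  counitl : forall x : H, sweedler2 (fun x1 x2 => counit H x1 *: x2) x = x;
  counitr : forall x : H, sweedler2 (fun x1 x2 => counit H x2 *: x1) x = x;
  comul1 : comul H (hone H) = hone H \ox hone H;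
  comulM : forall x y : H,
    comul H (hmul x y) =
    sweedler2 (fun x1 x2 =>
      sweedler2 (fun y1 y2 => hmul x1 y1 \ox hmul x2 y2) y) x;
  counit1 : counit H (hone H) = 1;
  counitM : forall x y : H, counit H (hmul x y) = counit H x * counit H y;
  antipl : forall x : H,
    sweedler2 (fun x1 x2 => hmul (antip H x1) x2) x = counit H x *: hone H;
  antipr : forall x : H,
    sweedler2 (fun x1 x2 => hmul x1 (antip H x2)) x = counit H x *: hone H
}.

Definition left_ideal (I : {vspace H}) : Prop :=
  forall h x : H, x \in I -> hmul h x \in I.

Definition semisimple_algebra : Prop :=
  forall I : {vspace H}, left_ideal I ->
  exists J : {vspace H},
    [/\ left_ideal J, (I + J)%VS = fullv & (I :&: J)%VS = 0%VS].

Definition hopf_subalgebra (K : {vspace H}) : Prop :=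
  [/\ hone H \in K,
      forall x y : H, x \in K -> y \in K -> hmul x y \in K,
      forall x : H, x \in K -> comul H x \in tensv K K &
      forall x : H, x \in K -> antip H x \in K].

Definition left_adjoint (x a : H) : H :=
  sweedler2 (fun x1 x2 => hmul (hmul x1 a) (antip H x2)) x.

Definition normal_hopf_subalgebra (K : {vspace H}) : Prop :=
  hopf_subalgebra K /\
  (forall x a : H, a \in K -> left_adjoint x a \in K).

(** * Finite dimensional representations *)

Record rep_data := RepData {
  rep_space :> vectType k;
  rep_act : 'Hom(H, 'End(rep_space))
}.

Definition is_rep (M : rep_data) : Prop :=
  rep_act M (hone H) = \1%VF /\
  (forall x y : H, rep_act M (hmul x y) = (rep_act M x \o rep_act M y)%VF).

Definition rep_hom (M N : rep_data) (f : 'Hom(M, N)) : Prop :=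
  forall (h : H) (m : M), f (rep_act M h m) = rep_act N h (f m).

Definition simple_rep (M : rep_data) : Prop :=
  \dim {:M} != 0%N /\
  (forall U : {vspace M},
     (forall (h : H) (m : M), m \in U -> rep_act M h m \in U) ->
     U = 0%VS \/ U = fullv).

(* The action of H (x) H on M (x) N. *)
Definition tensor_act (M N : rep_data) :
    'Hom(tensor H H, 'End(tensor M N)) :=
  tlift (fun x y => tmap (rep_act M x) (rep_act N y)).

Definition unit_rep : rep_data :=
  @RepData k^o (linfun (fun h : H => counit H h *: (\1%VF : 'End(k^o)))).

Definition tensor_rep (M N : rep_data) : rep_data :=
  @RepData (tensor M N) (tensor_act M N \o comul H)%VF.

Definition dual_rep (M : rep_data) : rep_data :=
  @RepData 'Hom(M, k^o)
    (linfun (fun h : H => linfun (fun f : 'Hom(M, k^o) =>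
      (f \o rep_act M (antip H h))%VF))).

Definition sum_rep (M N : rep_data) : rep_data :=
  @RepData (M * N)%type
    (linfun (fun h : H => linfun (fun p : M * N =>
      (rep_act M h p.1, rep_act N h p.2)))).

(* A full subcategory of Rep(H) is given by its class of objects.  Closure
   under direct summands contains closure under isomorphism. *)
Record fusion_subcategory (C : rep_data -> Prop) : Prop := FusionSubcategory {
  fusion_rep : forall M, C M -> is_rep M;
  fusion_unit : C unit_rep;
  fusion_tensor : forall M N, C M -> C N -> C (tensor_rep M N);
  fusion_dual : forall M, C M -> C (dual_rep M);
  fusion_sum : forall M N, C M -> C N -> C (sum_rep M N);
  fusion_summand : forall (M N : rep_data) (i : 'Hom(N, M)) (p : 'Hom(M, N)),
    C M -> is_rep N -> rep_hom i -> rep_hom p -> (p \o i)%VF = \1%VF -> C N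
}.

Definition generated_fusion_subcategory (S : rep_data -> Prop) :
    rep_data -> Prop :=
  fun M => forall C : rep_data -> Prop,
    fusion_subcategory C -> (forall X, S X -> C X) -> C M.

(** * Braiding and Mueger centralizer with respect to R in H (x) H *)

Variable R : tensor H H.

Definition braiding (M N : rep_data) : 'Hom(tensor M N, tensor N M) :=
  (tensor_act N M (tflip H H R) \o tflip M N)%VF.

Definition mueger_centralizer (C : rep_data -> Prop) : rep_data -> Prop :=
  generated_fusion_subcategory (fun X =>
    [/\ is_rep X, simple_rep X &
        forall Y, C Y -> (braiding Y X \o braiding X Y)%VF = \1%VF]).

(* The representations on which the subspace B acts through the counit. *)
Definition trivial_on (B : {vspace H}) : rep_data -> Prop :=
  fun M => is_rep M /\
    (forall (b : H) (m : M), b \in B -> rep_act M b m = counit H b *: m).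

End Hopf.

(** * The Drinfeld double *)

Section Double.
Variables (k : fieldType) (A : hopf_data k).

Definition dual_space : vectType k := 'Hom(A, k^o).

Local Notation n := (\dim {:A}).
Definition hopf_basis (i : 'I_n) : A := (vbasis {:A})`_i.
Definition hopf_dual_basis (i : 'I_n) : dual_space :=
  linfun (coord (vbasis {:A}) i : A -> k^o).
Local Notation b := hopf_basis.
Local Notation b' := hopf_dual_basis.

Definition dual_mul (g f : dual_space) : dual_space :=
  (tlift (fun x y : A => (g x * f y : k^o)) \o comul A)%VF.

(* f_1 (x) f_2, where f(xy) = f_1(x) f_2(y). *)
Definition dual_comul (f : dual_space) : tensor dual_space dual_space :=
  \sum_i \sum_j f (hmul (b i) (b j)) *: (b' i \ox b' j).

Definition antip_inv : 'End(A) := (antip A)^-1%VF.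

(* a -> f <- c, the functional x |-> f(c x a). *)
Definition dual_translate (a : A) (f : dual_space) (c : A) : dual_space :=
  linfun (fun x : A => f (hmul (hmul c x) a)).

Definition double_space : vectType k := tensor dual_space A.

Definition double_mul : 'Hom(tensor double_space double_space, double_space) :=
  tlift (fun p q : double_space =>
    tlift (fun (g : dual_space) (a : A) =>
      tlift (fun (f : dual_space) (c : A) =>
        sweedler3 (fun a1 a2 a3 =>
          dual_mul g (dual_translate a1 f (antip_inv a3)) \ox hmul a2 c) a)
      q) p).

Definition double_comul : 'Hom(double_space, tensor double_space double_space) :=
  tlift (fun (f : dual_space) (a : A) =>
    tlift (fun f1 f2 : dual_space =>
      sweedler2 (fun a1 a2 => (f2 \ox a1) \ox (f1 \ox a2)) a)
    (dual_comul f)).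

Definition double_counit : 'Hom(double_space, k^o) :=
  tlift (fun (f : dual_space) (a : A) => (f (hone A) * counit A a : k^o)).

(* S(f >< a) = (eps >< S(a)) (f o S^-1 >< 1); the antipode of A^*cop is
   f |-> f o S^-1. *)
Definition double_antip : 'End(double_space) :=
  tlift (fun (f : dual_space) (a : A) =>
    double_mul (((counit A : dual_space) \ox antip A a) \ox
                (((f \o antip_inv)%VF : dual_space) \ox hone A))).

Definition drinfeld_double : hopf_data k :=
  @HopfData k double_space ((counit A : dual_space) \ox hone A)
    double_mul double_comul double_counit double_antip.

Definition double_R : tensor drinfeld_double drinfeld_double :=
  \sum_i ((counit A : dual_space) \ox b i) \ox (b' i \ox hone A).

(* (A//K)^* as a subspace of A^*; see [dual_quotientP]. *)
Definition dual_quotient (K : {vspace A}) : {vspace dual_space} :=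
  (\bigcap_(i < n) \bigcap_(j < \dim K)
     lker (linfun (fun f : dual_space =>
       f (hmul (b i) (vbasis K)`_j) - f (b i) * counit A (vbasis K)`_j
       : k^o)))%VS.

(* (A//K)^*cop >< L *)
Definition double_sub (K L : {vspace A}) : {vspace drinfeld_double} :=
  tensv (dual_quotient K) L.

Definition double_cat (K L : {vspace A}) : rep_data drinfeld_double -> Prop :=
  trivial_on (double_sub K L).

Lemma dual_quotientP (K : {vspace A}) (f : dual_space) :
  f \in dual_quotient K <->
  (forall a x : A, x \in K -> f (hmul a x) = f a * counit A x).
Proof.
have in_ker a x : (f \in lker (linfun (fun g : dual_space =>
    g (hmul a x) - g a * counit A x : k^o))) =
    (f (hmul a x) == f a * counit A x).
  have lin : linear (fun g : dual_space =>
      g (hmul a x) - g a * counit A x : k^o).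
    move=> c g h; rewrite !lfun_simp /= mulrDl scalerBr opprD addrACA.
    by rewrite [in RHS]/GRing.scale /= mulrA.
  pose l : {linear dual_space -> k^o} :=
    HB.pack (fun g : dual_space => g (hmul a x) - g a * counit A x : k^o)
      (GRing.isLinear.Build _ _ _ _ _ lin).
  by rewrite memv_ker (lfunE l) /= subr_eq0.
have hmull x : linear (fun a : A => hmul a x).
  move=> c a a'; rewrite /hmul -linearP; congr (hmulm A _).
  by apply/matrixP=> i j; rewrite !mxE linearP mulrDl mulrA.
have hmulr a : linear (fun x : A => hmul a x).
  move=> c x x'; rewrite /hmul -linearP; congr (hmulm A _).
  by apply/matrixP=> i j; rewrite !mxE linearP mulrDr mulrCA.
rewrite /dual_quotient; split=> [|eq_f]; last first.
  rewrite memvE; apply/subv_bigcapP=> i _; apply/subv_bigcapP=> j _.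
  by rewrite -memvE in_ker eq_f // vbasis_mem // mem_nth // size_tuple.
rewrite memvE => /subv_bigcapP eq_f a x Kx.
have {}eq_f i (j : 'I_(\dim K)) : f (hmul (b i) (vbasis K)`_j) =
    f (b i) * counit A (vbasis K)`_j.
  by move: (eq_f i isT) => /subv_bigcapP /(_ j isT); rewrite -memvE in_ker => /eqP.
pose hl y : {linear A -> A} := HB.pack (fun a : A => hmul a y)
  (GRing.isLinear.Build _ _ _ _ _ (hmull y)).
pose hr c : {linear A -> A} := HB.pack (fun y : A => hmul c y)
  (GRing.isLinear.Build _ _ _ _ _ (hmulr c)).
have hmul_suml (c : 'I_n -> k) y :
    hmul (\sum_i c i *: b i) y = \sum_i c i *: hmul (b i) y.
  apply: etrans (linear_sum (hl y) _ _ _) _.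
  by apply: eq_bigr => i _; exact: (linearZ_LR (hl y)).
have hmul_sumr (d : 'I_(\dim K) -> k) :
    hmul a (\sum_j d j *: (vbasis K)`_j) =
    \sum_j d j *: hmul a (vbasis K)`_j.
  apply: etrans (linear_sum (hr a) _ _ _) _.
  by apply: eq_bigr => j _; exact: (linearZ_LR (hr a)).
have {}eq_f (j : 'I_(\dim K)) :
    f (hmul a (vbasis K)`_j) = f a * counit A (vbasis K)`_j.
  rewrite (coord_vbasis (memvf a)) hmul_suml !linear_sum mulr_suml.
  by apply: eq_bigr => i _; rewrite !linearZ /= eq_f /GRing.scale /= mulrA.
rewrite (coord_vbasis Kx) hmul_sumr !linear_sum mulr_sumr.
by apply: eq_bigr => j _; rewrite !linearZ /= eq_f /GRing.scale /= mulrCA.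
Qed.


End Double.

(* Main.v *)
(* On X (x) Y the double braiding is the action of R_21 R.

   If X lies in D(L,K) and Y in D(K,L), then a |-> <p, a x> lies in (A//K)^*,
   which acts trivially on Y; hence R acts trivially on X (x) Y, and likewise
   R_21.  Conversely, let X centralize D(K,L) and take for Y the dual of D//B,
   B = B(K,L).  For kap in K and eta in (A//L)^* the functional
   f >< a |-> f(kap) eta(a) belongs to Y: B has a normalized integral
   e = f_0 >< Lam_L, which is central because B is normal, and the functional is
   invariant under e.  Comparing R with R_21^-1 on X (x) Y and evaluating Y at 1
   gives eta(1) (kap x) = eps(kap) ((eta o S) x), so K and (A//L)^* act
   trivially on X.

   Generation by simple objects needs D(A) to be semisimple, that is, the theorem
   of Larson and Radford that A is cosemisimple.  The functional
   lam(h) = tr(y |-> h S^2(y)) is an integral of A^* with lam(1) = tr(S^2).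
   Radford's formula for S^4 gives S^2 finite order, and S^2 is inner; for a
   decomposition of 1 into primitive idempotents f_i fixed by S^2, each f_i A f_j
   is zero or a line on which S^2 is a root of unity a_j / a_i, so that tr(S^2)
   is a sum of squared absolute values |sum_i a_i|^2 over the classes of
   isomorphic idempotents, and the class of the counit is a singleton. *)

From HB Require Import structures.
Require Import Defs.
From mathcomp Require Import all_boot all_order all_algebra.
From mathcomp Require Import all_field cyclic.
From Stdlib Require Import Classical.

Set Implicit Arguments.
Unset Strict Implicit.
Unset Printing Implicit Defensive.

Import GRing.Theory.
Local Open Scope ring_scope.

(** * Linear maps on tensor products *)

(** The field has no conjugation, so the positivity argument for tr(S^2) can only run in [algC],
    after the sum has been read as an integer polynomial at a root of unity. A second obstacle: S^-1
    is a mere pseudo-inverse until S is known to be bijective, and the Hopf axioms of D(A) wait for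
    this. Bijectivity follows from the pair (lam, L), where L is the normalized integral that
    semisimplicity supplies. Writing lam as a trace replaces the existence theorem for integrals,
    and the dual trace formula inside K gives an integral of K; its counit is nonzero by regularity,
    because lam takes on it the value lam(1). So tr(S^2) != 0 serves twice: for the semisimplicity
    of D(A), and for the integrals of K and L from which the integral of B is built, with f_0 =
    lam(- Lam_K). Finally, normality is given for B(K,L) but not for B(L,K), so D(L,K) is not
    handled through a normal subalgebra of D(A): membership is split into triviality of (A//L)^* and
    of K, and closure under tensor products comes from normality of L in A. *)

Section Lin.
Variable k : fieldType.

(** An unbundled predicate, because the arguments of Sweedler sums are anonymous functions that
    carry no canonical linear structure. The tactic [lin] discharges it syntactically. *)
Definition lin (U V : lmodType k) (f : U -> V) : Prop :=
  forall a u v, f (a *: u + v) = a *: f u + f v.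

Definition lin_pack (U V : lmodType k) (f : U -> V) (hf : lin f) :
    {linear U -> V} :=
  HB.pack f (GRing.isLinear.Build _ _ _ _ f hf).

Implicit Types U V W : vectType k.

Lemma lin_sum (U V : lmodType k) (f : U -> V) (I : finType) (x : I -> U) :
  lin f -> f (\sum_i x i) = \sum_i f (x i).
Proof. by move=> hf; exact: (linear_sum (lin_pack hf)). Qed.

Lemma linZ (U V : lmodType k) (f : U -> V) a x :
  lin f -> f (a *: x) = a *: f x.
Proof. by move=> hf; exact: (linearZ_LR (lin_pack hf)). Qed.

Lemma linD (U V : lmodType k) (f : U -> V) x y :
  lin f -> f (x + y) = f x + f y.
Proof. by move=> hf; exact: (linearD (lin_pack hf)). Qed.

Lemma linB (U V : lmodType k) (f : U -> V) x y :
  lin f -> f (x - y) = f x - f y.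
Proof. by move=> hf; exact: (linearB (lin_pack hf)). Qed.

Lemma lin0 (U V : lmodType k) (f : U -> V) : lin f -> f 0 = 0.
Proof. by move=> hf; exact: (linear0 (lin_pack hf)). Qed.

Lemma lin_lfunE U V (f : U -> V) u : lin f -> linfun f u = f u.
Proof. by move=> hf; exact: (lfunE (lin_pack hf)). Qed.

Lemma lin_id (U : lmodType k) : lin (fun x : U => x).
Proof. by []. Qed.

Lemma lin_lfun (U : lmodType k) V W (f : 'Hom(V, W)) (E : U -> V) :
  lin E -> lin (fun x => f (E x)).
Proof. by move=> hE a u v; rewrite hE linearP. Qed.

Lemma lin_app (U : lmodType k) V W (E : U -> 'Hom(V, W)) (x : V) :
  lin E -> lin (fun f => E f x).
Proof. by move=> hE a u v; rewrite hE !lfun_simp. Qed.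

Lemma lin_comp (U V W : lmodType k) (f : V -> W) (E : U -> V) :
  lin f -> lin E -> lin (fun x => f (E x)).
Proof. by move=> hf hE a u v; rewrite hE hf. Qed.

Lemma lin_scalel (U V : lmodType k) (E : U -> k^o) (v : V) :
  lin E -> lin (fun x => (E x : k) *: v).
Proof. by move=> hE a u w; rewrite hE scalerDl scalerA. Qed.

Lemma lin_scaler (U V : lmodType k) (E : U -> V) (c : k) :
  lin E -> lin (fun x => c *: E x).
Proof. by move=> hE a u w; rewrite hE scalerDr !scalerA mulrC. Qed.

Lemma lin_mull (U : lmodType k) (E : U -> k^o) (c : k) :
  lin E -> lin (fun x => ((E x : k) * c : k^o)).
Proof. by move=> hE a u w; rewrite hE mulrDl -mulrA. Qed.

Lemma lin_mulr (U : lmodType k) (E : U -> k^o) (c : k) :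
  lin E -> lin (fun x => (c * (E x : k) : k^o)).
Proof. by move=> hE a u w; rewrite hE mulrDr mulrCA. Qed.

Lemma lin_add (U V : lmodType k) (E F : U -> V) :
  lin E -> lin F -> lin (fun x => E x + F x).
Proof. by move=> hE hF a u w; rewrite hE hF scalerDr addrACA. Qed.

Lemma lin_opp (U V : lmodType k) (E : U -> V) :
  lin E -> lin (fun x => - E x).
Proof. by move=> hE a u w; rewrite hE scalerN opprD. Qed.

Lemma lin_bigsum (U V : lmodType k) (I : finType) (E : I -> U -> V) :
  (forall i, lin (E i)) -> lin (fun x => \sum_i E i x).
Proof.
move=> hE a u v; rewrite scaler_sumr -big_split.
by apply: eq_bigr => i _; rewrite hE.
Qed.

Lemma lin_tensl (U : lmodType k) V W (E : U -> V) (w : W) :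
  lin E -> lin (fun x => E x \ox w).
Proof.
by move=> hE a u v; apply/matrixP=> i j; rewrite hE !mxE linearP mulrDl mulrA.
Qed.

Lemma lin_tensr (U : lmodType k) V W (E : U -> W) (v : V) :
  lin E -> lin (fun x => v \ox E x).
Proof.
by move=> hE a u w; apply/matrixP=> i j; rewrite hE !mxE linearP mulrDr mulrCA.
Qed.

(** [tlift F] reads [F] on pairs of basis vectors only, so this holds for an arbitrary function [F];
    bilinearity enters with [tlift_tens]. *)
Lemma tlift_sum U V W (F : U -> V -> W) (t : tensor U V) :
  tlift F t = \sum_i \sum_j t i j *: F (vbasis {:U})`_i (vbasis {:V})`_j.
Proof.
rewrite /tlift lin_lfunE // => a s u.
rewrite scaler_sumr -big_split; apply: eq_bigr => i _ /=.
rewrite scaler_sumr -big_split; apply: eq_bigr => j _ /=.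
by rewrite !mxE scalerDl scalerA.
Qed.

Lemma eq_tlift U V W (F G : U -> V -> W) (t : tensor U V) :

  (forall u v, F u v = G u v) -> tlift F t = tlift G t.
Proof.
move=> FG; rewrite !tlift_sum; apply: eq_bigr => i _; apply: eq_bigr => j _ /=.
by rewrite FG.
Qed.

Lemma tlift_exchange U V U' V' W (F : U -> V -> U' -> V' -> W) t t' :
  tlift (fun u v => tlift (F u v) t') t =
  tlift (fun u' v' => tlift (fun u v => F u v u' v') t) t'.
Proof.
have E (G : U -> V -> U' -> V' -> W) : tlift (fun u v => tlift (G u v) t') t =
    \sum_p \sum_q t p.1 p.2 *: (t' q.1 q.2 *:
      G (vbasis {:U})`_p.1 (vbasis {:V})`_p.2
        (vbasis {:U'})`_q.1 (vbasis {:V'})`_q.2).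
  rewrite tlift_sum pair_bigA /=; apply: eq_bigr => p _.
  by rewrite tlift_sum pair_bigA /= scaler_sumr.
rewrite E exchange_big /= tlift_sum [RHS]pair_bigA /=; apply: eq_bigr => q _.
rewrite tlift_sum pair_bigA /= scaler_sumr; apply: eq_bigr => p _.
by rewrite !scalerA mulrC.
Qed.

Lemma lin_tliftf (U : lmodType k) V W (X : vectType k) (F : U -> V -> W -> X) t :
  (forall v w, lin (fun x => F x v w)) -> lin (fun x => tlift (F x) t).
Proof.
move=> hF a u v; rewrite !tlift_sum scaler_sumr -big_split.
apply: eq_bigr => i _ /=; rewrite scaler_sumr -big_split.
apply: eq_bigr => j _ /=.
by rewrite hF scalerDr !scalerA mulrC.
Qed.

Lemma tlift_tens U V W (F : U -> V -> W) u v :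
  (forall v, lin (fun u => F u v)) -> (forall u, lin (F u)) ->
  tlift F (u \ox v) = F u v.
Proof. by move=> h1 h2; apply: tliftE => w; [exact: h1 | exact: h2]. Qed.

Lemma lin_tlift U V W (X : vectType k) (G : W -> X) (F : U -> V -> W) t :
  lin G -> G (tlift F t) = tlift (fun u v => G (F u v)) t.
Proof.
move=> hG; rewrite !tlift_sum (lin_sum _ hG); apply: eq_bigr => i _.
rewrite (lin_sum _ hG). apply: eq_bigr => j _; by rewrite (linZ _ _ hG).
Qed.

Lemma tens_sum U V (t : tensor U V) :
  t = \sum_i \sum_j t i j *: ((vbasis {:U})`_i \ox (vbasis {:V})`_j).
Proof.
apply/matrixP=> i j; rewrite summxE (bigD1 i) //= summxE (bigD1 j) //=.
have fU : free (vbasis {:U}) by exact: basis_free (vbasisP _).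
have fV : free (vbasis {:V}) by exact: basis_free (vbasisP _).
rewrite !mxE !coord_free // !eqxx !mulr1 big1 ?addr0 => [|j' /negPf nj].
  rewrite big1 ?addr0 // => i' /negPf ni; rewrite summxE big1 // => j' _.
  by rewrite !mxE !coord_free // ni mul0r mulr0.
by rewrite !mxE !coord_free // nj !mulr0.
Qed.

Lemma lin_tliftE U V (X : vectType k) (G : tensor U V -> X) t :
  lin G -> G t = tlift (fun u v => G (u \ox v)) t.
Proof.
move=> hG; rewrite {1}[t]tens_sum tlift_sum (lin_sum _ hG).
apply: eq_bigr => i _; rewrite (lin_sum _ hG); apply: eq_bigr => j _.
by rewrite (linZ _ _ hG).
Qed.

Lemma tens_ext U V (X : vectType k) (F G : tensor U V -> X) :
  lin F -> lin G -> (forall u v, F (u \ox v) = G (u \ox v)) -> F =1 G.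
Proof.
by move=> hF hG FG t; rewrite (lin_tliftE _ hF) (lin_tliftE _ hG); apply: eq_tlift.
Qed.

Lemma tens_lfun_ext U V (X : vectType k) (f g : 'Hom(tensor U V, X)) :
  (forall u v, f (u \ox v) = g (u \ox v)) -> f = g.
Proof.
move=> fg; apply/lfunP; apply: tens_ext => //; apply: lin_lfun; exact: lin_id.
Qed.

(* Values are taken in [k] rather than [k^o], so that products and scalings by
   them live in [k]. *)
Definition ev (U : vectType k) (f : 'Hom(U, k^o)) (u : U) : k := f u.

Lemma lin_evr (U : lmodType k) V (f : 'Hom(V, k^o)) (E : U -> V) :
  lin E -> lin (fun x => ev f (E x) : k^o).
Proof. exact: lin_lfun. Qed.

Lemma lin_evl (U : lmodType k) V (E : U -> 'Hom(V, k^o)) (x : V) :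
  lin E -> lin (fun f => ev (E f) x : k^o).
Proof. exact: lin_app. Qed.

End Lin.

Definition eps (k : fieldType) (H : hopf_data k) (x : H) : k := counit H x.

Section HmulLin.
Variables (k : fieldType) (H : hopf_data k).

Lemma lin_hmull (U : lmodType k) (E : U -> H) (b : H) :
  lin E -> lin (fun x => hmul (E x) b).
Proof. by move=> hE; apply: lin_lfun; apply: lin_tensl. Qed.

Lemma lin_hmulr (U : lmodType k) (E : U -> H) (b : H) :
  lin E -> lin (fun x => hmul b (E x)).
Proof. by move=> hE; apply: lin_lfun; apply: lin_tensr. Qed.

Lemma lin_sw (U : lmodType k) (W : vectType k) (F : H -> H -> W) (E : U -> H) :
  lin E -> lin (fun x => sweedler2 F (E x)).
Proof. by move=> hE; do 2!apply: lin_lfun. Qed.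

Lemma lin_swf (U : lmodType k) (W : vectType k) (F : U -> H -> H -> W) a :
  (forall v w, lin (fun x => F x v w)) -> lin (fun x => sweedler2 (F x) a).
Proof. exact: lin_tliftf. Qed.

Lemma lin_eps (U : lmodType k) (E : U -> H) :
  lin E -> lin (fun x => eps (E x) : k^o).
Proof. exact: lin_lfun. Qed.

End HmulLin.

(* A hook, redefined whenever new multilinear operations are introduced. *)
Ltac lin_ext := fail.
Ltac lin1 :=
  cbv beta;
  first [lin_ext |
  match goal with
  | |- lin (fun x => x) => apply: lin_id
  | |- lin (fun x => @?l_f x + @?l_g x) => apply: (lin_add (E := l_f) (F := l_g))
  | |- lin (fun x => - @?l_f x) => apply: (lin_opp (E := l_f))
  | |- @lin _ ?l_U ?l_V (fun x => @bigop.body _ _ _ _ (fun i => @BigBody _ _ i _ _ (@?l_f x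
    i))) =>
      refine (@lin_bigsum _ l_U l_V _ (fun i x => l_f x i) _); intro
  | |- lin (fun x => hmul (@?l_f x) ?l_b) => apply: (lin_hmull (E := l_f))
  | |- lin (fun x => hmul ?l_b (@?l_f x)) => apply: (lin_hmulr _ (E := l_f))
  | |- lin (fun x => tens (@?l_f x) ?l_b) => apply: (lin_tensl (E := l_f))
  | |- lin (fun x => tens ?l_b (@?l_f x)) => apply: (lin_tensr _ (E := l_f))
  | |- lin (fun x => sweedler2 ?l_F (@?l_f x)) => apply: (lin_sw _ (E := l_f))
  | |- lin (fun x => @sweedler2 _ _ ?l_W (@?l_F x) ?l_a) => refine (@lin_swf _ _ _ l_W l_F
    l_a _); intros
  | |- lin (fun x => tlift ?l_F (@?l_f x)) => apply: (lin_lfun _ (E := l_f))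
  | |- lin (fun x => fun_of_lfun (@tlift _ _ _ ?l_W (@?l_F x)) ?l_a) => refine (@lin_tliftf
    _ _ _ _ l_W l_F l_a _); intros
  | |- lin (fun x => eps (@?l_f x)) => apply: (lin_eps (E := l_f))
  | |- lin (fun x => ev ?l_g (@?l_f x)) => apply: (lin_evr _ (E := l_f))
  | |- lin (fun x => ev (@?l_g x) ?l_b) => apply: (lin_evl _ (E := l_g))
  | |- @lin _ ?l_U ?l_V (fun x => GRing.scale (@?l_f x) ?l_b) => refine (@lin_scalel _ l_U
    l_V l_f l_b _)
  | |- @lin _ ?l_U ?l_V (fun x => GRing.scale ?l_b (@?l_f x)) => refine (@lin_scaler _ l_U
    l_V l_f l_b _)
  | |- lin (fun x => GRing.mul (@?l_f x) ?l_b) => apply: (lin_mull (E := l_f))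
  | |- lin (fun x => GRing.mul ?l_b (@?l_f x)) => apply: (lin_mulr _ (E := l_f))
  | |- lin (fun x => fun_of_lfun ?l_g (@?l_f x)) => apply: (lin_lfun _ (E := l_f))
  | |- lin (fun x => fun_of_lfun (@?l_g x) ?l_b) => apply: (lin_app (E := l_g))
  | l_h : lin ?l_F |- lin (fun x => ?l_F (@?l_g x)) =>
      refine (lin_comp (f := l_F) (E := l_g) l_h _)
  | l_h : forall y, lin (fun x => ?l_F x y) |- lin (fun x => ?l_F (@?l_g x) ?l_b) =>
      refine (lin_comp (f := fun z => l_F z l_b) (E := l_g) (l_h l_b) _)
  | l_h : forall x, lin (?l_F x) |- lin (fun x => ?l_F ?l_b (@?l_g x)) =>
      refine (lin_comp (f := l_F l_b) (E := l_g) (l_h l_b) _)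
  | l_h : forall y z, lin (fun x => ?l_F x y z) |- lin (fun x => ?l_F (@?l_g x) ?l_b ?l_c) =>
      refine (lin_comp (f := fun z => l_F z l_b l_c) (E := l_g) (l_h l_b l_c) _)
  | l_h : forall y z, lin (fun x => ?l_F y x z) |- lin (fun x => ?l_F ?l_b (@?l_g x) ?l_c) =>
      refine (lin_comp (f := fun z => l_F l_b z l_c) (E := l_g) (l_h l_b l_c) _)
  | l_h : forall x y, lin (?l_F x y) |- lin (fun x => ?l_F ?l_b ?l_c (@?l_g x)) =>
      refine (lin_comp (f := l_F l_b l_c) (E := l_g) (l_h l_b l_c) _)
  | |- lin (fun x => @?l_f x) => first [ assumption | solve [auto] ]
  | |- lin ?l_f => first [ assumption | change (lin (fun x => l_f x)) ]
  end].
Ltac lin := intros; repeat lin1.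

(** * Sweedler calculus and the antipode *)

Section Sweedler.
Variables (k : fieldType) (H : hopf_data k).
Implicit Types (W X : vectType k).

Lemma eq_sw W (F G : H -> H -> W) a :
  (forall x y, F x y = G x y) -> sweedler2 F a = sweedler2 G a.
Proof. exact: eq_tlift. Qed.

Lemma sw_exchange (H' : hopf_data k) W (F : H -> H -> H' -> H' -> W) a b :
  sweedler2 (fun x y => sweedler2 (F x y) b) a =
  sweedler2 (fun u v => sweedler2 (fun x y => F x y u v) a) b.
Proof. exact: tlift_exchange. Qed.

Lemma sw_lin W X (G : W -> X) (F : H -> H -> W) a :
  lin G -> G (sweedler2 F a) = sweedler2 (fun x y => G (F x y)) a.
Proof. exact: lin_tlift. Qed.

Lemma sw_linl W X (G : W -> X) (F : H -> H -> W) a :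
  lin G -> sweedler2 (fun x y => G (F x y)) a = G (sweedler2 F a).
Proof. by move=> hG; rewrite (sw_lin _ _ hG). Qed.

Lemma sw_const_scale W (F : H -> H -> W) (c : k) a :
  sweedler2 (fun x y => c *: F x y) a = c *: sweedler2 F a.
Proof. by rewrite [RHS](sw_lin (G := fun w => c *: w)) //; lin. Qed.

Hypothesis hopf : is_hopf_algebra H.

(** [comulA] is an identity in H (x) (H (x) H). A trilinear [F] factors through a linear map [G] on
    that space, which is applied to both sides. *)
Lemma sw_coassoc W (F : H -> H -> H -> W) a :
  (forall y z, lin (fun x => F x y z)) -> (forall x z, lin (fun y => F x y z)) ->
  (forall x y, lin (fun z => F x y z)) ->
  sweedler2 (fun x z => sweedler2 (fun u v => F u v z) x) a =
  sweedler2 (fun x z => sweedler2 (F x) z) a.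
Proof.
move=> h1 h2 h3.
pose G := tlift (fun (x : H) (t : tensor H H) => tlift (F x) t).
have GE x y z : G (x \ox (y \ox z)) = F x y z.
  by rewrite tlift_tens ?tlift_tens //; lin.
have := congr1 G (comulA hopf a).
rewrite !(sw_lin (G := fun t => G t)); [|lin..].
have -> : sweedler2 (fun x y => G (sweedler2
    (fun x11 x12 => x11 \ox (x12 \ox y)) x)) a =
    sweedler2 (fun x z => sweedler2 (fun u v => F u v z) x) a.
  apply: eq_sw => x z; rewrite (sw_lin (G := fun t => G t)); last by lin.
  by apply: eq_sw => u v.
move=> ->; apply: eq_sw => x y; rewrite /G tlift_tens //; lin.
Qed.

Lemma sw_mul W (F : H -> H -> W) a b :
  (forall y, lin (fun x => F x y)) -> (forall x, lin (F x)) ->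
  sweedler2 F (hmul a b) = sweedler2 (fun a1 a2 =>
    sweedler2 (fun b1 b2 => F (hmul a1 b1) (hmul a2 b2)) b) a.
Proof.
move=> h1 h2; rewrite {1}/sweedler2 (comulM hopf).
rewrite (sw_lin (G := fun t => tlift F t)); last by lin.
apply: eq_sw => x y; rewrite (sw_lin (G := fun t => tlift F t)); last by lin.
by apply: eq_sw => u v; rewrite tlift_tens.
Qed.

Lemma sw_one W (F : H -> H -> W) :
  (forall y, lin (fun x => F x y)) -> (forall x, lin (F x)) ->
  sweedler2 F (hone H) = F (hone H) (hone H).
Proof. by move=> h1 h2; rewrite /sweedler2 (comul1 hopf) tlift_tens. Qed.

Lemma sw_counitl W (G : H -> W) a :
  lin G -> sweedler2 (fun x y => eps x *: G y) a = G a.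
Proof.
move=> hG; rewrite -{2}(counitl hopf a) (sw_lin _ _ hG).
by apply: eq_sw => x y; rewrite -(linZ _ _ hG).
Qed.

Lemma sw_counitr W (G : H -> W) a :
  lin G -> sweedler2 (fun x y => eps y *: G x) a = G a.
Proof.
move=> hG; rewrite -{2}(counitr hopf a) (sw_lin _ _ hG).
by apply: eq_sw => x y; rewrite -(linZ _ _ hG).
Qed.

Lemma epsM (x y : H) : eps (hmul x y) = eps x * eps y.
Proof. exact: counitM. Qed.

Lemma eps1 : eps (hone H) = 1.
Proof. exact: counit1. Qed.

Lemma sw_antipl W (G : H -> W) a :
  lin G -> sweedler2 (fun x y => G (hmul (antip H x) y)) a =
           eps a *: G (hone H).
Proof. by move=> hG; rewrite -(linZ _ _ hG) -(antipl hopf) (sw_lin _ _ hG). Qed.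

Lemma sw_antipr W (G : H -> W) a :
  lin G -> sweedler2 (fun x y => G (hmul x (antip H y))) a =
           eps a *: G (hone H).
Proof. by move=> hG; rewrite -(linZ _ _ hG) -(antipr hopf) (sw_lin _ _ hG). Qed.


End Sweedler.

Section Antipode.
Variables (k : fieldType) (H : hopf_data k).
Hypothesis hopf : is_hopf_algebra H.
Implicit Types (W X : vectType k).

Lemma antip1 : antip H (hone H) = hone H.
Proof.
have := antipl hopf (hone H).
by rewrite (sw_one hopf); [rewrite (hmul1r hopf) (counit1 hopf) scale1r|lin..].
Qed.

(** Both sides are convolution inverses of the multiplication H (x) H -> H. [E] is the triple
    product S(x_1 y_1) x_2 y_2 S(y_3) S(x_3), which collapses from the right to one side and from
    the left to the other. *)
Lemma antipM x y : antip H (hmul x y) = hmul (antip H y) (antip H x).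
Proof.
pose E := sweedler2 (fun x1 r => sweedler2 (fun y1 s =>
  sweedler2 (fun x2 x3 => sweedler2 (fun y2 y3 =>
    hmul (antip H (hmul x1 y1))
      (hmul (hmul x2 y2) (hmul (antip H y3) (antip H x3)))) s) r) y) x.
transitivity E.
  rewrite -[LHS](sw_counitr hopf (G := fun z => antip H (hmul z y))); last by lin.
  apply: eq_sw => x1 r; cbv beta.
  rewrite -[X in _ *: X](sw_counitr hopf (G := fun z => antip H (hmul x1 z))); last by lin.
  rewrite -sw_const_scale; apply: eq_sw => y1 s; cbv beta.
  transitivity (sweedler2 (fun x2 x3 => eps s *:
      hmul (antip H (hmul x1 y1)) (hmul x2 (antip H x3))) r).
    rewrite sw_const_scale (sw_antipr hopf (G := fun z => hmul _ z)); last by lin.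
    by rewrite (hmul1r hopf) !scalerA mulrC.
  apply: eq_sw => x2 x3; cbv beta.
  have := sw_antipr hopf (G := fun z => hmul (antip H (hmul x1 y1))
    (hmul x2 (hmul z (antip H x3)))) s.
  rewrite (hmul1l hopf) => <-; last by lin.
  by apply: eq_sw => y2 y3; cbv beta; rewrite !(hmulA hopf).
have hE : E = sweedler2 (fun r x3 => sweedler2 (fun s y3 =>
    sweedler2 (fun x1 x2 => sweedler2 (fun y1 y2 =>
    hmul (antip H (hmul x1 y1))
      (hmul (hmul x2 y2) (hmul (antip H y3) (antip H x3)))) s) r) y) x.
  transitivity (sweedler2 (fun x1 r => sweedler2 (fun x2 x3 =>
     sweedler2 (fun y1 s => sweedler2 (fun y2 y3 =>
    hmul (antip H (hmul x1 y1))
      (hmul (hmul x2 y2) (hmul (antip H y3) (antip H x3)))) s) y) r) x).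
    by apply: eq_sw => x1 r; cbv beta; rewrite sw_exchange.
  rewrite -(sw_coassoc hopf); [|lin..].
  apply: eq_sw => r x3; cbv beta; rewrite [RHS]sw_exchange; apply: eq_sw => x1 x2; cbv beta.
  by rewrite -(sw_coassoc hopf); [|lin..].
rewrite hE -[RHS](sw_counitl hopf (G := fun z => hmul _ (antip H z))); last by lin.
apply: eq_sw => r x3; cbv beta.
rewrite -[hmul _ _](sw_counitl hopf (G := fun z => hmul (antip H z) (antip H x3))); last by lin.
rewrite -sw_const_scale; apply: eq_sw => s y3; cbv beta.
rewrite scalerA -(epsM hopf).
rewrite -(hmul1l hopf (hmul (antip H y3) _)).
rewrite -[RHS](sw_antipl hopf (G := fun z => hmul z (hmul (antip H y3) (antip H x3))));
  last by lin.
rewrite (sw_mul hopf); [|lin..].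
do 2![apply: eq_sw => ? ?; cbv beta]; by rewrite !(hmulA hopf) !(hmul1r hopf).
Qed.

Lemma epsS (x : H) : eps (antip H x) = eps x.
Proof.
have -> : eps x = eps (sweedler2 (fun x1 x2 => hmul (antip H x1) x2) x).
  by rewrite (antipl hopf) {2}/eps linearZ /= (counit1 hopf) /GRing.scale /= mulr1.
rewrite [RHS](sw_lin (G := fun t : H => eps t : k^o)); last by lin.
rewrite -[LHS](sw_counitr hopf (G := fun t : H => eps (antip H t) : k^o)); last by lin.
by apply: (eq_sw (W := k^o)) => u v; rewrite (epsM hopf) mulrC.
Qed.

(** Uniqueness of convolution inverses again, now for the coproduct as a map H -> H (x) H: [E] is
    Delta(S(x_1)) Delta(x_2) (S(x_4) (x) S(x_3)), collapsed in two ways. *)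
Lemma sw_antip W (F : H -> H -> W) x :
  (forall y, lin (fun x => F x y)) -> (forall x, lin (F x)) ->
  sweedler2 F (antip H x) =
  sweedler2 (fun x1 x2 => F (antip H x2) (antip H x1)) x.
Proof.
move=> hF1 hF2.
pose E := sweedler2 (fun u v => sweedler2 (fun p q =>
  sweedler2 (fun s1 s2 => sweedler2 (fun q1 q2 => sweedler2 (fun v1 v2 =>
    F (hmul s1 (hmul q1 (antip H v2))) (hmul s2 (hmul q2 (antip H v1))))
  v) q) (antip H p)) u) x.
transitivity E; last first.
  rewrite -[RHS](sw_counitl hopf (G := fun z => sweedler2 _ z)); last by lin.
  apply: eq_sw => u v; cbv beta.
  transitivity (sweedler2 (fun v1 v2 => sweedler2 (fun p q =>
    sweedler2 (fun s t => F (hmul s (antip H v2)) (hmul t (antip H v1)))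
      (hmul (antip H p) q)) u) v).
    rewrite sw_exchange; apply: eq_sw => p q; cbv beta.
    transitivity (sweedler2 (fun v1 v2 => sweedler2 (fun s1 s2 =>
      sweedler2 (fun q1 q2 =>
    F (hmul s1 (hmul q1 (antip H v2))) (hmul s2 (hmul q2 (antip H v1)))) q)
      (antip H p)) v).
      rewrite [RHS]sw_exchange; apply: eq_sw => s1 s2; cbv beta.
      by rewrite [RHS]sw_exchange.
    apply: eq_sw => v1 v2; cbv beta; rewrite [RHS](sw_mul hopf); [|lin..].
    do 2![apply: eq_sw => ? ?; cbv beta]; by rewrite !(hmulA hopf).
  rewrite -sw_const_scale; apply: eq_sw => v1 v2; cbv beta.
  rewrite (sw_antipl hopf (G := fun z => sweedler2 _ z)); last by lin.
  by rewrite (sw_one hopf); [rewrite !(hmul1l hopf)|lin..].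
rewrite /E (sw_coassoc hopf); [|lin..].
rewrite -[LHS](sw_counitr hopf (G := fun z => sweedler2 _ (antip H z))); last by lin.
apply: eq_sw => p w; cbv beta.
rewrite -sw_const_scale [RHS]sw_exchange; apply: eq_sw => s1 s2; cbv beta.
transitivity (sweedler2 (fun q1 z => sweedler2 (fun y v2 =>
  sweedler2 (fun q2 v1 =>
  F (hmul s1 (hmul q1 (antip H v2))) (hmul s2 (hmul q2 (antip H v1)))) y) z) w);
  last first.
  rewrite (sw_coassoc hopf); [|lin..].
  by apply: eq_sw => q1 z; rewrite (sw_coassoc hopf); [|lin..].
transitivity (sweedler2 (fun q1 z => F (hmul s1 (hmul q1 (antip H z))) s2) w).
  rewrite (sw_antipr hopf (G := fun z => F (hmul s1 z) s2)); last by lin.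
  by rewrite (hmul1r hopf).
apply: eq_sw => q1 z; cbv beta.
rewrite -[LHS](sw_counitl hopf (G := fun z => F (hmul s1 (hmul q1 (antip H z))) s2));
  last by lin.
apply: eq_sw => y v2; cbv beta.
rewrite (sw_antipr hopf (G := fun z => F _ (hmul s2 z))); last by lin.
by rewrite (hmul1r hopf).
Qed.

End Antipode.

(** * Traces and integrals *)

Section Trace.
Variables (k : fieldType) (V : vectType k).

Definition cb (i : 'I_(\dim {:V})) : 'Hom(V, k^o) :=
  linfun (coord (vbasis {:V}) i : V -> k^o).
Definition vb (i : 'I_(\dim {:V})) : V := (vbasis {:V})`_i.

Definition ltrace (f : V -> V) : k := \sum_i ev (cb i) (f (vb i)).

Lemma cbE i v : ev (cb i) v = coord (vbasis {:V}) i v.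
Proof. by rewrite /ev lfunE. Qed.

Lemma vb_sum v : v = \sum_i ev (cb i) v *: vb i.
Proof.
rewrite {1}(coord_vbasis (memvf v)); apply: eq_bigr => i _.
by rewrite cbE.
Qed.

Lemma ev_vb i j : ev (cb i) (vb j) = (j == i)%:R.
Proof. by rewrite cbE coord_free //; exact: basis_free (vbasisP _). Qed.

Lemma lin_vb_sum (X : vectType k) (F : V -> X) v :
  lin F -> F v = \sum_i ev (cb i) v *: F (vb i).
Proof.
move=> hF; rewrite {1}[v]vb_sum (lin_sum _ hF).
by apply: eq_bigr => i _; rewrite (linZ _ _ hF).
Qed.

Lemma eq_ltrace f g : f =1 g -> ltrace f = ltrace g.
Proof. by move=> fg; apply: eq_bigr => i _; rewrite fg. Qed.

Lemma ltraceC f g : lin f -> lin g ->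
  ltrace (fun v => f (g v)) = ltrace (fun v => g (f v)).
Proof.
move=> hf hg; rewrite /ltrace.
transitivity (\sum_i \sum_j ev (cb j) (g (vb i)) * ev (cb i) (f (vb j))).
  apply: eq_bigr => i _.
  by rewrite (lin_vb_sum (F := fun v => ev (cb i) (f v) : k^o)) //; lin.
rewrite exchange_big; apply: eq_bigr => j _ /=.
rewrite [RHS](lin_vb_sum (F := fun v => ev (cb j) (g v) : k^o)); last by lin.
by apply: eq_bigr => i _; rewrite mulrC.
Qed.

Lemma ltrace_rank1 (c : 'Hom(V, k^o)) v : ltrace (fun w => ev c w *: v) = ev c v.
Proof.
rewrite [RHS](lin_vb_sum (F := fun w => ev c w : k^o)); last by lin.
apply: eq_bigr => i _.
rewrite (linZ (f := fun v => ev (cb i) v : k^o)); last by lin.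
by rewrite /GRing.scale /= mulrC.
Qed.

Lemma ltrace_sum (I : finType) (P : pred I) (f : I -> V -> V) :
  ltrace (fun v => \sum_(i | P i) f i v) = \sum_(i | P i) ltrace (f i).
Proof.
rewrite /ltrace exchange_big; apply: eq_bigr => i _.
by rewrite {1}/ev linear_sum.
Qed.

Lemma ltraceZ c (f : V -> V) : ltrace (fun v => c *: f v) = c * ltrace f.
Proof.
rewrite /ltrace mulr_sumr; apply: eq_bigr => i _.
by rewrite {1}/ev linearZ.
Qed.

End Trace.

(** * Von Neumann regularity and normalized integrals of a semisimple Hopf algebra *)

Section Algebra.
Variables (k : fieldType) (H : hopf_data k).
Hypothesis hopf : is_hopf_algebra H.

Lemma hmulDl (x y z : H) : hmul (x + y) z = hmul x z + hmul y z.
Proof. by rewrite (linD (f := fun t => hmul t z)) //; lin. Qed.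
Lemma hmulDr (x y z : H) : hmul z (x + y) = hmul z x + hmul z y.
Proof. by rewrite (linD (f := fun t => hmul z t)) //; lin. Qed.
Lemma hmulBl (x y z : H) : hmul (x - y) z = hmul x z - hmul y z.
Proof. by rewrite (linB (f := fun t => hmul t z)) //; lin. Qed.
Lemma hmulBr (x y z : H) : hmul z (x - y) = hmul z x - hmul z y.
Proof. by rewrite (linB (f := fun t => hmul z t)) //; lin. Qed.
Lemma hmulZl c (x z : H) : hmul (c *: x) z = c *: hmul x z.
Proof. by rewrite (linZ (f := fun t => hmul t z)) //; lin. Qed.
Lemma hmulZr c (x z : H) : hmul z (c *: x) = c *: hmul z x.
Proof. by rewrite (linZ (f := fun t => hmul z t)) //; lin. Qed.
Lemma hmul0l (z : H) : hmul 0 z = 0.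
Proof. by rewrite (lin0 (f := fun t => hmul t z)) //; lin. Qed.
Lemma hmul0r (z : H) : hmul z 0 = 0.
Proof. by rewrite (lin0 (f := fun t => hmul z t)) //; lin. Qed.
Lemma hmul_suml (I : finType) (x : I -> H) (z : H) :
  hmul (\sum_i x i) z = \sum_i hmul (x i) z.
Proof. by rewrite (lin_sum (f := fun t => hmul t z)) //; lin. Qed.
Lemma hmul_sumr (I : finType) (x : I -> H) (z : H) :
  hmul z (\sum_i x i) = \sum_i hmul z (x i).
Proof. by rewrite (lin_sum (f := fun t => hmul z t)) //; lin. Qed.

Definition regular : Prop :=
  forall x : H, exists y : H, x = hmul (hmul x y) x.

(** Write 1 = yx + e' along a complement J of the left ideal Hx. Then x - xyx = x e' lies both in Hx
    and in J. *)
Lemma semisimple_regular : semisimple_algebra H -> regular.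
Proof.
move=> ss x.
pose R := linfun (fun y : H => hmul y x).
have RE y : R y = hmul y x by rewrite lin_lfunE //; lin.
have [|J [idJ IJ1 IJ0]] := ss (limg R).
  move=> h z /memv_imgP[y _ ->]; rewrite RE (hmulA hopf) -RE.
  by apply: memv_img; exact: memvf.
have /memv_addP[e Ie [e' Je' def1]] : hone H \in (limg R + J)%VS.
  by rewrite IJ1 memvf.
have [y _ def_e] := memv_imgP Ie.
exists y; apply/eqP; rewrite -subr_eq0 -(hmulA hopf) -RE -def_e.
rewrite -memv0 -IJ0 memv_cap; apply/andP; split.
  apply: memvB; first by rewrite -[x in x \in _](hmul1l hopf) -RE memv_img ?memvf.
  by rewrite def_e RE (hmulA hopf) -RE memv_img ?memvf.
rewrite -[X in X - _](hmul1r hopf) def1 hmulDr addrC addKr.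
exact: idJ.
Qed.

Definition left_integral (L : H) : Prop := forall h, hmul h L = eps h *: L.
Definition right_integral (L : H) : Prop := forall h, hmul L h = eps h *: L.

Lemma semisimple_integral : semisimple_algebra H ->
  exists L : H, [/\ left_integral L, right_integral L & eps L = 1].
Proof.
move=> ss.
have [|J [idJ IJ1 IJ0]] := ss (lker (counit H)).
  by move=> h x; rewrite !memv_ker (counitM hopf) => /eqP->; rewrite mulr0.
have /memv_addP[e Ie [L JL def1]] : hone H \in (lker (counit H) + J)%VS.
  by rewrite IJ1 memvf.
have epsL : eps L = 1.
  rewrite -(eps1 hopf) def1 {2}/eps linearD /=.
  by move: Ie; rewrite memv_ker => /eqP->; rewrite add0r.
have left_L : left_integral L.
  move=> h; apply/eqP; rewrite -subr_eq0 -memv0 -IJ0 memv_cap; apply/andP; split.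
    rewrite memv_ker linearB linearZ /= (counitM hopf).
    by rewrite -/(eps L) -/(eps h) epsL subrr.
  by apply: memvB; [exact: idJ | exact: memvZ].
exists L; split=> // h.
(* Since eps(x) = 0, any product (Lx) y (Lx) contains xyL = 0. Regularity, applied to Lx, then
   forces Lx = 0. *)
pose x := h - eps h *: hone H.
have ex : eps x = 0.
  by rewrite /x /eps linearB linearZ /= (counit1 hopf) /GRing.scale /= mulr1 subrr.
have [y] := semisimple_regular ss (hmul L x).
have -> : hmul (hmul (hmul L x) y) (hmul L x) =
    hmul L (hmul (hmul (hmul x y) L) x) by rewrite !(hmulA hopf).
rewrite left_L (epsM hopf) ex mul0r scale0r hmul0l hmul0r /x hmulBr hmulZr.
by rewrite (hmul1r hopf) => /eqP; rewrite subr_eq0 => /eqP.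
Qed.

End Algebra.

Section Integral.
Variables (k : fieldType) (H : hopf_data k).
Hypothesis hopf : is_hopf_algebra H.
Local Notation S := (antip H).

Definition tr_int : 'Hom(H, k^o) :=
  linfun (fun h : H => ltrace (fun y => hmul h (S (S y))) : k^o).

Lemma tr_intE h : ev tr_int h = ltrace (fun y => hmul h (S (S y))).
Proof. by rewrite /ev lin_lfunE //; rewrite /ltrace; lin. Qed.

Lemma lin_ltracel (V U : vectType k) (T : U -> V -> V) :
  (forall y, lin (fun u => T u y)) -> lin (fun u => ltrace (T u) : k^o).
Proof. by move=> hT; rewrite /ltrace; lin. Qed.

Lemma sw_sum (W : vectType k) (I : finType) (F : I -> H -> H -> W) a :
  sweedler2 (fun x y => \sum_i F i x y) a = \sum_i sweedler2 (F i) a.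
Proof.
rewrite /sweedler2 tlift_sum.
under [RHS]eq_bigr do rewrite tlift_sum.
rewrite [RHS]exchange_big; apply: eq_bigr => i _ /=.
rewrite [RHS]exchange_big; apply: eq_bigr => j _ /=.
by rewrite scaler_sumr.
Qed.

(* Insert [S^2(y_2) S(y_1) = eps(y)] under the trace, then move the coproduct of
   the basis vector across the trace. *)
Lemma tr_int_left h :
  sweedler2 (fun h1 h2 => ev tr_int h2 *: h1) h = ev tr_int h *: hone H.
Proof.
pose c := @cb k H; pose b := @vb k H.
pose T y := hmul h (S (S y)).
have linT : lin T by rewrite /T; lin.
transitivity (\sum_i sweedler2 (fun y1 y2 => sweedler2 (fun z1 z2 =>
    ev (c i) z2 *: hmul z1 (S y1)) (T y2)) (b i)).
  transitivity (\sum_i sweedler2 (fun h1 h2 =>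
      ev (c i) (hmul h2 (S (S (b i)))) *: h1) h).
    rewrite -sw_sum; apply: eq_sw => h1 h2.
    by rewrite tr_intE /ltrace scaler_suml.
  apply: eq_bigr => i _; apply/esym.
  transitivity (sweedler2 (fun w p2 => sweedler2 (fun y1 p1 =>
      sweedler2 (fun h1 h2 =>
      ev (c i) (hmul h2 (S (S p2))) *: hmul h1 (S (hmul y1 (S p1)))) h) w) (b i)).
    rewrite (sw_coassoc hopf); [|lin..].
    apply: eq_sw => y1 y2; rewrite sw_exchange {1}/T (sw_mul hopf); [|lin..].
    apply: eq_sw => h1 h2; rewrite (sw_antip hopf) ?(sw_antip hopf); [|lin..].
    by apply: eq_sw => p1 p2; rewrite (antipM hopf) (hmulA hopf).
  rewrite -[RHS](sw_counitl hopf (G := fun z => sweedler2 (fun h1 h2 =>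
      ev (c i) (hmul h2 (S (S z))) *: h1) h) (b i)); last by lin.
  apply: eq_sw => w p2; rewrite sw_exchange -sw_const_scale.
  apply: eq_sw => h1 h2; cbv beta.
  rewrite (sw_antipr hopf (G := fun z => ev (c i) (hmul h2 (S (S p2))) *: hmul h1 (S z)));
    last by lin.
  by rewrite (antip1 hopf) (hmul1r hopf).
transitivity (\sum_j sweedler2 (fun z1 z2 => sweedler2 (fun y1 y2 =>
   ev (c j) y2 *: hmul z1 (S y1)) z2) (T (b j))).
  transitivity (\sum_i \sum_j sweedler2 (fun y1 y2 => ev (c j) y2 *:
    sweedler2 (fun z1 z2 => ev (c i) z2 *: hmul z1 (S y1)) (T (b j))) (b i)).
    apply: eq_bigr => i _; rewrite -sw_sum; apply: eq_sw => y1 y2.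
    by rewrite (lin_vb_sum (F := fun y2 => sweedler2 _ (T y2))) //; lin.
  rewrite exchange_big; apply: eq_bigr => j _ /=.
  transitivity (\sum_i sweedler2 (fun z1 z2 => ev (c i) z2 *:
    sweedler2 (fun y1 y2 => ev (c j) y2 *: hmul z1 (S y1)) (b i)) (T (b j))).
    apply: eq_bigr => i _.
    transitivity (sweedler2 (fun y1 y2 => sweedler2 (fun z1 z2 => ev (c i) z2 *: (ev (c j)
      y2 *: hmul z1 (S y1))) (T (b j))) (b i)).
      apply: eq_sw => y1 y2; rewrite -sw_const_scale; apply: eq_sw => z1 z2.
      by rewrite !scalerA mulrC.
    by rewrite sw_exchange; apply: eq_sw => z1 z2; rewrite sw_const_scale.
  rewrite -sw_sum; apply: eq_sw => z1 z2.
  by rewrite [RHS](lin_vb_sum (F := fun z => sweedler2 _ z)) //; lin.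
rewrite tr_intE /ltrace scaler_suml; apply: eq_bigr => j _.
rewrite -(sw_coassoc hopf); [|lin..].
rewrite -[RHS](sw_counitl hopf (G := fun z => ev (c j) z *: hone H) (T (b j))); last by lin.
apply: eq_sw => w y2; cbv beta.
by rewrite (sw_antipr hopf (G := fun z => ev (c j) y2 *: z)) //; lin.
Qed.

End Integral.

(** * Grouplike elements and the fourth power of the antipode *)

Lemma ev_ext (k : fieldType) (V : vectType k) (x y : V) :
  (forall f : 'Hom(V, k^o), ev f x = ev f y) -> x = y.
Proof.
by move=> fxy; rewrite [x]vb_sum [y]vb_sum; apply: eq_bigr => i _; rewrite fxy.
Qed.

Lemma evZ (k : fieldType) (V : vectType k) (f : 'Hom(V, k^o)) c x :
  ev f (c *: x) = c * ev f x.
Proof. by rewrite /ev linearZ. Qed.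

Lemma epsZ (k : fieldType) (H : hopf_data k) c (x : H) :
  eps (c *: x) = c * eps x.
Proof. by rewrite /eps linearZ. Qed.

Lemma evB (k : fieldType) (V : vectType k) (f : 'Hom(V, k^o)) x y :
  ev f (x - y) = ev f x - ev f y.
Proof. by rewrite /ev linearB. Qed.

Lemma ev0 (k : fieldType) (V : vectType k) (f : 'Hom(V, k^o)) : ev f 0 = 0.
Proof. by rewrite /ev linear0. Qed.

Lemma eps0 (k : fieldType) (H : hopf_data k) : eps (0 : H) = 0.
Proof. by rewrite /eps linear0. Qed.

Section Grouplike.
Variables (k : fieldType) (H : hopf_data k).

Definition grouplike (g : H) : Prop := comul H g = g \ox g /\ eps g = 1.

(** If v = sum_i c_i s_i, contracting the first leg of Delta(v) with the i-th coordinate gives c_i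
    s_i on one side and c_i v on the other. As v differs from s_i, every c_i vanishes, against
    eps(v) = 1. *)
Lemma grouplike_free (s : seq H) :
  uniq s -> (forall x, x \in s -> grouplike x) -> free s.
Proof.
elim: s => [|v s IHs] /=; first by rewrite nil_free.
move=> /andP[vs us] gs; rewrite free_cons IHs // ?andbT; last first.
  by move=> x xs; apply: gs; rewrite inE xs orbT.
have fs : free (in_tuple s) by apply: IHs => // x xs; apply: gs; rewrite inE xs orbT.
apply/negP => v_s.
have vE : v = \sum_i coord (in_tuple s) i v *: s`_i.
  exact: (coord_span (X := in_tuple s)).
have [dv ev1] : grouplike v by apply: gs; rewrite inE eqxx.
suff c0 i : coord (in_tuple s) i v = 0.
  move: ev1; rewrite vE big1 => [|i _]; last by rewrite c0 scale0r.
  by rewrite /eps linear0 => /esym/eqP; rewrite oner_eq0.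
pose ci : 'Hom(H, k^o) := linfun (coord (in_tuple s) i : H -> k^o).
pose G := tlift (fun x y : H => ev ci x *: y).
have GE x y : G (x \ox y) = ev ci x *: y by rewrite /G tlift_tens //; lin.
have ciE x : ev ci x = coord (in_tuple s) i x by rewrite /ev lfunE.
have : G (comul H v) = coord (in_tuple s) i v *: s`_i.
  rewrite {1}vE !linear_sum (bigD1 i) //= big1 ?addr0 => [|j /negPf ji].
    rewrite !linearZ /= (proj1 (gs _ _)) ?inE ?mem_nth ?orbT //.
    by rewrite GE ciE (coord_free i i fs) eqxx scale1r.
  rewrite !linearZ /= (proj1 (gs _ _)) ?inE ?mem_nth ?orbT //.
  by rewrite GE ciE (coord_free j i fs) ji scale0r scaler0.
rewrite dv GE ciE => /eqP; rewrite -subr_eq0 -scalerBr scaler_eq0 => /orP[/eqP//|].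
rewrite subr_eq0 => /eqP v_eq; case/negP: vs.
by rewrite v_eq mem_nth.
Qed.

Hypothesis hopf : is_hopf_algebra H.

Definition hpow (g : H) (n : nat) : H := iter n (hmul g) (hone H).

Lemma hpowD g m n : hpow g (m + n) = hmul (hpow g m) (hpow g n).
Proof.
by elim: m => [|m IHm]; rewrite ?add0n ?(hmul1l hopf) // addSn /= IHm (hmulA hopf).
Qed.

Lemma grouplike1 : grouplike (hone H).
Proof. by split; [exact: comul1 | exact: eps1]. Qed.

Lemma grouplikeM g h : grouplike g -> grouplike h -> grouplike (hmul g h).
Proof.
move=> [dg eg] [dh eh]; split; last by rewrite (epsM hopf) eg eh mulr1.
rewrite (comulM hopf) {1}/sweedler2 dg tlift_tens; [|lin..].
by rewrite /sweedler2 dh tlift_tens //; lin.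
Qed.

Lemma grouplike_pow g n : grouplike g -> grouplike (hpow g n).
Proof.
by move=> gg; elim: n => [|n IHn]; [exact: grouplike1 | exact: grouplikeM].
Qed.

Lemma grouplikeV g : grouplike g -> hmul (antip H g) g = hone H.
Proof.
move=> [dg eg]; have := antipl hopf g.
rewrite /sweedler2 dg tlift_tens; [|lin..].
by rewrite -/(eps g) eg scale1r.
Qed.

(** By linear independence, dim H + 1 powers of g cannot be distinct; a repetition is cancelled with
    S(g^i). *)
Lemma grouplike_torsion g : grouplike g -> exists2 n, (0 < n)%N & hpow g n = hone H.
Proof.
move=> gg; pose s := mkseq (hpow g) (\dim {:H}).+1.
have gs x : x \in s -> grouplike x by move=> /mapP[i _ ->]; exact: grouplike_pow.
have : ~~ uniq s.
  apply/negP => us; have := grouplike_free us gs.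
  rewrite /free size_mkseq => /eqP dims.
  by have := dimvS (subvf <<s>>%VS); rewrite dims ltnn.
move=> /(uniqPn (hone H))[i [j [ij]]]; rewrite size_mkseq => jn.
rewrite !nth_mkseq ?(ltn_trans ij) // => gij.
exists (j - i)%N; first by rewrite subn_gt0.
have inv : hmul (antip H (hpow g i)) (hpow g i) = hone H.
  by apply: grouplikeV; exact: grouplike_pow.
have jE : hpow g j = hmul (hpow g i) (hpow g (j - i)) by rewrite -hpowD subnKC // ltnW.
move: gij; rewrite jE => /(congr1 (hmul (antip H (hpow g i)))).
by rewrite (hmulA hopf) inv (hmul1l hopf).
Qed.

End Grouplike.

(** * Integrals of the dual, bijectivity of S and Radford's formula *)

Section LeftIntegral.
Variables (k : fieldType) (H : hopf_data k).
Hypothesis hopf : is_hopf_algebra H.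
Local Notation S := (antip H).

(** In the dual algebra this reads f l = f(1) l for every functional f. *)
Definition dual_left_integral (l : 'Hom(H, k^o)) : Prop :=
  forall h, sweedler2 (fun h1 h2 => ev l h2 *: h1) h = ev l h *: hone H.

(** Insert S(a_1) a_2 in front of b_1: then a_2 b_1 and a_3 b_2 are the two legs of a coproduct, to
    which the integral property applies, and S(a_1) remains. *)
Lemma dual_left_integral_shift l a b : dual_left_integral l ->
  sweedler2 (fun b1 b2 => ev l (hmul a b2) *: b1) b =
  sweedler2 (fun a1 a2 => ev l (hmul a2 b) *: S a1) a.
Proof.
move=> left_l.
transitivity (sweedler2 (fun a1 w => sweedler2 (fun a2 a3 => sweedler2 (fun b1 b2 =>
    ev l (hmul a3 b2) *: hmul (S a1) (hmul a2 b1)) b) w) a).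
  rewrite -(sw_coassoc hopf); [|lin..].
  rewrite -[LHS](sw_counitl hopf (G := fun z => sweedler2 (fun b1 b2 => ev l (hmul z b2) *:
    b1) b)); last by lin.
  apply: eq_sw => w a3; rewrite [RHS]sw_exchange -sw_const_scale.
  apply: eq_sw => b1 b2.
  rewrite -[in LHS](hmul1l hopf b1).
  rewrite -[LHS](sw_antipl hopf (G := fun z => ev l (hmul a3 b2) *: hmul z b1)); last by lin.
  by apply: eq_sw => a1 a2; rewrite (hmulA hopf).
apply: eq_sw => a1 w.
rewrite -(sw_mul hopf (F := fun x y => ev l y *: hmul (S a1) x)); [|lin..].
under eq_sw => x y do rewrite -hmulZr.
rewrite (sw_linl (G := fun z => hmul (S a1) z)); last by lin.
by rewrite left_l hmulZr (hmul1r hopf).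
Qed.

End LeftIntegral.

Section Integrals.
Variables (k : fieldType) (H : hopf_data k).
Hypothesis hopf : is_hopf_algebra H.
Variable L : H.
Hypothesis left_L : left_integral L.
Hypothesis right_L : right_integral L.
Hypothesis epsL : eps L = 1.
Local Notation S := (antip H).
Local Notation lam := (tr_int H).

Lemma lam_left : dual_left_integral lam.
Proof. exact: tr_int_left. Qed.

(** As L is a right integral, y |-> L S^2(y) is the rank one map y |-> eps(y) L, of trace eps(L). *)
Lemma lamL : ev lam L = 1.
Proof.
rewrite tr_intE -epsL -[RHS](ltrace_rank1 (counit H)).
by apply: eq_ltrace => y; rewrite right_L !(epsS hopf).
Qed.

(** Cyclicity of the trace: S^2 is the Nakayama automorphism of the form lam(ab). *)
Lemma lam_mulC a b : ev lam (hmul a b) = ev lam (hmul b (S (S a))).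
Proof.
rewrite !tr_intE.
transitivity (ltrace (fun y => hmul a (hmul b (S (S y))))).
  by apply: eq_ltrace => y; rewrite (hmulA hopf).
rewrite (ltraceC (f := hmul a) (g := fun y => hmul b (S (S y)))); [|lin..].
by apply: eq_ltrace => y; rewrite !(antipM hopf) (hmulA hopf).
Qed.

(** The legs of Delta(L), with S on the first, are dual bases for the form lam(ab). It is the shift
    lemma with a = L, where L absorbs b_2. *)
Lemma integral_dual_basis b :
  sweedler2 (fun l1 l2 => ev lam (hmul l2 b) *: S l1) L = b.
Proof.
rewrite -(dual_left_integral_shift hopf _ _ lam_left).
under eq_sw => b1 b2 do rewrite right_L evZ lamL mulr1.
exact: (sw_counitr hopf (G := fun z => z)).
Qed.

(** The reproducing formula just proved puts every b into the image of S, and the dimension is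
    finite. From here on [antip_inv] is a genuine inverse. *)
Lemma antip_lker : lker S == 0%VS.
Proof.
have : limg S = fullv.
  apply/eqP; rewrite eqEsubv subvf; apply/subvP => b _.
  rewrite -(integral_dual_basis b).
  under eq_sw => x y do rewrite -linearZ.
  rewrite (sw_linl (G := fun z => S z)); last by lin.
  by apply: memv_img; exact: memvf.
move=> im; have := limg_ker_dim S fullv.
rewrite im capfv => /eqP; rewrite -[X in _ == X]add0n eqn_add2r => /eqP d0.
by rewrite -dimv_eq0 d0.
Qed.

Lemma antipK a : antip_inv H (S a) = a.
Proof. by rewrite /antip_inv lker0_lfunK // antip_lker. Qed.

Lemma integral_antip a :
  sweedler2 (fun l1 l2 => ev lam (hmul a l2) *: l1) L = S a.
Proof.
rewrite (dual_left_integral_shift hopf _ _ lam_left).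
under eq_sw => b1 b2 do rewrite left_L evZ lamL mulr1.
by rewrite (sw_counitr hopf (G := fun z => S z)) //; lin.
Qed.

Lemma lam_nondegr c : (forall a, ev lam (hmul c a) = 0) -> c = 0.
Proof.
move=> c0; rewrite -(antipK c) -(integral_antip c).
under eq_sw => b1 b2 do rewrite c0.
by rewrite sw_const_scale scale0r linear0.
Qed.

(** The dual bases give l = lam(c -) for some c. Reading the integral property of l at L through
    [integral_antip] gives S(c) = l(L) 1, so c is that scalar. *)
Lemma dual_left_integral_unique l h : dual_left_integral l ->
  ev l h = ev l L * ev lam h.
Proof.
move=> left_l.
pose c := sweedler2 (fun l1 l2 => ev l (S l1) *: l2) L.
have lE a : ev l a = ev lam (hmul c a).
  rewrite -{1}(integral_dual_basis a) (sw_lin (G := fun z => ev l z : k^o)); last by lin.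
  rewrite (sw_lin (G := fun z => ev lam (hmul z a) : k^o)); last by lin.
  apply: (eq_sw (W := k^o)) => l1 l2.
  by rewrite hmulZl !evZ mulrC.
have Sc : S c = ev l L *: hone H.
  rewrite -left_l; under [RHS]eq_sw => l1 l2 do rewrite lE.
  by rewrite integral_antip.
by rewrite lE -(antipK c) Sc linearZ /= -{1}(antip1 hopf) antipK hmulZl
  (hmul1l hopf) evZ.
Qed.

Definition modular := sweedler2 (fun l1 l2 => ev lam l1 *: l2) L.
Local Notation g := modular.

(** For each functional f, the map h |-> lam(h_1) f(h_2) is again a left integral, hence a multiple
    of lam by uniqueness; [g] is the distinguished grouplike element. *)
Lemma lam_right h : sweedler2 (fun h1 h2 => ev lam h1 *: h2) h = ev lam h *: g.
Proof.
apply: ev_ext => f.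
pose l : 'Hom(H, k^o) := linfun (fun h : H =>
  ev f (sweedler2 (fun h1 h2 => ev lam h1 *: h2) h) : k^o).
have lE a : ev l a = ev f (sweedler2 (fun h1 h2 => ev lam h1 *: h2) a).
  by rewrite /ev lin_lfunE //; lin.
rewrite -lE dual_left_integral_unique.
  by rewrite lE evZ mulrC.
move=> {}h.
transitivity (sweedler2 (fun h1 w => sweedler2 (fun p q => (ev f q * ev lam p) *: h1) w) h).
  apply: eq_sw => h1 h2; rewrite lE (sw_lin (G := fun z => ev f z : k^o)); last by lin.
  rewrite (sw_lin (G := fun z : k^o => (z : k) *: h1)); last by lin.
  by apply: eq_sw => p q; rewrite evZ mulrC.
rewrite -(sw_coassoc hopf); [|lin..].
rewrite lE (sw_lin (G := fun z => ev f z : k^o)); last by lin.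
rewrite (sw_lin (G := fun z : k^o => (z : k) *: hone H)); last by lin.
apply: eq_sw => w q.
under eq_sw => u v do rewrite -scalerA.
rewrite sw_const_scale lam_left scalerA.
by rewrite evZ mulrC.
Qed.

Lemma modular_grouplike : grouplike g.
Proof.
split; last first.
  rewrite -lamL /g (sw_lin (G := fun z : H => eps z : k^o)); last by lin.
  rewrite -[RHS](sw_counitr hopf (G := fun z => ev lam z : k^o)); last by lin.
  by apply: (eq_sw (W := k^o)) => x y; rewrite epsZ mulrC.
rewrite {1}/g (sw_lin (G := fun z => comul H z)); last by lin.
transitivity (sweedler2 (fun l1 w => sweedler2 (fun p q => ev lam l1 *: (p \ox q)) w) L).
  apply: eq_sw => l1 w; rewrite linearZ /= sw_const_scale; congr (_ *: _).
  by rewrite [LHS](lin_tliftE (G := fun z => z)).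
rewrite -(sw_coassoc hopf); [|lin..].
transitivity (sweedler2 (fun w q => ev lam w *: (g \ox q)) L).
  apply: eq_sw => w q.
  rewrite -(linZ (f := fun z => z \ox q)); last by lin.
  rewrite -lam_right (sw_lin (G := fun z => z \ox q)); last by lin.
  by apply: eq_sw => l1 p; rewrite (linZ (f := fun z => z \ox q)) //; lin.
rewrite {3}/g (sw_lin (G := fun z => g \ox z)); last by lin.
by apply: eq_sw => l1 p; rewrite (linZ (f := fun z => g \ox z)) //; lin.
Qed.

(** This lemma and the next evaluate the form on Delta(L) with a factor on either side of l_1. Since
    lam(S(d) l_1) = lam(l_1 S^3(d)), comparing them yields d g = g S^4(d). *)
Lemma integral_modularl d :
  sweedler2 (fun l1 l2 => ev lam (hmul (S d) l1) *: l2) L = hmul d g.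
Proof.
transitivity (sweedler2 (fun d1 w => sweedler2 (fun d2 d3 =>
  sweedler2 (fun l1 l2 => ev lam (hmul (S d3) l1) *: hmul d1 (hmul (S d2) l2)) L)
   w) d).
  rewrite -(sw_coassoc hopf); [|lin..].
  rewrite -[LHS](sw_counitl hopf (G := fun z => sweedler2 (fun l1 l2 => ev lam (hmul (S z)
    l1) *: l2) L)); last by lin.
  apply: eq_sw => w d3; rewrite [RHS]sw_exchange -sw_const_scale.
  apply: eq_sw => l1 l2.
  rewrite -[in LHS](hmul1l hopf l2).
  rewrite -[LHS](sw_antipr hopf (G := fun z => ev lam (hmul (S d3) l1) *: hmul z l2));
    last by lin.
  by apply: eq_sw => a1 a2; rewrite (hmulA hopf).
rewrite -[RHS](sw_counitr hopf (G := fun z => hmul z g)); last by lin.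
apply: eq_sw => d1 w.
have -> : eps w *: hmul d1 g = hmul d1 (ev lam (hmul (S w) L) *: g).
  by rewrite left_L evZ lamL mulr1 (epsS hopf) hmulZr.
rewrite -lam_right (sw_lin (G := fun z => hmul d1 z)); last by lin.
rewrite (sw_mul hopf); [|lin..].
rewrite (sw_antip hopf); [|lin..].
by do 2![apply: eq_sw => ? ?]; rewrite hmulZr.
Qed.

Lemma integral_modularr b :
  sweedler2 (fun l1 l2 => ev lam (hmul l1 b) *: l2) L = hmul g (S b).
Proof.
transitivity (sweedler2 (fun w b3 => sweedler2 (fun b1 b2 =>
  sweedler2 (fun l1 l2 => ev lam (hmul l1 b1) *: hmul (hmul l2 b2) (S b3)) L)
   w) b).
  rewrite (sw_coassoc hopf); [|lin..].
  rewrite -[LHS](sw_counitr hopf (G := fun z => sweedler2 (fun l1 l2 => ev lam (hmul l1 z)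
    *: l2) L)); last by lin.
  apply: eq_sw => b1 w; rewrite [RHS]sw_exchange -sw_const_scale.
  apply: eq_sw => l1 l2.
  rewrite -[in LHS](hmul1r hopf l2).
  rewrite -[LHS](sw_antipr hopf (G := fun z => ev lam (hmul l1 b1) *: hmul l2 z)); last by lin.
  by apply: eq_sw => a1 a2; rewrite (hmulA hopf).
rewrite -[RHS](sw_counitl hopf (G := fun z => hmul g (S z))); last by lin.
apply: eq_sw => w b3.
have -> : eps w *: hmul g (S b3) = hmul (ev lam (hmul L w) *: g) (S b3).
  by rewrite right_L evZ lamL mulr1 hmulZl.
rewrite -lam_right (sw_lin (G := fun z => hmul z (S b3))); last by lin.
rewrite (sw_mul hopf); [|lin..].
rewrite sw_exchange.
by do 2![apply: eq_sw => ? ?]; rewrite hmulZl.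
Qed.

(* Radford's formula for the fourth power of the antipode, in the unimodular
   case. *)
Lemma antip4 d : hmul d g = hmul g (S (S (S (S d)))).
Proof.
rewrite -integral_modularl -integral_modularr.
by apply: eq_sw => l1 l2; rewrite lam_mulC.
Qed.

(** Iterating Radford's formula gives d g^n = g^n S^(4n)(d), and g has finite order. *)
Lemma antip_finite_order : exists2 n, (0 < n)%N &
  forall d, iter n (fun x => S (S (S (S x)))) d = d.
Proof.
have [n n_gt0 gn] := grouplike_torsion hopf modular_grouplike.
exists n => // d.
suff : hmul d (hpow g n) = hmul (hpow g n) (iter n (fun x => S (S (S (S x)))) d).
  by rewrite gn (hmul1l hopf) (hmul1r hopf).
elim: n d {n_gt0 gn} => [|n IHn] d; first by rewrite (hmul1l hopf) (hmul1r hopf).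
rewrite [hpow g _]/= -/(hpow g n) (hmulA hopf) antip4 -(hmulA hopf) IHn iterSr.
by rewrite (hmulA hopf).
Qed.

End Integrals.

(** * Sums of roots of unity *)

Section RootsOfUnity.
Import Num.Theory.
Variables (k : closedFieldType) (char_k : [pchar k] =i pred0).

Lemma natr_neq0 n : (0 < n)%N -> n%:R != 0 :> k.
Proof. by move=> n0; move/pcharf0P: char_k => ->; rewrite -lt0n. Qed.

Lemma prim_root_exists n : (0 < n)%N -> exists z : k, n.-primitive_root z.
Proof.
pose p : {poly k} := 'X^n - 1; have [r Dp] := closed_field_poly_normal p.
move=> n_gt0; rewrite (monicP _) ?monicXnsubC // scale1r in Dp.
have rn1: all n.-unity_root r by apply/allP=> z; rewrite -root_prod_XsubC -Dp.
have sz_r: (n < (size r).+1)%N.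
  by rewrite -(size_prod_XsubC r id) -Dp size_XnsubC.
have [|z] := hasP (has_prim_root n_gt0 rn1 _ sz_r); last by exists z.
by rewrite -separable_prod_XsubC -Dp separable_Xn_sub_1 // natr_neq0.
Qed.

Lemma intr_neq0 (a : int) : a != 0 -> a%:~R != 0 :> k.
Proof.
have n0 n : (n.+1)%:R != 0 :> k by exact: natr_neq0.
by case: a => [[|n]|n] //= _; rewrite ?NegzE ?rmorphN ?oppr_eq0 /= -pmulrn n0.
Qed.

(* A common root in [k] of two integer polynomials shows that they are not
   coprime over the rationals, hence have a common root in [algC]. *)
Lemma common_root_algC (p q : {poly int}) (x : k) :
  q != 0 -> root (map_poly intr p) x -> root (map_poly intr q) x ->
  exists z : algC, root (map_poly intr p) z && root (map_poly intr q) z.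
Proof.
move=> q0 px qx.
pose pQ : {poly rat} := map_poly intr p; pose qQ : {poly rat} := map_poly intr q.
have ncop : ~~ coprimep pQ qQ.
  apply/Bezout_eq1_coprimepP => -[[u v] /= uv].
  have [u' [a a0 uE]] := rat_poly_scale u.
  have [v' [b b0 vE]] := rat_poly_scale v.
  have uE' : map_poly intr u' = a%:~R *: u.
    by rewrite uE scalerA divff ?scale1r // intr_eq0.
  have vE' : map_poly intr v' = b%:~R *: v.
    by rewrite vE scalerA divff ?scale1r // intr_eq0.
  have E : b *: (u' * p) + a *: (v' * q) = (a * b)%:P.
    apply: (map_inj_poly (f := intr : int -> rat)) => //; first exact: intr_inj.
    rewrite rmorphD /=. rewrite !map_polyZ.
      rewrite /= [map_poly _ (_ * p)]rmorphM [map_poly _ (_ * q)]rmorphM /= map_polyC /=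
        rmorphM /=.
    rewrite -/pQ -/qQ uE' vE' -!scalerAl !scalerA mulrC -scalerDr uv.
    by rewrite alg_polyC.
  have := congr1 (fun r => (map_poly intr r : {poly k}).[x]) E.
  rewrite rmorphD /= !map_polyZ /= [map_poly _ (_ * p)]rmorphM [map_poly _ (_ * q)]rmorphM.
  rewrite /= map_polyC /= hornerD !hornerZ !hornerM hornerC (rootP px) (rootP qx).
  rewrite !mulr0 addr0 => /esym/eqP.
  by rewrite (negPf (intr_neq0 _)) // mulf_neq0.
pose toC : {rmorphism rat -> algC} := ratr.
have mapE (r : {poly int}) : map_poly toC (map_poly intr r) = map_poly intr r.
  by rewrite -map_poly_comp; apply: eq_map_poly => a; exact: ratr_int.
have /closed_rootP[z] : size (gcdp (map_poly toC pQ) (map_poly toC qQ)) != 1%N.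
  by rewrite -gcdp_map size_map_poly; rewrite coprimep_def in ncop.
by rewrite root_gcd !mapE; exists z.
Qed.

(** Within a class all a_i are one scalar times powers z^(e_i) of a root of unity, so the sum is
    p(z) for an integer polynomial p. If it vanished, p would also vanish at some w in [algC] with
    w^m = 1, where inverse is conjugation and p(w) is a sum of squared norms; the class of i0
    contributes |w^(e_i0)|^2 = 1. *)
Lemma gram_sum_neq0 (I : finType) (R : rel I) (a : I -> k) (m : nat) (i0 : I) :
  reflexive R -> symmetric R -> transitive R -> (0 < m)%N ->
  (forall i, a i != 0) -> (forall i j, R i j -> (a j / a i) ^+ m = 1) ->
  (forall j, R i0 j -> j = i0) ->
  \sum_i \sum_(j | R i j) a j / a i != 0.
Proof.
move=> Rr Rs Rt m_gt0 a0 am i0P.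
pose rep i := odflt i [pick j | R i j].
have rep_R i : R i (rep i).
  by rewrite /rep; case: pickP => //= /(_ i); rewrite Rr.
have RE i j : R i j = (rep i == rep j).
  apply/idP/eqP => [Rij|rij].
    rewrite /rep (eq_pick (Q := R j)); last first.
      by move=> l; apply/idP/idP; [rewrite Rs in Rij|]; exact: Rt.
    by case: pickP => //= /(_ j); rewrite Rr.
  by apply: Rt (rep_R i) _; rewrite rij Rs.
have [z prim_z] := prim_root_exists m_gt0.
have /fin_all_exists[e eE] i : exists e : 'I_m, a i = a (rep i) * z ^+ e.
  have Ri : R (rep i) i by rewrite Rs.
  by have [e E] := prim_rootP prim_z (am _ _ Ri); exists e; rewrite -E mulrC divfK.
have z0 : z != 0.
  by apply/eqP => z0; have := prim_expr_order prim_z; rewrite z0 expr0n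
    (gtn_eqF m_gt0) => /eqP; rewrite eq_sym oner_eq0.
(* The exponent m - e_i stands for -e_i, legitimate at every m-th root of unity; [hornerp] is stated
   over any field so as to serve in [k] and in [algC]. *)
pose p : {poly int} := \sum_i \sum_(j | R i j) 'X^(e j + (m - e i)).
have hornerp (F : fieldType) (x : F) : x ^+ m = 1 ->
    (map_poly intr p).[x] = \sum_i \sum_(j | R i j) x ^+ e j / x ^+ e i.
  move=> xm; rewrite rmorph_sum horner_sum; apply: eq_bigr => i _.
  rewrite rmorph_sum horner_sum; apply: eq_bigr => j _.
  rewrite /= map_polyXn hornerXn exprD; congr (_ * _).
  have x0 : x != 0.
    by apply/eqP => x0; move/eqP: xm; rewrite x0 expr0n (gtn_eqF m_gt0) eq_sym oner_eq0.
  apply: (mulfI (expf_neq0 (e i) x0)).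
  by rewrite -exprD subnKC ?xm ?mulfV ?expf_neq0 // ltnW.
have zm := prim_expr_order prim_z.
apply/negP => sum0.
have pz : root (map_poly intr p) z.
  rewrite /root hornerp //; apply: etrans sum0; congr (_ == _).
  apply: eq_bigr => i _; apply: eq_bigr => j; rewrite RE => /eqP rij.
  by rewrite (eE i) (eE j) rij -mulf_div divff ?mul1r.
(* The root w need not be primitive: |w| = 1 suffices. *)
have [||w /andP[pw]] := @common_root_algC p ('X^m - 1) z _ pz.
- by rewrite -size_poly_eq0 size_XnsubC.
- by rewrite rmorphB /= map_polyXn rmorph1 /root !hornerE zm subrr.
rewrite rmorphB /= map_polyXn rmorph1 /root !hornerE subr_eq0 => /eqP wm.
have nw : `|w| = 1.
  have : `|w| ^+ m = 1 by rewrite -normrX wm normr1.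
  by move/eqP; rewrite pexpr_eq1 // => /eqP.
have wV n : (w ^+ n)^-1 = (w ^+ n)^*.
  by rewrite invC_norm normrX nw !expr1n invr1 mul1r.
have w0 : w != 0 by rewrite -normr_eq0 nw oner_eq0.
pose T r := \sum_(i | rep i == r) w ^+ e i.
have sumT : \sum_r `|T r| ^+ 2 = 0.
  rewrite -[RHS](rootP pw) (hornerp _ _ wm).
  rewrite [RHS](partition_big rep xpredT) //=. apply: eq_big => // r _.
  rewrite normCKC rmorph_sum mulr_suml; apply: eq_big => // i /eqP ri.
  rewrite mulr_sumr; apply: eq_big => [j|j _]; first by rewrite RE ri eq_sym.
  by rewrite wV mulrC.
have := psumr_eq0P (fun r _ => exprn_ge0 2 (normr_ge0 (T r))) sumT (i := rep i0) isT.
move=> /eqP; rewrite expf_eq0 normr_eq0 /= /T (big_pred1 i0) ?expf_eq0 ?(negPf w0) ?andbF //.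
move=> i /=; rewrite eq_sym -RE; apply/idP/eqP => [/i0P//|->]; exact: Rr.
Qed.
End RootsOfUnity.

(** * Idempotents of von Neumann regular algebras *)

Section LinearAlgebra.
Variable k : fieldType.

Definition lmx (V : vectType k) (f : V -> V) : 'M[k]_(\dim {:V}) :=
  \matrix_(i, j) ev (cb j) (f (vb i)).

Lemma lmx_vb (V : vectType k) (f : V -> V) (v : 'rV[k]_(\dim {:V})) :
  lin f -> f (\sum_i v 0 i *: vb i) = \sum_j (v *m lmx f) 0 j *: vb j.
Proof.
move=> hf; rewrite (lin_sum _ hf).
transitivity (\sum_i \sum_j (v 0 i * lmx f i j) *: vb j).
  apply: eq_bigr => i _; rewrite (linZ _ _ hf) {1}[f _]vb_sum scaler_sumr.
  by apply: eq_bigr => j _; rewrite scalerA mxE.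
rewrite exchange_big; apply: eq_bigr => j _ /=.
by rewrite -scaler_suml mxE.
Qed.

Lemma lmxM (V : vectType k) (f g : V -> V) : lin f -> lin g ->
  lmx (fun v => f (g v)) = lmx g *m lmx f.
Proof.
move=> hf hg; apply/matrixP => i j; rewrite !mxE.
rewrite (lin_vb_sum (F := fun v => ev (cb j) (f v) : k^o)); last by lin.
by apply: eq_bigr => l _; rewrite !mxE.
Qed.

(** In a full rank factorization A = CR, idempotence forces RC = 1, an identity matrix of size rank
    A. *)
Lemma idempotent_mxtrace n (A : 'M[k]_n) : A *m A = A -> \tr A = (\rank A)%:R.
Proof.
move=> AA; rewrite -{1}(mulmx_base A) mxtrace_mulC.
suff -> : row_base A *m col_base A = 1%:M by rewrite mxtrace1.
apply: (row_full_inj (col_base_full A)).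
apply: (row_free_inj (row_base_free A)).
have CR := mulmx_base A; set C := col_base A in CR *; set R := row_base A in CR *.
by rewrite mulmx1 mulmxA -mulmxA CR AA.
Qed.

Lemma ltrace_idempotent (V : vectType k) (P : V -> V) :
  [pchar k] =i pred0 -> lin P -> (forall v, P (P v) = P v) ->
  ltrace P = 0 -> forall v, P v = 0.
Proof.
move=> char_k hP PP tr0 v.
have : \tr (lmx P) = 0.
  by rewrite -tr0 /ltrace /mxtrace; apply: eq_bigr => i _; rewrite mxE.
rewrite idempotent_mxtrace; last first.
  by rewrite -lmxM //; apply/matrixP => i j; rewrite !mxE PP.
move/pcharf0P: char_k => char_k /eqP; rewrite char_k mxrank_eq0 => /eqP P0.
rewrite [v]vb_sum (lin_sum _ hP) big1 // => i _.
rewrite (linZ _ _ hP) [P _]vb_sum big1 ?scaler0 // => j _.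
by have /matrixP/(_ i j) := P0; rewrite !mxE => ->; rewrite scale0r.
Qed.

End LinearAlgebra.

Lemma eigenvector_closed (k : closedFieldType) (V : vectType k) (f : V -> V)
    (U : {vspace V}) : lin f -> U != 0%VS -> (forall v, v \in U -> f v \in U) ->
  exists a v, [/\ v \in U, v != 0 & f v = a *: v].
Proof.
move=> hf U0 fU.
pose W : vectType k := subvs_of U.
pose g (x : W) : W := vsproj U (f (vsval x)).
have hg : lin g by move=> a x y; rewrite /g linearP hf linearP.
have n_gt0 : (0 < \dim {:W})%N by rewrite dimvf /dim /= lt0n dimv_eq0.
have /closed_rootP[a] : size (char_poly (lmx g)) != 1%N.
  by rewrite size_char_poly eqSS -lt0n.
rewrite -eigenvalue_root_char => /eigenvalueP[v vg v0].
pose w : W := \sum_i v 0 i *: vb i.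
have gw : g w = a *: w.
  rewrite lmx_vb // vg scaler_sumr; apply: eq_bigr => i _.
  by rewrite mxE scalerA.
exists a, (vsval w); split.
- exact: subvsP.
- apply: contraNneq v0 => w0; apply/eqP/rowP => i; rewrite mxE.
  have {}w0 : w = 0 by apply: val_inj.
  have := congr1 (ev (cb i)) w0; rewrite {2}/ev linear0 => <-.
  rewrite (lin_sum (f := fun z => ev (cb i) z : k^o)); last by lin.
  rewrite (bigD1 i) //= evZ ev_vb eqxx mulr1 big1 ?addr0 // => j /negPf ji.
  by rewrite evZ ev_vb ji mulr0.
have := congr1 vsval gw; by rewrite /g vsprojK ?fU ?subvsP // => ->.
Qed.

Section Idempotents.
Variables (k : closedFieldType) (H : hopf_data k).
Hypothesis hopf : is_hopf_algebra H.
(** To be instantiated by the fixed points of S^2. Regularity is required inside [P], with the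
    quasi-inverse fixed as well. *)
Variable P : H -> Prop.
Hypothesis PM : forall x y, P x -> P y -> P (hmul x y).
Hypothesis PB : forall x y c, P x -> P y -> P (x - c *: y).
Hypothesis P_regular : forall x, P x -> exists2 y, P y & x = hmul (hmul x y) x.

Local Infix "·" := hmul (at level 40, left associativity).

(** Primitivity relative to [P], in the form valid over an algebraically closed field: the corner f
    P f is the line through f. *)
Definition primitive (f : H) : Prop :=
  [/\ P f, f · f = f, f != 0 &
      forall x, P x -> exists c, f · x · f = c *: f].

Definition lmulH (e : H) : 'End(H) := linfun (hmul e).
Lemma lmulHE e x : lmulH e x = e · x.
Proof. by rewrite lin_lfunE //; lin. Qed.

(* A corner [e P e] that is not [k e] contains a proper idempotent: regularity
   produces one from [w - a e], where [w] is not scalar and [a] is an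
   eigenvalue of the left multiplication by [w] on [e H]. *)
Lemma split_idempotent e : P e -> e · e = e -> e != 0 -> ~ primitive e ->
  exists f, [/\ P f, f · f = f, e · f = f, f · e = f & f != 0 /\ f != e].
Proof.
move=> Pe ee e0 not_prim.
have [x Px Nx] : exists2 x, P x & ~ (exists c, e · x · e = c *: e).
  apply: NNPP => N; apply: not_prim; split=> // x Px.
  by apply: NNPP => Nx; apply: N; exists x.
pose w := e · x · e.
have ew : e · w = w by rewrite /w !(hmulA hopf) ee.
have we : w · e = w by rewrite /w -(hmulA hopf) ee.
have Pw : P w by do 2!apply: PM => //.
have eU v : (v \in limg (lmulH e)) = (e · v == v).
  apply/idP/eqP => [/memv_imgP[y _ ->]|<-]; first by rewrite lmulHE (hmulA hopf) ee.
  by rewrite -lmulHE memv_img ?memvf.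
have [|||a [v [Uv v0 wv]]] := @eigenvector_closed k H (hmul w) (limg (lmulH e)).
- by lin.
- by apply: contraNneq e0 => U0; have := eU e; rewrite U0 memv0 ee eqxx => ->.
- by move=> v _; rewrite eU (hmulA hopf) ew.
pose n := w - a *: e.
have Pn : P n by apply: PB.
have nv : n · v = 0.
  by move: Uv; rewrite eU /n hmulBl hmulZl wv => /eqP->; rewrite subrr.
have en : e · n = n by rewrite /n hmulBr hmulZr ew ee.
have ne : n · e = n by rewrite /n hmulBl hmulZl we ee.
have n0 : n != 0.
  by rewrite /n subr_eq0; apply/eqP => wE; apply: Nx; exists a.
have [y Py ny] := P_regular Pn.
exists (e · y · n); split.
- by do 2!apply: PM => //.
- by rewrite -!(hmulA hopf) (hmulA hopf n) ne (hmulA hopf n) -ny.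
- by rewrite !(hmulA hopf) ee.
- by rewrite -!(hmulA hopf) ne.
split.
  apply: contraNneq n0 => f0.
  by rewrite ny -(hmulA hopf) -{1}ne -!(hmulA hopf) (hmulA hopf e) f0 hmul0r.
(* The idempotent e y n kills the eigenvector v, since n v = 0, whereas e fixes it. *)
apply: contraNneq v0 => fe.
by move: Uv; rewrite eU => /eqP <-; rewrite -fe -(hmulA hopf) nv hmul0r.
Qed.

(** Induction on dim eH, which drops for both f and e - f. The absorption clause e f_i = f_i = f_i e
    is carried along so that members of the two halves are orthogonal to each other. *)
Lemma primitive_decomposition e : P e -> e · e = e ->
  exists (I : finType) (f : I -> H),
    [/\ forall i, primitive (f i), forall i j, i != j -> f i · f j = 0,
        \sum_i f i = e & forall i, e · f i = f i /\ f i · e = f i].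
Proof.
have [n] := ubnP (\dim (limg (lmulH e))).
elim: n e => // n IHn e dim_e Pe ee.
have [->|e0] := eqVneq e 0.
  exists void, (fun i : void => match i with end); split; try by case.
  by rewrite big_pred0 // => -[].
have [pe|npe] := classic (primitive e).
  exists unit, (fun _ => e); split=> //; last first.
    by rewrite (big_pred1 tt) // => -[].
have [f [Pf ff ef fe [f0 fNe]]] := split_idempotent Pe ee e0 npe.
(* The scalar 1 gives e - f the shape of [PB]. *)
pose g := e - 1 *: f.
have gE : g = e - f by rewrite /g scale1r.
have Pg : P g by apply: PB.
have eg : e · g = g by rewrite gE hmulBr ee ef.
have ge : g · e = g by rewrite gE hmulBl ee fe.
have fg : f · g = 0 by rewrite gE hmulBr fe ff subrr.
have gf : g · f = 0 by rewrite gE hmulBl ef ff subrr.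
have gg : g · g = g by rewrite {2}gE hmulBr ge gf subr0.
have g0 : g != 0 by rewrite gE subr_eq0 eq_sym.
have dim_lt f' g' : e · f' = f' -> e · g' = g' -> f' · f' = f' ->
    f' · g' = 0 -> g' != 0 ->
    (\dim (limg (lmulH f')) < n)%N.
  move=> ef' eg' ff' fg' g'0.
  have sub : (limg (lmulH f') <= limg (lmulH e))%VS.
    apply/subvP => _ /memv_imgP[y _ ->].
    by rewrite lmulHE -ef' -(hmulA hopf) -lmulHE memv_img ?memvf.
  rewrite -ltnS; apply: leq_trans dim_e; rewrite ltnS.
  rewrite ltn_neqAle dimvS // andbT; apply: contra g'0 => dim_eq.
  have eqU : limg (lmulH f') = limg (lmulH e).
    by apply/eqP; rewrite -(geq_leqif (dimv_leqif_eq sub)) (eqP dim_eq).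
  have : g' \in limg (lmulH f') by rewrite eqU -eg' -lmulHE memv_img ?memvf.
  by move=> /memv_imgP[y _]; rewrite lmulHE => gy; move: fg';
     rewrite {1}gy (hmulA hopf) ff' -gy => ->.
have [I1 [f1 [p1 o1 s1 r1]]] := IHn f (dim_lt _ _ ef eg ff fg g0) Pf ff.
have [I2 [f2 [p2 o2 s2 r2]]] := IHn g (dim_lt _ _ eg ef gg gf f0) Pg gg.
exists (I1 + I2)%type, (fun i => match i with inl a => f1 a | inr b => f2 b end).
split.
- by case.
- move=> [i|i] [j|j] ij.
  + by apply: o1; apply: contra ij => /eqP->.
  + by rewrite -(proj2 (r1 i)) -(proj1 (r2 j)) (hmulA hopf) -(hmulA hopf _ f) fg hmul0r hmul0l.
  + by rewrite -(proj2 (r2 i)) -(proj1 (r1 j)) (hmulA hopf) -(hmulA hopf _ g) gf hmul0r hmul0l.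
  + by apply: o2; apply: contra ij => /eqP->.
- by rewrite big_sumType /= s1 s2 gE addrC subrK.
case=> [i|i]; split.
- by rewrite -(proj1 (r1 i)) (hmulA hopf) ef.
- by rewrite -(proj2 (r1 i)) -(hmulA hopf) fe.
- by rewrite -(proj1 (r2 i)) (hmulA hopf) eg.
- by rewrite -(proj2 (r2 i)) -(hmulA hopf) ge.
Qed.

End Idempotents.

(** * The trace of the square of the antipode *)

Section LarsonRadford.
Variables (k : closedFieldType) (char_k : [pchar k] =i pred0).
Variable H : hopf_data k.
Hypothesis hopf : is_hopf_algebra H.
Hypothesis regular_H : regular H.
Variable L : H.
Hypothesis left_L : left_integral L.
Hypothesis right_L : right_integral L.
Hypothesis epsL : eps L = 1.
Local Notation S := (antip H).
Local Notation lam := (tr_int H).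
Local Infix "·" := hmul (at level 40, left associativity).

Let chi (a : H) : k := ltrace (fun y => a · y).

(** With a = aya, left multiplication by ay is idempotent of trace chi(ay) = 0, hence zero in
    characteristic zero; its value at a is a. *)
Lemma chi_nondeg a : (forall b, chi (a · b) = 0) -> a = 0.
Proof.
move=> chi0; have [y ay] := regular_H a.
have e_idem v : (a · y) · (a · y · v) = a · y · v.
  by rewrite !(hmulA hopf) -ay.
have := ltrace_idempotent char_k _ e_idem (chi0 y) a.
by rewrite -ay; apply; lin.
Qed.

(* [S^2] is inner because both the trace of the regular representation and the
   integral [lam] are nondegenerate. *)
Lemma antip2_inner : exists c u : H,
  [/\ c · u = hone H, u · c = hone H & forall a, c · S (S a) = a · c].
Proof.
pose chi' : 'Hom(H, k^o) := linfun (fun a : H => chi a : k^o).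
have chiE a : ev chi' a = chi a.
  by rewrite /ev lin_lfunE // /chi; apply: lin_ltracel; lin.
have chiC a b : chi (a · b) = chi (b · a).
  transitivity (ltrace (fun y => a · (b · y))).
    by apply: eq_ltrace => y; rewrite (hmulA hopf).
  rewrite (ltraceC (f := hmul a) (g := hmul b)); [|lin..].
  by apply: eq_ltrace => y; rewrite (hmulA hopf).
pose c := sweedler2 (fun l1 l2 => ev chi' (S l1) *: l2) L.
have chi_lam a : chi a = ev lam (c · a).
  rewrite -chiE -{1}(integral_dual_basis hopf right_L epsL a).
  rewrite (sw_lin (G := fun z => ev chi' z : k^o)); last by lin.
  rewrite (sw_lin (G := fun z => ev lam (hmul z a) : k^o)); last by lin.
  apply: (eq_sw (W := k^o)) => l1 l2.
  by rewrite hmulZl !evZ mulrC.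
have c_inj x : c · x = 0 -> x = 0.
  move=> cx; apply: chi_nondeg => b.
  by rewrite chi_lam (hmulA hopf) cx hmul0l ev0.
have lker_c : lker (lmulH c) == 0%VS.
  rewrite -subv0; apply/subvP => x; rewrite memv_ker lmulHE memv0 => /eqP cx.
  by rewrite (c_inj x).
pose u := (lmulH c)^-1%VF (hone H).
have cu : c · u = hone H by rewrite -lmulHE lker0_lfunVK.
have uc : u · c = hone H.
  apply/eqP; rewrite -subr_eq0; apply/eqP/c_inj.
  by rewrite hmulBr (hmulA hopf) cu (hmul1l hopf) (hmul1r hopf) subrr.
exists c, u; split=> // a.
apply/eqP; rewrite -subr_eq0; apply/eqP.
apply: (lam_nondegr hopf left_L right_L epsL) => b.
rewrite hmulBl evB -!(hmulA hopf) -chi_lam chiC chi_lam (lam_mulC hopf a).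
by rewrite (hmulA hopf) subrr.
Qed.

Lemma antip2M x y : S (S (x · y)) = S (S x) · S (S y).
Proof. by rewrite !(antipM hopf). Qed.

(** Average a quasi-inverse y of x over the powers of S^2: each S^(2j)(y) is again a quasi-inverse,
    because x is fixed. There are m = 2n powers, as n counts those of S^4; dividing by m uses
    characteristic zero. *)
Lemma antip2_regular x : S (S x) = x ->
  exists2 y, S (S y) = y & x = x · y · x.
Proof.
move=> Sx; have [n n_gt0 Sn] := antip_finite_order hopf left_L right_L epsL.
pose phi j (y : H) := iter j (fun z => S (S z)) y.
have phi_n y : phi (n + n)%N y = y.
  rewrite -[RHS]Sn /phi addnn -muln2 iterM.
  by apply: eq_iter => z.
have [y xy] := regular_H x.
pose m := (n + n)%N.
have m0 : m%:R != 0 :> k by apply: natr_neq0; rewrite // addn_gt0 n_gt0.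
exists (m%:R^-1 *: \sum_(j < m) phi j y).
  have hS2 : lin (fun z => S (S z)) by lin.
  rewrite (linZ _ _ hS2) (lin_sum _ hS2); congr (_ *: _).
  apply: (addIr y); transitivity (\sum_(j < m.+1) phi j y).
    by rewrite big_ord_recl addrC.
  by rewrite big_ord_recr /= phi_n.
have xphi j : x · phi j y · x = x.
  elim: j => //= j IHj; rewrite -{1 2}Sx -!antip2M IHj.
  exact: Sx.
rewrite hmulZr hmulZl hmul_sumr hmul_suml.
under eq_bigr do rewrite xphi.
by rewrite sumr_const card_ord -scaler_nat scalerA mulVf // scale1r.
Qed.

Lemma trace_antip2_neq0 : ltrace (fun x => S (S x)) != 0.
Proof.
have [c [u [cu uc Sc]]] := antip2_inner.
have c_fixed : S (S c) = c.
  by rewrite -[LHS](hmul1l hopf) -uc -(hmulA hopf) Sc (hmulA hopf) uc (hmul1l hopf).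
(* S^2 is conjugation by c, so commuting with c gives a fixed point of S^2. *)
have comm_fixed x : x · c = c · x -> S (S x) = x.
  by move=> xc; rewrite -[LHS](hmul1l hopf) -uc -(hmulA hopf) Sc xc (hmulA hopf) uc (hmul1l
    hopf).
pose P x := S (S x) = x.
have PM x y : P x -> P y -> P (x · y) by rewrite /P antip2M => -> ->.
have PB x y a : P x -> P y -> P (x - a *: y).
  by rewrite /P => Px Py; rewrite !linearB !linearZ /= Px Py.
have P1 : P (hone H) by rewrite /P !(antip1 hopf).
have [I [f [prim_f orth_f sum_f _]]] :=
  primitive_decomposition hopf PM PB antip2_regular P1 (hmul1l hopf _).
have fP i : S (S (f i)) = f i by case: (prim_f i).
have ff i : f i · f i = f i by case: (prim_f i).
have f0 i : f i != 0 by case: (prim_f i).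
have fc i : f i · c = c · f i by rewrite -Sc fP.
have /fin_all_exists[a aE] i : exists a, c · f i = a *: f i.
  have [_ _ _ /(_ c c_fixed)[a E]] := prim_f i.
  by exists a; rewrite -E fc -(hmulA hopf) ff.
have a0 i : a i != 0.
  apply: contraNneq (f0 i) => ai.
  by rewrite -[f i](hmul1l hopf) -uc -(hmulA hopf) aE ai scale0r hmul0r.
have uE i : u · f i = (a i)^-1 *: f i.
  apply: (scalerI (a0 i)); rewrite scalerA mulfV // scale1r -hmulZr -aE.
  by rewrite (hmulA hopf) uc (hmul1l hopf).
(* Primitivity of f_i concerns fixed elements only. But c acts on f_i as the scalar a_i, on either
   side, so all of f_i H f_i commutes with c and is fixed; the whole corner is therefore a line. *)
have corner i x : exists d, f i · x · f i = d *: f i.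
  have [_ _ _ prim] := prim_f i.
  have [|d] := prim (f i · x · f i).
    apply: comm_fixed; rewrite -(hmulA hopf) fc aE hmulZr.
    by rewrite !(hmulA hopf) aE !hmulZl.
  by exists d; rewrite -p !(hmulA hopf) ff -(hmulA hopf _ (f i) (f i)) ff.
have eigen i j x : S (S (f i · x · f j)) = (a j / a i) *: (f i · x · f j).
  rewrite -[LHS](hmul1l hopf) -uc -(hmulA hopf) Sc -!(hmulA hopf) fc aE.
  by rewrite !hmulZr (hmulA hopf u) uE hmulZl scalerA.
(* A nonzero block f_i H f_j means that the idempotents are isomorphic; testing basis vectors makes
   the relation boolean. *)
pose R i j := [exists t, f i · vb t · f j != 0].
have RP i j : reflect (exists x, f i · x · f j != 0) (R i j).
  apply: (iffP existsP) => [[t ft]|[x]]; first by exists (vb t).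
  move=> fx; apply/existsP; apply: contraNT fx => /existsPn N.
  rewrite (lin_vb_sum (F := fun x => f i · x · f j)); last by lin.
  rewrite big1 // => t _; apply/eqP; rewrite scaler_eq0; apply/orP; right.
  exact/negPn/N.
have RN i j x : ~~ R i j -> f i · x · f j = 0.
  by move=> nR; apply/eqP; apply/negPn/negP => fx; case/negP: nR; apply/RP; exists x.
(* For a quasi-inverse y of x moved into f_j H f_i, the products xy and yx are nonzero idempotents
   of one-dimensional corners, hence equal to f_i and f_j. *)
have inverse i j : R i j -> exists x y,
    [/\ f i · x · f j = x, f j · y · f i = y, x · y = f i & y · x = f j].
  move=> /RP[x0 fx0].
  have [x Ex] : exists x, x = f i · x0 · f j by exists (f i · x0 · f j).
  have [y0 xy0] := regular_H x; rewrite -Ex in fx0.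
  have [y Ey] : exists y, y = f j · y0 · f i by exists (f j · y0 · f i).
  have fx : f i · x = x by rewrite Ex !(hmulA hopf) ff.
  have xf : x · f j = x by rewrite Ex -(hmulA hopf) ff.
  have fy : f j · y = y by rewrite Ey !(hmulA hopf) ff.
  have yf : y · f i = y by rewrite Ey -(hmulA hopf) ff.
  have xy : x · y · x = x.
    by rewrite Ey !(hmulA hopf) xf -(hmulA hopf _ (f i) x) fx -xy0.
  have unit_idem l e : f l · e · f l = e -> e · e = e -> e != 0 -> e = f l.
    move=> fe ee e0; have [d] := corner l e; rewrite fe => eE.
    move: e0 ee; rewrite eE hmulZl hmulZr ff scaler_eq0 negb_or => /andP[d0 fl0].
    move=> /(scalerI d0)/eqP; rewrite -subr_eq0 -{2}[f l]scale1r -scalerBl.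
    by rewrite scaler_eq0 (negPf fl0) orbF subr_eq0 => /eqP->; rewrite scale1r.
  exists x, y; split.
  - by rewrite fx xf.
  - by rewrite fy yf.
  - apply: unit_idem; first by rewrite (hmulA hopf) fx -(hmulA hopf) yf.
      by rewrite (hmulA hopf) xy.
    by apply: contraNneq fx0 => xy1; rewrite -xy xy1 hmul0l.
  - apply: unit_idem; first by rewrite (hmulA hopf) fy -(hmulA hopf) xf.
      by rewrite -(hmulA hopf) (hmulA hopf x) xy.
    by apply: contraNneq fx0 => yx1; rewrite -xy -(hmulA hopf) yx1 hmul0r.
have Rr : reflexive R.
  by move=> i; apply/RP; exists (hone H); rewrite (hmul1r hopf) ff.
have Rs : symmetric R.
  suff Rs i j : R i j -> R j i by move=> i j; apply/idP/idP; exact: Rs.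
  move=> /inverse[x [y [_ fy _ yx]]]; apply/RP; exists y; rewrite fy.
  by apply: contraNneq (f0 j) => y0; rewrite -yx y0 hmul0l.
have Rt : transitive R.
  move=> j i l /inverse[x [y [fx fy xy yx]]] /inverse[x' [y' [fx' fy' xy' yx']]].
  apply/RP; exists (x · x').
  have -> : f i · (x · x') · f l = x · x'.
    have ix : f i · x = x by rewrite -fx !(hmulA hopf) ff.
    have xl : x' · f l = x' by rewrite -fx' -(hmulA hopf) ff.
    by rewrite (hmulA hopf) ix -(hmulA hopf) xl.
  apply: contraNneq (f0 j) => xx'; rewrite -ff -{1}yx -xy' (hmulA hopf).
  by rewrite -(hmulA hopf y) xx' hmul0r hmul0l.
have [n n_gt0 Sn] := antip_finite_order hopf left_L right_L epsL.
(* S^4 acts on the block by the square of a_j / a_i, and n counts powers of S^4; hence the exponent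
   2n. *)
have ratio i j : R i j -> (a j / a i) ^+ (n + n) = 1.
  move=> /inverse[x [y [fx fy xy yx]]].
  have x0 : x != 0 by apply: contraNneq (f0 i) => x0; rewrite -xy x0 hmul0l.
  have Sx : S (S x) = (a j / a i) *: x by rewrite -fx eigen.
  have : iter n (fun z => S (S (S (S z)))) x = (a j / a i) ^+ (n + n) *: x.
    rewrite addnn; elim: (n) => [|l IHl] /=; first by rewrite scale1r.
    rewrite IHl doubleS !linearZ /= Sx !linearZ /= Sx !scalerA. by rewrite -exprS -exprSr.
  rewrite Sn => /eqP; rewrite -subr_eq0 -{1}[x]scale1r -scalerBl scaler_eq0.
  by rewrite (negPf x0) orbF subr_eq0 eq_sym => /eqP.
have [i0 ei0] : exists i0, eps (f i0) != 0.
  apply: NNPP => N; have : eps (hone H) = 0.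
    rewrite -sum_f (lin_sum (f := fun z : H => eps z : k^o)); last by lin.
    by apply: big1 => i _; apply/eqP/negPn/negP => ei; apply: N; exists i.
  by rewrite (eps1 hopf) => /eqP; rewrite oner_eq0.
(* Isomorphic idempotents xy and yx have the same counit, while distinct f_j and f_i0 have product
   0; so eps(f_i0) != 0 makes the class of i0 a singleton. *)
have i0P j : R i0 j -> j = i0.
  move=> /inverse[x [y [_ _ xy yx]]]; apply/eqP/negPn/negP => ji0.
  have := congr1 (@eps k H) (orth_f _ _ ji0).
  have ej : eps (f j) = eps (f i0) by rewrite -yx -xy !(epsM hopf) mulrC.
  by move/eqP; rewrite (epsM hopf) ej eps0 mulf_eq0 orbb (negPf ei0).
suff -> : ltrace (fun x => S (S x)) = \sum_i \sum_(j | R i j) a j / a i.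
  by apply: (gram_sum_neq0 char_k Rr Rs Rt _ a0 ratio i0P); rewrite addn_gt0 n_gt0.
transitivity (ltrace (fun x => \sum_i \sum_j S (S (f i · x · f j)))).
  apply: eq_ltrace => x.
  rewrite -{1}[x](hmul1l hopf) -[_ · x](hmul1r hopf) -sum_f.
  rewrite hmul_suml hmul_suml !linear_sum; apply: eq_bigr => i _ /=.
  by rewrite hmul_sumr !linear_sum.
rewrite ltrace_sum; apply: eq_bigr => i _; rewrite ltrace_sum.
rewrite [RHS]big_mkcond; apply: eq_bigr => j _.
transitivity ((a j / a i) * ltrace (fun x => f i · x · f j)).
  by rewrite -ltraceZ; apply: eq_ltrace => x; rewrite eigen.
have [Rij|nR] := boolP (R i j); last first.
  by rewrite /ltrace big1 ?mulr0 // => t _; rewrite RN // ev0.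
have [x [y [fx fy xy yx]]] := inverse _ _ Rij.
have x0 : x != 0 by apply: contraNneq (f0 i) => x0; rewrite -xy x0 hmul0l.
have [t xt] : exists t, ev (cb t) x != 0.
  apply: NNPP => N; case/eqP: x0; rewrite [x]vb_sum big1 // => t _.
  have [->|xt] := eqVneq (ev (cb t) x) 0; first by rewrite scale0r.
  by case: N; exists t.
pose d : 'Hom(H, k^o) := linfun (fun z => (ev (cb t) x)^-1 * ev (cb t) (f i · z · f j) : k^o).
have dE z : ev d z = (ev (cb t) x)^-1 * ev (cb t) (f i · z · f j).
  by rewrite {1}/ev lin_lfunE //; lin.
rewrite -[RHS]mulr1; congr (_ * _).
transitivity (ltrace (fun z => ev d z *: x)); last first.
  by rewrite ltrace_rank1 dE fx mulVf.
apply: eq_ltrace => z.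
(* Since f_j = yx, the block element f_i z f_j passes through the corner at f_i and lands on the
   line through x. The block projection thus has rank one and trace d(x) = 1. *)
have [e eE] := corner i (z · f j · y).
have zE : f i · z · f j = e *: x.
  have ix : f i · x = x by rewrite -fx !(hmulA hopf) ff.
  have yi : y · f i = y by rewrite -fy -(hmulA hopf) ff.
  transitivity (f i · (z · f j · y) · f i · x).
    by rewrite -!(hmulA hopf) ix yx ff.
  by rewrite eE hmulZl ix.
by rewrite dE zE evZ mulrC mulfK.
Qed.

End LarsonRadford.

(** * Normal Hopf subalgebras *)

Lemma tensv_mem (k : fieldType) (U V W : vectType k) (X : {vspace U})
    (Y : {vspace V}) (Z : {vspace W}) (f : 'Hom(tensor U V, W)) t :
  (forall u v, u \in X -> v \in Y -> f (u \ox v) \in Z) ->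
  t \in tensv X Y -> f t \in Z.
Proof.
move=> fZ; suff /subvP XYZ : (tensv X Y <= f @^-1: Z)%VS by move/XYZ; rewrite memv_preim.
apply/span_subvP => _ /allpairsP[[u v] /= [uX vY ->]].
by rewrite -memv_preim fZ // vbasis_mem.
Qed.

Lemma tensv_ext (k : fieldType) (U V W : vectType k) (X : {vspace U})
    (Y : {vspace V}) (f g : 'Hom(tensor U V, W)) t :
  (forall u v, u \in X -> v \in Y -> f (u \ox v) = g (u \ox v)) ->
  t \in tensv X Y -> f t = g t.
Proof.
move=> fg tXY; apply/eqP; rewrite -subr_eq0 -memv0.
have -> : f t - g t = (f - g)%VF t by rewrite !lfun_simp.
by apply: tensv_mem tXY => u v uX vY; rewrite !lfun_simp fg // subrr mem0v.
Qed.

Lemma tens_tensv (k : fieldType) (U V : vectType k) (X : {vspace U})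
    (Y : {vspace V}) u v : u \in X -> v \in Y -> u \ox v \in tensv X Y.
Proof.
move=> uX vY; rewrite (coord_vbasis uX) (coord_vbasis vY).
rewrite (lin_sum (f := fun z => z \ox _)); last by lin.
apply: memv_suml => i _; rewrite (linZ (f := fun z => z \ox _)); last by lin.
apply: memvZ; rewrite (lin_sum (f := fun z => _ \ox z)); last by lin.
apply: memv_suml => j _; rewrite (linZ (f := fun z => _ \ox z)); last by lin.
apply: memvZ; apply: memv_span; apply/allpairsP.
by exists ((vbasis X)`_i, (vbasis Y)`_j); split=> //=; rewrite mem_nth // size_tuple.
Qed.

Section NormalSub.
Variables (k : fieldType) (H : hopf_data k).
Hypothesis hopf : is_hopf_algebra H.
Local Notation S := (antip H).
Hypothesis lkerS : lker S == 0%VS.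
Local Infix "·" := hmul (at level 40, left associativity).
Variable K : {vspace H}.

Lemma sw_mem (W : vectType k) (F : H -> H -> W) (Z : {vspace W}) a :
  hopf_subalgebra K -> a \in K ->
  (forall y, lin (fun x => F x y)) -> (forall x, lin (F x)) ->
  (forall x y, x \in K -> y \in K -> F x y \in Z) -> sweedler2 F a \in Z.
Proof.
move=> [_ _ dK _] aK h1 h2 FZ; apply: tensv_mem (dK _ aK) => x y xK yK.
by rewrite tlift_tens //; exact: FZ.
Qed.

Lemma sw_sub (W : vectType k) (F G : H -> H -> W) a :
  hopf_subalgebra K -> a \in K ->
  (forall y, lin (fun x => F x y)) -> (forall x, lin (F x)) ->
  (forall y, lin (fun x => G x y)) -> (forall x, lin (G x)) ->
  (forall x y, x \in K -> y \in K -> F x y = G x y) ->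
  sweedler2 F a = sweedler2 G a.
Proof.
move=> [_ _ dK _] aK h1 h2 h3 h4 FG; apply: tensv_ext (dK _ aK) => x y xK yK.
by rewrite !tlift_tens //; exact: FG.
Qed.

Lemma antip_sub_inv a : hopf_subalgebra K -> S a \in K -> a \in K.
Proof.
move=> [_ _ _ SK].
have SKE : (S @: K)%VS = K.
  apply/eqP; rewrite eqEdim limg_dim_eq ?leqnn ?andbT.
    by apply/subvP => _ /memv_imgP[x xK ->]; exact: SK.
  by rewrite (eqP lkerS) capv0.
rewrite -{1}SKE => /memv_imgP[x xK /eqP].
rewrite -subr_eq0 -linearB => /eqP Sax.
have : a - x \in lker S by rewrite memv_ker Sax.
by rewrite (eqP lkerS) memv0 subr_eq0 => /eqP->.
Qed.

Definition right_adjoint (d a : H) : H :=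
  sweedler2 (fun d1 d2 => S d1 · a · d2) d.

(** S carries the right adjoint action of d on a to the left adjoint action of S(d) on S(a), and
    S^-1 preserves K. *)
Lemma right_adjoint_mem d a : normal_hopf_subalgebra K -> a \in K ->
  right_adjoint d a \in K.
Proof.
move=> [subK adK] aK; apply: antip_sub_inv => //.
have -> : S (right_adjoint d a) = left_adjoint (S d) (S a).
  rewrite /right_adjoint /left_adjoint (sw_antip hopf); [|lin..].
  rewrite (sw_lin (G := fun z => S z)); last by lin.
  by apply: eq_sw => d1 d2; rewrite !(antipM hopf) (hmulA hopf).
by apply: adK; case: subK => _ _ _; exact.
Qed.

Lemma eps_right_adjoint (d a : H) : eps (right_adjoint d a) = eps d * eps a.
Proof.
rewrite /right_adjoint (sw_lin (G := fun z : H => eps z : k^o)); last by lin.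
transitivity (sweedler2 (fun d1 d2 => eps d1 *: (eps a * eps d2 : k^o)) d).
  apply: (eq_sw (W := k^o)) => d1 d2.
  by rewrite !(epsM hopf) (epsS hopf) -mulrA.
by rewrite (sw_counitl hopf (G := fun z => eps a * eps z : k^o)) 1?mulrC //; lin.
Qed.

Lemma eps_left_adjoint (d a : H) : eps (left_adjoint d a) = eps d * eps a.
Proof.
rewrite /left_adjoint (sw_lin (G := fun z : H => eps z : k^o)); last by lin.
transitivity (sweedler2 (fun d1 d2 => eps d1 *: (eps a * eps d2 : k^o)) d).
  apply: (eq_sw (W := k^o)) => d1 d2.
  by rewrite !(epsM hopf) (epsS hopf) -mulrA.
by rewrite (sw_counitl hopf (G := fun z => eps a * eps z : k^o)) 1?mulrC //; lin.
Qed.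

(** Elementwise form of KH = HK: moving a to the right past d replaces it by adjoint conjugates,
    which stay in a normal K. *)
Lemma mul_right_adjoint (a d : H) :
  a · d = sweedler2 (fun d1 d2 => d1 · right_adjoint d2 a) d.
Proof.
rewrite -[LHS](sw_counitl hopf (G := fun z => a · z)); last by lin.
transitivity (sweedler2 (fun w d3 => sweedler2 (fun d1 d2 =>
    d1 · (S d2 · a · d3)) w) d).
  apply: eq_sw => w d3; rewrite -[in LHS](hmul1l hopf a).
  rewrite -[LHS](sw_antipr hopf (G := fun z => z · a · d3)); last by lin.
  by apply: eq_sw => d1 d2; rewrite !(hmulA hopf).
rewrite (sw_coassoc hopf); [|lin..].
apply: eq_sw => d1 w; rewrite /right_adjoint.
by rewrite (sw_lin (G := fun z => d1 · z)) //; lin.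
Qed.

Lemma mul_left_adjoint (a d : H) :
  d · a = sweedler2 (fun d1 d2 => left_adjoint d1 a · d2) d.
Proof.
rewrite -[LHS](sw_counitr hopf (G := fun z => z · a)); last by lin.
transitivity (sweedler2 (fun d1 w => sweedler2 (fun d2 d3 =>
    (d1 · a · S d2) · d3) w) d).
  apply: eq_sw => d1 w; rewrite -[in LHS](hmul1r hopf (d1 · a)).
  rewrite -[LHS](sw_antipl hopf (G := fun z => d1 · a · z)); last by lin.
  by apply: eq_sw => d2 d3; rewrite !(hmulA hopf).
rewrite -(sw_coassoc hopf); [|lin..].
apply: eq_sw => w d3; rewrite /left_adjoint.
by rewrite (sw_lin (G := fun z => z · d3)) //; lin.
Qed.

(** [dual_quotient] tests factors of K on the far right only. By normality b moves there past y, so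
    f vanishes on the two-sided ideal generated by K^+. *)
Lemma dual_quotient_mid (f : dual_space H) (x b y : H) :
  normal_hopf_subalgebra K -> f \in dual_quotient K -> b \in K ->
  ev f (x · b · y) = eps b * ev f (x · y).
Proof.
move=> nK /dual_quotientP fK bK.
have {}fK a c : c \in K -> ev f (a · c) = ev f a * eps c by exact: fK.
rewrite -(hmulA hopf) (mul_right_adjoint b).
rewrite (sw_lin (G := fun z => ev f (x · z) : k^o)); last by lin.
transitivity (sweedler2 (fun d1 d2 => eps d2 *: (eps b * ev f (x · d1) : k^o)) y).
  apply: (eq_sw (W := k^o)) => d1 d2.
  rewrite (hmulA hopf) fK ?right_adjoint_mem // eps_right_adjoint.
  by rewrite mulrC -mulrA.
by rewrite (sw_counitr hopf (G := fun z => eps b * ev f (x · z) : k^o)) //; lin.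
Qed.

(* Both [d e] and [e d] are equal to [e d e]. *)
Lemma normal_integral_central (e d : H) : normal_hopf_subalgebra K -> e \in K ->
  (forall b, b \in K -> b · e = eps b *: e) ->
  (forall b, b \in K -> e · b = eps b *: e) -> eps e = 1 -> d · e = e · d.
Proof.
move=> nK eK le re e1.
transitivity (e · d · e).
  rewrite (mul_right_adjoint e d) (sw_lin (G := fun z => z · e)); last by lin.
  rewrite -[LHS](sw_counitr hopf (G := fun z => z · e)); last by lin.
  apply: eq_sw => d1 d2.
  by rewrite -(hmulA hopf) (le (right_adjoint _ _)) ?right_adjoint_mem // eps_right_adjoint
    e1 mulr1 hmulZr.
rewrite -(hmulA hopf) (mul_left_adjoint e d) (sw_lin (G := fun z => e · z)); last by lin.
rewrite -[RHS](sw_counitl hopf (G := fun z => e · z)); last by lin.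
apply: eq_sw => d1 d2; rewrite (hmulA hopf) re; last by case: nK => _; exact.
by rewrite eps_left_adjoint e1 mulr1 hmulZl.
Qed.

(** S(e) is a right integral of K because S(K) = K. The product S(e) e equals e by the left property
    and S(e) by the right one. *)
Lemma sub_integral_right (e : H) : hopf_subalgebra K -> e \in K ->
  (forall b, b \in K -> b · e = eps b *: e) -> eps e = 1 ->
  forall b, b \in K -> e · b = eps b *: e.
Proof.
move=> subK eK le e1.
have [_ _ _ SK] := subK.
have reS b : b \in K -> S e · b = eps b *: S e.
  move=> bK; have : b \in (S @: K)%VS.
    rewrite (_ : (S @: K)%VS = K) //; apply/eqP; rewrite eqEdim limg_dim_eq ?leqnn ?andbT.
      by apply/subvP => _ /memv_imgP[x xK ->]; exact: SK.
    by rewrite (eqP lkerS) capv0.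
  by move=> /memv_imgP[c cK ->]; rewrite -(antipM hopf) le // linearZ /= (epsS hopf).
have Se : S e = e.
  by rewrite -[RHS]scale1r -e1 -(epsS hopf) -le ?SK // reS // e1 scale1r.
by move=> b bK; rewrite -{1}Se reS // Se.
Qed.

Let c (i : 'I_(\dim K)) : 'Hom(H, k^o) := linfun (coord (vbasis K) i : H -> k^o).
Let b (i : 'I_(\dim K)) : H := (vbasis K)`_i.

Let bK i : b i \in K.
Proof. by rewrite vbasis_mem // mem_nth // size_tuple. Qed.

Let sumK x : x \in K -> x = \sum_i ev (c i) x *: b i.
Proof.
move=> xK; rewrite {1}(coord_vbasis xK); apply: eq_bigr => i _.
by rewrite /ev lfunE.
Qed.

(* The formula of [tr_int] for the dual Hopf algebra of [K], read in [K = K^**]. *)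
Definition sub_integral : H :=
  \sum_i sweedler2 (fun x1 x2 => ev (c i) (S (S x2)) *: x1) (b i).

Lemma sub_integral_mem : hopf_subalgebra K -> sub_integral \in K.
Proof.
move=> subK; apply: memv_suml => i _; apply: sw_mem; rewrite ?bK //; try by lin.
by move=> x y xK _; exact: memvZ.
Qed.

(** The argument of [tr_int_left], dualized: insert S(l_3) S^2(l_2) = eps so that l_2 joins x_2
    under S^2, move l_1 across the trace of K, and contract l_1 S(l_2). *)
Lemma sub_integral_left : hopf_subalgebra K ->
  forall l, l \in K -> l · sub_integral = eps l *: sub_integral.
Proof.
move=> subK l lK; have [_ MK dK SK] := subK.
pose F i (y z : H) := sweedler2 (fun x1 x2 => ev (c i) (y · S (S x2)) *: x1) z.
have FE : sub_integral = \sum_i F i (hone H) (b i).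
  apply: eq_bigr => i _; apply: eq_sw => x1 x2; by rewrite (hmul1l hopf).
have linF1 i z : lin (fun y => F i y z) by rewrite /F; lin.
have linF2 i y : lin (F i y) by rewrite /F; lin.
transitivity (sweedler2 (fun l1 l2 => \sum_i F i (S l2) (l1 · b i)) l).
  rewrite sw_sum hmul_sumr; apply: eq_bigr => i _.
  transitivity (sweedler2 (fun l1 w => sweedler2 (fun l2 l3 =>
     sweedler2 (fun x1 x2 => ev (c i) (S l3 · S (S l2) · S (S x2)) *: (l1 · x1)) (b i)) w) l).
    rewrite (sw_lin (G := fun z => l · z)); last by lin.
    rewrite -[LHS](sw_counitr hopf (G := fun l => sweedler2 (fun x1 x2 => l · (ev (c i) (S
      (S x2)) *: x1)) (b i))); last by lin.
    apply: eq_sw => l1 w; rewrite -sw_const_scale [RHS]sw_exchange.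
    apply: eq_sw => x1 x2; rewrite hmulZr.
    transitivity (eps w *: (ev (c i) (S (hone H) · S (S x2)) *: (l1 · x1))).
      by rewrite (antip1 hopf) (hmul1l hopf).
    rewrite -(sw_antipl hopf (G := fun z => ev (c i) (S z · S (S x2)) *: (l1 · x1)));
      last by lin.
    by apply: eq_sw => l2 l3; rewrite (antipM hopf).
  rewrite -(sw_coassoc hopf); [|lin..].
  apply: eq_sw => w l3; rewrite /F (sw_mul hopf); [|lin..].
  apply: eq_sw => l1 l2; apply: eq_sw => x1 x2.
  by rewrite !(antipM hopf) (hmulA hopf).
transitivity (sweedler2 (fun l1 l2 => \sum_j F j (l1 · S l2) (b j)) l).
  apply: (sw_sub subK lK); [lin..|].
  move=> l1 l2 l1K l2K.
  transitivity (\sum_i \sum_j ev (c j) (l1 · b i) *: F i (S l2) (b j)).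
    apply: eq_bigr => i _.
    rewrite {1}(sumK (MK _ _ l1K (bK i))) (lin_sum _ (linF2 _ _)).
    by apply: eq_bigr => j _; rewrite (linZ _ _ (linF2 _ _)).
  rewrite exchange_big; apply: eq_bigr => j _ /=.
  transitivity (\sum_i sweedler2 (fun x1 x2 => ev (c i) (S l2 · S (S x2)) *: (ev (c j) (l1
    · b i) *: x1)) (b j)).
    apply: eq_bigr => i _; rewrite -sw_const_scale; apply: eq_sw => x1 x2.
    by rewrite !scalerA mulrC.
  rewrite -sw_sum; apply: (sw_sub subK (bK j)); [lin..|].
  move=> x1 x2 x1K x2K.
  have vK : S l2 · S (S x2) \in K by apply: MK; rewrite ?SK.
  rewrite -(hmulA hopf) {2}(sumK vK) hmul_sumr.
  rewrite (lin_sum (f := fun z => ev (c j) z : k^o)); last by lin.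
  rewrite scaler_suml; apply: eq_bigr => i _.
  by rewrite hmulZr evZ scalerA.
rewrite (sw_antipr hopf (G := fun z => \sum_j F j z (b j))).
  by rewrite FE.
by apply: lin_bigsum => j.
Qed.

(** The right integral property turns the sum into the dual basis expansion of 1 in K. The
    nonvanishing of lam(1) thereby passes to the integral of K. *)
Lemma ev_sub_integral (l : 'Hom(H, k^o)) : hopf_subalgebra K ->
  (forall h, sweedler2 (fun h1 h2 => ev l h1 *: h2) h = ev l h *: hone H) ->
  ev l sub_integral = ev l (hone H).
Proof.
move=> [oneK _ _ _] right_l.
rewrite (lin_sum (f := fun z => ev l z : k^o)); last by lin.
rewrite [in RHS](sumK oneK) (lin_sum (f := fun z => ev l z : k^o)); last by lin.
apply: eq_bigr => i _.
rewrite (sw_lin (G := fun z => ev l z : k^o)); last by lin.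
transitivity (ev (c i) (S (S (ev l (b i) *: hone H)))).
  rewrite -right_l (sw_lin (G := fun z => ev (c i) (S (S z)) : k^o)); last by lin.
  by apply: (eq_sw (W := k^o)) => x1 x2; rewrite !linearZ /= !evZ mulrC.
by rewrite !linearZ /= !(antip1 hopf) !evZ mulrC.
Qed.

Lemma sub_integral_exists (l : 'Hom(H, k^o)) : normal_hopf_subalgebra K ->
  regular H ->
  (forall h, sweedler2 (fun h1 h2 => ev l h1 *: h2) h = ev l h *: hone H) ->
  ev l (hone H) != 0 ->
  exists e, [/\ e \in K, forall b, b \in K -> b · e = eps b *: e,
    forall d, d · e = e · d, eps e = 1 & ev l e != 0].
Proof.
move=> nK regH right_l l1; have [subK adK] := nK.
have leS := sub_integral_left subK.
have SK := sub_integral_mem subK.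
have lS := ev_sub_integral subK right_l.
set s := sub_integral in leS SK lS.
have es0 : eps s != 0.
  apply: contraNneq l1 => es0; rewrite -lS.
  have [y ->] := regH s.
  rewrite (mul_right_adjoint s y) (sw_lin (G := fun z => z · s)); last by lin.
  suff -> : sweedler2 (fun x z => x · right_adjoint z s · s) y = 0 by rewrite ev0.
  transitivity (sweedler2 (fun x z => (0 : k) *: (x · z)) y).
    apply: eq_sw => x z; rewrite -(hmulA hopf) leS ?right_adjoint_mem //.
    by rewrite eps_right_adjoint es0 mulr0 !scale0r hmul0r.
  by rewrite sw_const_scale scale0r.
pose e := (eps s)^-1 *: s.
have eK : e \in K by exact: memvZ.
have e1 : eps e = 1 by rewrite /e epsZ mulVf.
have le d : d \in K -> d · e = eps d *: e.
  by move=> dK; rewrite /e hmulZr leS // !scalerA mulrC.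
exists e; split=> //; last by rewrite /e evZ lS mulf_neq0 // invr_eq0.
move=> d; apply: normal_integral_central => //.
exact: sub_integral_right.
Qed.

End NormalSub.

(** * The dual coalgebra *)

Lemma evZl (k : fieldType) (V : vectType k) (f : 'Hom(V, k^o)) c x :
  ev (c *: f) x = c * ev f x.
Proof. by rewrite /ev lfun_simp. Qed.

Section DualLin.
Variables (k : fieldType) (A : hopf_data k).

Lemma lin_dual (U : lmodType k) (V : vectType k) (E : U -> 'Hom(V, k^o)) :
  (forall x, lin (fun u => ev (E u) x : k^o)) -> lin E.
Proof. by move=> hE a u v; apply/lfunP => x; rewrite !lfun_simp; exact: hE. Qed.

Lemma dual_mulE (g f : dual_space A) x :
  ev (dual_mul g f) x = sweedler2 (fun x y => ev g x * ev f y : k^o) x.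
Proof. by rewrite {1}/ev /dual_mul comp_lfunE. Qed.

Lemma dual_translateE a (f : dual_space A) c x :
  ev (dual_translate a f c) x = ev f (hmul (hmul c x) a).
Proof. by rewrite {1}/ev /dual_translate lin_lfunE //;
  change (lin (fun x => ev f (hmul (hmul c x) a) : k^o)); lin. Qed.

Lemma lin_dual_mull (U : lmodType k) (E : U -> dual_space A) f :
  lin E -> lin (fun x => dual_mul (E x) f).
Proof.
move=> hE; apply: lin_dual => x.
suff : lin (fun u => sweedler2 (fun x y => ev (E u) x * ev f y : k^o) x).
  by move=> h a u v; rewrite !dual_mulE h.
by lin.
Qed.

Lemma lin_dual_mulr (U : lmodType k) (E : U -> dual_space A) f :
  lin E -> lin (fun x => dual_mul f (E x)).
Proof.
move=> hE; apply: lin_dual => x.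
suff : lin (fun u => sweedler2 (fun x y => ev f x * ev (E u) y : k^o) x).
  by move=> h a u v; rewrite !dual_mulE h.
by lin.
Qed.

Lemma lin_translatel (U : lmodType k) (E : U -> A) f c :
  lin E -> lin (fun x => dual_translate (E x) f c).
Proof.
move=> hE; apply: lin_dual => x.
suff : lin (fun u => ev f (hmul (hmul c x) (E u)) : k^o).
  by move=> h a u v; rewrite !dual_translateE h.
by lin.
Qed.

Lemma lin_translatef (U : lmodType k) (E : U -> dual_space A) a c :
  lin E -> lin (fun x => dual_translate a (E x) c).
Proof.
move=> hE; apply: lin_dual => x.
suff : lin (fun u => ev (E u) (hmul (hmul c x) a) : k^o).
  by move=> h b u v; rewrite !dual_translateE h.
by lin.
Qed.

Lemma lin_translater (U : lmodType k) (E : U -> A) a f :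
  lin E -> lin (fun x => dual_translate a f (E x)).
Proof.
move=> hE; apply: lin_dual => x.
suff : lin (fun u => ev f (hmul (hmul (E u) x) a) : k^o).
  by move=> h b u v; rewrite !dual_translateE h.
by lin.
Qed.

Lemma lin_precomp (U : lmodType k) (V W : vectType k) (E : U -> 'Hom(W, k^o))
    (h : 'Hom(V, W)) : lin E -> lin (fun x => (E x \o h)%VF).
Proof. by move=> hE a u v; rewrite hE comp_lfunDl comp_lfunZl. Qed.

Lemma dual_comul_sum f : dual_comul f =
  \sum_(i < \dim {:A}) \sum_(j < \dim {:A})
    ev f (hmul (vb i) (vb j)) *: ((cb i : dual_space A) \ox (cb j : dual_space A)).
Proof. by []. Qed.

Lemma lin_dual_comul : lin (@dual_comul k A).
Proof.
move=> a f g; rewrite !dual_comul_sum scaler_sumr -big_split; apply: eq_bigr => i _ /=.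
rewrite scaler_sumr -big_split; apply: eq_bigr => j _ /=.
by rewrite {1}/ev !lfun_simp /= scalerDl scalerA.
Qed.

(* [dsw F f] is the Sweedler sum F(f_1, f_2), where f(xy) = f_1(x) f_2(y). *)
Definition dsw (W : vectType k) (F : dual_space A -> dual_space A -> W)
  (f : dual_space A) : W := tlift F (dual_comul f).

Lemma lin_dsw (U : lmodType k) (W : vectType k) (F : dual_space A -> dual_space A -> W)
    (E : U -> dual_space A) :
  lin E -> lin (fun x => dsw F (E x)).
Proof. by move=> hE; apply: lin_lfun; apply: lin_comp => //; exact: lin_dual_comul. Qed.

Lemma lin_dswf (U : lmodType k) (W : vectType k) (F : U -> dual_space A -> dual_space A ->
  W) a :
  (forall v w, lin (fun x => F x v w)) -> lin (fun x => dsw (F x) a).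
Proof. exact: lin_tliftf. Qed.

End DualLin.

Ltac lin_ext2 := fail.
Ltac lin_ext ::=
  first [lin_ext2 |
  match goal with
  | |- lin (fun x => dual_mul (@?l_f x) ?l_b) => refine (lin_dual_mull (E := l_f) l_b _)
  | |- lin (fun x => dual_mul ?l_b (@?l_f x)) => refine (lin_dual_mulr (E := l_f) l_b _)
  | |- lin (fun x => dual_translate (@?l_f x) ?l_b ?l_c) => refine (lin_translatel (E :=
    l_f) l_b l_c _)
  | |- lin (fun x => dual_translate ?l_b (@?l_f x) ?l_c) => refine (lin_translatef (E :=
    l_f) l_b l_c _)
  | |- lin (fun x => dual_translate ?l_b ?l_c (@?l_f x)) => refine (lin_translater (E :=
    l_f) l_b l_c _)
  | |- lin (fun x => comp_lfun (@?l_f x) ?l_b) => refine (lin_precomp (E := l_f) l_b _)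
  | |- lin (fun x => dsw ?l_F (@?l_f x)) => refine (lin_dsw l_F (E := l_f) _)
  | |- lin (fun x => @dsw _ _ ?l_W (@?l_F x) ?l_a) => refine (@lin_dswf _ _ _ l_W l_F l_a
    _); intros
  end].

Section DualTensor.
Variables (k : fieldType) (A : hopf_data k).

Lemma tens_sep (U V : vectType k) (s t : tensor U V) :
  (forall (p : 'Hom(U, k^o)) (q : 'Hom(V, k^o)),
     tlift (fun u v => ev p u * ev q v : k^o) s =
     tlift (fun u v => ev p u * ev q v : k^o) t) -> s = t.
Proof.
move=> st; apply/matrixP => i j.
have E (w : tensor U V) : tlift (fun u v => ev (cb i) u * ev (cb j) v : k^o) w = w i j.
  rewrite tlift_sum (bigD1 i) //= (bigD1 j) //= big1 ?addr0 => [|j' /negPf nj].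
    rewrite big1 ?addr0 => [|i' /negPf ni].
      by rewrite !ev_vb !eqxx mulr1 /GRing.scale /= mulr1.
    by rewrite big1 // => j' _; rewrite !ev_vb ni mul0r scaler0.
  by rewrite !ev_vb nj mulr0 scaler0.
by rewrite -!E st.
Qed.

Lemma tens_sepl (V W : vectType k) (s t : tensor 'Hom(V, k^o) W) :
  (forall x (q : 'Hom(W, k^o)),
     tlift (fun (u : 'Hom(V, k^o)) v => ev u x * ev q v : k^o) s =
     tlift (fun (u : 'Hom(V, k^o)) v => ev u x * ev q v : k^o) t) -> s = t.
Proof.
move=> st; apply: tens_sep => p q.
have E w : tlift (fun u v => ev p u * ev q v : k^o) w =
    ev p (tlift (fun u v => ev q v *: u) w).
  rewrite (lin_tlift (G := fun z => ev p z : k^o)); last by lin.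
  by apply: eq_tlift => u v; rewrite evZ mulrC.
rewrite !E; congr (ev p _); apply/lfunP => x.
have E' w : tlift (fun (u : 'Hom(V, k^o)) v => ev u x * ev q v : k^o) w =
    ev (tlift (fun u v => ev q v *: u) w) x.
  rewrite (lin_tlift (G := fun z : 'Hom(V, k^o) => ev z x : k^o)); last by lin.
  by apply: eq_tlift => u v; rewrite evZl mulrC.
by have := st x q; rewrite !E'.
Qed.

(** Vectors of V and W separate the points of the tensor product of the duals; identities for the
    coproduct of the dual thus become identities in A. *)
Lemma tens_sep2 (V W : vectType k) (s t : tensor 'Hom(V, k^o) 'Hom(W, k^o)) :
  (forall x y,
     tlift (fun (u : 'Hom(V, k^o)) (v : 'Hom(W, k^o)) => ev u x * ev v y : k^o) s =
     tlift (fun (u : 'Hom(V, k^o)) (v : 'Hom(W, k^o)) => ev u x * ev v y : k^o) t) -> s = t.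
Proof.
move=> st; apply: tens_sepl => x q.
have E w : tlift (fun (u : 'Hom(V, k^o)) v => ev u x * ev q v : k^o) w =
    ev q (tlift (fun (u : 'Hom(V, k^o)) v => ev u x *: v) w).
  rewrite (lin_tlift (G := fun z => ev q z : k^o)); last by lin.
  by apply: eq_tlift => u v; rewrite evZ.
rewrite !E; congr (ev q _); apply/lfunP => y.
have E' w : tlift (fun (u : 'Hom(V, k^o)) (v : 'Hom(W, k^o)) => ev u x * ev v y : k^o) w =
    ev (tlift (fun (u : 'Hom(V, k^o)) v => ev u x *: v) w) y.
  rewrite (lin_tlift (G := fun z : 'Hom(W, k^o) => ev z y : k^o)); last by lin.
  by apply: eq_tlift => u v; rewrite evZl.
by have := st x y; rewrite !E'.
Qed.

Lemma dsw_ev (f : dual_space A) (x y : A) :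
  dsw (fun f1 f2 => ev f1 x * ev f2 y : k^o) f = ev f (hmul x y).
Proof.
rewrite /dsw dual_comul_sum linear_sum /=.
rewrite (lin_vb_sum (F := fun x => ev f (hmul x y) : k^o)); last by lin.
apply: eq_bigr => i _; rewrite linear_sum /=.
rewrite (lin_vb_sum (F := fun y => ev f (hmul _ y) : k^o)); last by lin.
rewrite scaler_sumr; apply: eq_bigr => j _.
rewrite linearZ /= tlift_tens; [|lin..].
by rewrite /GRing.scale /= mulrC mulrA.
Qed.

Lemma eq_dsw (W : vectType k) (F G : dual_space A -> dual_space A -> W) f :
  (forall u v, F u v = G u v) -> dsw F f = dsw G f.
Proof. exact: eq_tlift. Qed.

Lemma dsw_lin (W X : vectType k) (G : W -> X) (F : dual_space A -> dual_space A -> W) f :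
  lin G -> G (dsw F f) = dsw (fun u v => G (F u v)) f.
Proof. exact: lin_tlift. Qed.

Lemma dual_comul_sep (f : dual_space A) (t : tensor (dual_space A) (dual_space A)) :
  (forall x y : A, ev f (hmul x y) =
    tlift (fun f1 f2 : dual_space A => ev f1 x * ev f2 y : k^o) t) -> dual_comul f = t.
Proof.
by move=> ft; apply: tens_sep2 => x y; rewrite -ft -dsw_ev.
Qed.

Lemma dsw_exchange (H : hopf_data k) (W : vectType k)
    (F : dual_space A -> dual_space A -> H -> H -> W) f a :
  dsw (fun f1 f2 => sweedler2 (F f1 f2) a) f =
  sweedler2 (fun a1 a2 => dsw (fun f1 f2 => F f1 f2 a1 a2) f) a.
Proof. exact: tlift_exchange. Qed.

Lemma dsw_dsw (W : vectType k)
    (F : dual_space A -> dual_space A -> dual_space A -> dual_space A -> W) f g :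
  dsw (fun f1 f2 => dsw (F f1 f2) g) f =
  dsw (fun g1 g2 => dsw (fun f1 f2 => F f1 f2 g1 g2) f) g.
Proof. exact: tlift_exchange. Qed.

Hypothesis hopf : is_hopf_algebra A.

(** Evaluated at three vectors, this is associativity of A: f((xy)z) = f(x(yz)). *)
Lemma dsw_coassoc (W : vectType k) (F : dual_space A -> dual_space A -> dual_space A -> W) f :
  (forall y z, lin (fun x => F x y z)) -> (forall x z, lin (fun y => F x y z)) ->
  (forall x y, lin (fun z => F x y z)) ->
  dsw (fun x z => dsw (fun u v => F u v z) x) f =
  dsw (fun x z => dsw (F x) z) f.
Proof.
move=> h1 h2 h3.
pose G := tlift (fun (x : dual_space A) (t : tensor (dual_space A) (dual_space A)) => tlift
  (F x) t).
have GE x y z : G (x \ox (y \ox z)) = F x y z.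
  by rewrite /G tlift_tens ?tlift_tens //; lin.
transitivity (G (dsw (fun x z => dsw (fun u v => u \ox (v \ox z)) x) f)).
  rewrite (dsw_lin (G := fun t => G t)); last by lin.
  apply: eq_dsw => x z; rewrite (dsw_lin (G := fun t => G t)); last by lin.
  by apply: eq_dsw => u v; rewrite GE.
transitivity (G (dsw (fun x z => dsw (fun u v => x \ox (u \ox v)) z) f)); last first.
  rewrite (dsw_lin (G := fun t => G t)); last by lin.
  apply: eq_dsw => x z; rewrite (dsw_lin (G := fun t => G t)); last by lin.
  by apply: eq_dsw => u v; rewrite GE.
congr (G _).
have sep3 (s t : tensor (dual_space A) (tensor (dual_space A) (dual_space A))) :
   (forall x y z,
     tlift (fun (u : dual_space A) (v : tensor (dual_space A) (dual_space A)) => ev u x *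
      (tlift (fun v w : dual_space A => ev v y * ev w z : k^o) v : k) : k^o) s =
     tlift (fun (u : dual_space A) (v : tensor (dual_space A) (dual_space A)) => ev u x *
      (tlift (fun v w : dual_space A => ev v y * ev w z : k^o) v : k) : k^o) t) -> s = t.
  move=> st; apply: (@tens_sepl A (tensor (dual_space A) (dual_space A))) => x q.
  have E w : tlift (fun (u : dual_space A) v => ev u x * ev q v : k^o) w =
      ev q (tlift (fun (u : dual_space A) v => ev u x *: v) w).
    rewrite (lin_tlift (G := fun z => ev q z : k^o)); last by lin.
    by apply: eq_tlift => u v; rewrite evZ.
  rewrite !E; congr (ev q _); apply: tens_sep2 => y z.
  rewrite !(lin_tlift (G := fun z => tlift _ z)); [|lin..].
  have := st x y z; rewrite /=.
  set a := (X in X = _ -> _); set b := (X in _ = X -> _) => ab.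
  transitivity a; last (transitivity b => //); apply: eq_tlift => u v;
   by rewrite linearZ.
apply: sep3 => x y z.
rewrite !(dsw_lin (G := fun t => tlift _ t)); [|lin..].
transitivity (ev f (hmul (hmul x y) z)).
  rewrite -dsw_ev; apply: eq_dsw => u v.
  rewrite (dsw_lin (G := fun t => tlift _ t)); last by lin.
  rewrite -dsw_ev.
  transitivity (dsw (fun f1 f2 => ev f1 x * (ev f2 y * ev v z) : k^o) u).
    apply: eq_dsw => p q; rewrite tlift_tens; [|lin..].
    by rewrite tlift_tens //; lin.
  rewrite (dsw_lin (G := fun t : k^o => (t : k) * ev v z : k^o)); last by lin.
  by apply: eq_dsw => p q; rewrite mulrA.
rewrite -(hmulA hopf) -dsw_ev; apply: eq_dsw => u v.
rewrite [RHS](dsw_lin (G := fun t => tlift _ t)); last by lin.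
rewrite -dsw_ev (dsw_lin (G := fun t : k^o => ev u x * (t : k) : k^o)); last by lin.
apply: eq_dsw => p q; rewrite tlift_tens; [|lin..].
by rewrite tlift_tens //; lin.
Qed.

Lemma dsw_mul (W : vectType k) (F : dual_space A -> dual_space A -> W) g f :
  (forall y, lin (fun x => F x y)) -> (forall x, lin (F x)) ->
  dsw F (dual_mul g f) = dsw (fun g1 g2 =>
    dsw (fun f1 f2 => F (dual_mul g1 f1) (dual_mul g2 f2)) f) g.
Proof.
move=> h1 h2; rewrite {1}/dsw.
rewrite (@dual_comul_sep _ (dsw (fun g1 g2 => dsw (fun f1 f2 =>
  dual_mul g1 f1 \ox dual_mul g2 f2) f) g)).
  rewrite (dsw_lin (G := fun t => tlift F t)); last by lin.
  apply: eq_dsw => u v; rewrite (dsw_lin (G := fun t => tlift F t)); last by lin.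
  by apply: eq_dsw => p q; rewrite tlift_tens.
move=> x y.
rewrite (dsw_lin (G := fun t => tlift _ t)); last by lin.
transitivity (sweedler2 (fun x1 x2 => sweedler2 (fun y1 y2 =>
   ev g (hmul x1 y1) * ev f (hmul x2 y2) : k^o) y) x).
  by rewrite dual_mulE (sw_mul hopf) //; lin.
transitivity (dsw (fun g1 g2 => sweedler2 (fun x1 x2 => sweedler2 (fun y1 y2 =>
    (ev g1 x1 * ev g2 y1) * ev f (hmul x2 y2) : k^o) y) x) g).
  rewrite dsw_exchange; apply: (eq_sw (W := k^o)) => x1 x2; rewrite dsw_exchange;
    apply: (eq_sw (W := k^o)) => y1 y2.
  by rewrite -dsw_ev (dsw_lin (G := fun t : k^o => (t : k) * ev f _ : k^o)) //; lin.
apply: (eq_dsw (W := k^o)) => g1 g2; rewrite (dsw_lin (G := fun t => tlift _ t)); last by lin.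
transitivity (dsw (fun f1 f2 => sweedler2 (fun x1 x2 => sweedler2 (fun y1 y2 =>
    (ev g1 x1 * ev g2 y1) * (ev f1 x2 * ev f2 y2) : k^o) y) x) f).
  rewrite dsw_exchange; apply: (eq_sw (W := k^o)) => x1 x2; rewrite dsw_exchange;
    apply: (eq_sw (W := k^o)) => y1 y2.
  by rewrite -dsw_ev (dsw_lin (G := fun t : k^o => ev g1 x1 * ev g2 y1 * (t : k) : k^o))
    //; lin.
apply: (eq_dsw (W := k^o)) => f1 f2; rewrite tlift_tens; [|lin..].
rewrite !dual_mulE (sw_lin (G := fun t : k^o => (t : k) * _ : k^o)); last by lin.
apply: (eq_sw (W := k^o)) => x1 x2.
rewrite (sw_lin (G := fun t : k^o => _ * (t : k) : k^o)); last by lin.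
by apply: (eq_sw (W := k^o)) => y1 y2; rewrite mulrACA.
Qed.

Lemma dsw_counitl (W : vectType k) (G : dual_space A -> W) f :
  lin G -> dsw (fun f1 f2 => ev f1 (hone A) *: G f2) f = G f.
Proof.
move=> hG.
have fE : dsw (fun f1 f2 : dual_space A => ev f1 (hone A) *: f2) f = f.
  apply/lfunP => y; rewrite -!/(ev _ y).
  rewrite (dsw_lin (G := fun z : dual_space A => ev z y : k^o)); last by lin.
  rewrite -[y in RHS](hmul1l hopf) -dsw_ev; apply: (eq_dsw (W := k^o)) => u v.
  by rewrite evZl.
rewrite -[in RHS]fE (dsw_lin _ _ hG); apply: eq_dsw => u v.
by rewrite (linZ _ _ hG).
Qed.

Lemma dsw_counitr (W : vectType k) (G : dual_space A -> W) f :
  lin G -> dsw (fun f1 f2 => ev f2 (hone A) *: G f1) f = G f.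
Proof.
move=> hG.
have fE : dsw (fun f1 f2 : dual_space A => ev f2 (hone A) *: f1) f = f.
  apply/lfunP => y; rewrite -!/(ev _ y).
  rewrite (dsw_lin (G := fun z : dual_space A => ev z y : k^o)); last by lin.
  rewrite -[y in RHS](hmul1r hopf) -dsw_ev; apply: (eq_dsw (W := k^o)) => u v.
  by rewrite evZl mulrC.
rewrite -[in RHS]fE (dsw_lin _ _ hG); apply: eq_dsw => u v.
by rewrite (linZ _ _ hG).
Qed.

End DualTensor.

(** * The Drinfeld double *)

Lemma ev_comp (k : fieldType) (V W : vectType k) (f : 'Hom(W, k^o)) (g : 'Hom(V, W)) x :
  ev (f \o g)%VF x = ev f (g x).
Proof. by rewrite /ev comp_lfunE. Qed.

Section Double.
Variables (k : fieldType) (A : hopf_data k).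
Local Notation D := (drinfeld_double A).
Local Notation S := (antip A).
Local Notation Si := (antip_inv A).
Local Notation tr := dual_translate.

Definition dpair (f : dual_space A) (a : A) : D := f \ox a.

Lemma lin_dpairl (U : lmodType k) (E : U -> dual_space A) a :
  lin E -> lin (fun x => dpair (E x) a).
Proof. exact: lin_tensl. Qed.

Lemma lin_dpairr (U : lmodType k) (E : U -> A) f :
  lin E -> lin (fun x => dpair f (E x)).
Proof. exact: lin_tensr. Qed.

(* [dblM] and [dblT] are the left multiplications by [h >< 1] and [eps >< a];
   associativity of the double amounts to their commutation rules. *)
Definition dblM (h : dual_space A) (z : D) : D :=
  tlift (fun f b => dpair (dual_mul h f) b) z.

Definition dblT (a : A) (z : D) : D :=
  tlift (fun f b => sweedler2 (fun a1 r => sweedler2 (fun a2 a3 =>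
    dpair (tr a1 f (Si a3)) (hmul a2 b)) r) a) z.

End Double.

Ltac lin_dpair :=
  match goal with
  | |- lin (fun x => dpair (@?l_f x) ?l_b) => refine (lin_dpairl (E := l_f) l_b _)
  | |- lin (fun x => dpair ?l_b (@?l_f x)) => refine (lin_dpairr (E := l_f) l_b _)
  end.
Ltac lin_ext2 ::= lin_dpair.

Section DoubleLin.
Variables (k : fieldType) (A : hopf_data k).
Local Notation D := (drinfeld_double A).

Lemma lin_dblMl (U : lmodType k) (E : U -> dual_space A) (z : D) :
  lin E -> lin (fun x => dblM (E x) z).
Proof. by move=> hE; apply: lin_tliftf => f b; lin. Qed.

Lemma lin_dblMr (U : lmodType k) (E : U -> D) (h : dual_space A) :
  lin E -> lin (fun x => dblM h (E x)).
Proof. by move=> hE; apply: lin_lfun. Qed.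

Lemma lin_dblTl (U : lmodType k) (E : U -> A) (z : D) :
  lin E -> lin (fun x => dblT (E x) z).
Proof. by move=> hE; apply: lin_tliftf => f b; lin. Qed.

Lemma lin_dblTr (U : lmodType k) (E : U -> D) (a : A) :
  lin E -> lin (fun x => dblT a (E x)).
Proof. by move=> hE; apply: lin_lfun. Qed.

End DoubleLin.

Ltac lin_ext2 ::= first [lin_dpair |
  match goal with
  | |- lin (fun x => dblM (@?l_f x) ?l_b) => refine (lin_dblMl (E := l_f) l_b _)
  | |- lin (fun x => dblM ?l_b (@?l_f x)) => refine (lin_dblMr (E := l_f) l_b _)
  | |- lin (fun x => dblT (@?l_f x) ?l_b) => refine (lin_dblTl (E := l_f) l_b _)
  | |- lin (fun x => dblT ?l_b (@?l_f x)) => refine (lin_dblTr (E := l_f) l_b _)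
  end].

Section DoubleHopf.
Variables (k : fieldType) (A : hopf_data k).
Hypothesis hopf : is_hopf_algebra A.
Local Notation D := (drinfeld_double A).
Local Notation S := (antip A).
Local Notation Si := (antip_inv A).
Local Notation tr := dual_translate.
Hypothesis SiK : forall a, Si (S a) = a.
Hypothesis SiVK : forall a, S (Si a) = a.
Local Notation ee := (counit A : dual_space A).
Implicit Types (f g h : dual_space A) (a b c : A).

Lemma D_ext (X : vectType k) (F G : D -> X) :
  lin F -> lin G -> (forall f a, F (dpair f a) = G (dpair f a)) -> F =1 G.
Proof. exact: tens_ext. Qed.

Lemma dblME h f b : dblM h (dpair f b) = dpair (dual_mul h f) b.
Proof. by rewrite /dblM tlift_tens //; lin. Qed.

Lemma dblTE a f b : dblT a (dpair f b) =
  sweedler2 (fun a1 r => sweedler2 (fun a2 a3 =>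
    dpair (tr a1 f (Si a3)) (hmul a2 b)) r) a.
Proof. by rewrite /dblT tlift_tens //; lin. Qed.

Lemma dmulE g a f c : hmul (dpair g a) (dpair f c) =
  sweedler2 (fun a1 r => sweedler2 (fun a2 a3 =>
    dpair (dual_mul g (tr a1 f (Si a3))) (hmul a2 c)) r) a.
Proof.
rewrite /hmul /= /double_mul /dpair /sweedler3.
rewrite tlift_tens; [|lin..].
rewrite tlift_tens; [|lin..].
rewrite tlift_tens; [|lin..].
by [].
Qed.

Lemma eps_dpair f a : eps (dpair f a) = ev f (hone A) * eps a.
Proof.
rewrite {1}/eps /= /double_counit /dpair tlift_tens //.
- move=> b; change (lin (fun f => ev f (hone A) * eps b : k^o)); lin.
- move=> g; change (lin (fun b => ev g (hone A) * eps b : k^o)); lin.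
Qed.

Lemma sw_dpair (W : vectType k) (F : D -> D -> W) f a :
  (forall y, lin (fun x => F x y)) -> (forall x, lin (F x)) ->
  sweedler2 F (dpair f a) =
  dsw (fun f1 f2 => sweedler2 (fun a1 a2 => F (dpair f2 a1) (dpair f1 a2)) a) f.
Proof.
move=> h1 h2.
have E : comul D (dpair f a) = dsw (fun f1 f2 =>
    sweedler2 (fun a1 a2 => dpair f2 a1 \ox dpair f1 a2) a) f.
  rewrite /= /double_comul /dpair tlift_tens //.
  - move=> b; change (lin (fun f => dsw (fun f1 f2 : dual_space A =>
      sweedler2 (fun a1 a2 : A => dpair f2 a1 \ox dpair f1 a2) b) f)); lin.
  - move=> g; change (lin (fun b => dsw (fun f1 f2 : dual_space A =>
      sweedler2 (fun a1 a2 : A => dpair f2 a1 \ox dpair f1 a2) b) g)); lin.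
rewrite {1}/sweedler2 E (dsw_lin (G := fun t => tlift F t)); last by lin.
apply: eq_dsw => f1 f2; rewrite (sw_lin (G := fun t => tlift F t)); last by lin.
by apply: eq_sw => a1 a2; rewrite tlift_tens.
Qed.

Lemma dmul_MT g a z : hmul (dpair g a) z = dblM g (dblT a z).
Proof.
move: z; apply: D_ext; [lin..|] => f c; rewrite dmulE dblTE.
rewrite (sw_lin (G := fun z => dblM g z)); last by lin.
apply: eq_sw => a1 r; rewrite (sw_lin (G := fun z => dblM g z)); last by lin.
by apply: eq_sw => a2 a3; rewrite dblME.
Qed.

Lemma dual_mulA f g h : dual_mul f (dual_mul g h) = dual_mul (dual_mul f g) h.
Proof.
apply/lfunP => x; rewrite -!/(ev _ x) !dual_mulE.
transitivity (sweedler2 (fun x1 w => sweedler2 (fun x2 x3 =>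
    ev f x1 * (ev g x2 * ev h x3) : k^o) w) x).
  apply: (eq_sw (W := k^o)) => x1 w; rewrite dual_mulE.
  by rewrite (sw_lin (G := fun t : k^o => _ * (t : k) : k^o)) //; lin.
rewrite -(sw_coassoc hopf); [|lin..].
apply: (eq_sw (W := k^o)) => w x3; rewrite dual_mulE.
rewrite (sw_lin (G := fun t : k^o => (t : k) * _ : k^o)); last by lin.
by apply: (eq_sw (W := k^o)) => x1 x2; rewrite mulrA.
Qed.

Lemma dual_mul1l f : dual_mul ee f = f.
Proof.
apply/lfunP => x; rewrite -!/(ev _ x) dual_mulE.
by apply: (sw_counitl hopf (G := fun x => ev f x : k^o)); lin.
Qed.

Lemma dual_mul1r f : dual_mul f ee = f.
Proof.
apply/lfunP => x; rewrite -!/(ev _ x) dual_mulE.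
transitivity (sweedler2 (fun x1 x2 => eps x2 *: (ev f x1 : k^o)) x).
  by apply: (eq_sw (W := k^o)) => x1 x2; rewrite mulrC.
by rewrite (sw_counitr hopf (G := fun x => ev f x : k^o)) //; lin.
Qed.

Lemma translate_comp a f (x : A) c (y : A) : tr c (tr a f x) y = tr (hmul c a) f (hmul x y).
Proof.
by apply/lfunP => z; rewrite -!/(ev _ z) !dual_translateE !(hmulA hopf).
Qed.

Lemma sw_antip_inv (W : vectType k) (F : A -> A -> W) a :
  (forall y, lin (fun x => F x y)) -> (forall x, lin (F x)) ->
  sweedler2 F (Si a) = sweedler2 (fun a1 a2 => F (Si a2) (Si a1)) a.
Proof.
move=> h1 h2; rewrite -[in RHS](SiVK a) (sw_antip hopf); [|lin..].
by apply: eq_sw => x y; rewrite !SiK.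
Qed.

Lemma antip_invM a b : Si (hmul a b) = hmul (Si b) (Si a).
Proof. by rewrite -{1}(SiVK a) -{1}(SiVK b) -(antipM hopf) SiK. Qed.

Lemma antip_inv1 : Si (hone A) = hone A.
Proof. by rewrite -{1}(antip1 hopf) SiK. Qed.

Lemma eps_antip_inv a : eps (Si a) = eps a.
Proof. by rewrite -{2}(SiVK a) (epsS hopf). Qed.

Lemma sw_antip_invl (W : vectType k) (G : A -> W) a : lin G ->
  sweedler2 (fun x y => G (hmul (Si y) x)) a = eps a *: G (hone A).
Proof.
move=> hG; rewrite -[in LHS](SiVK a) (sw_antip hopf); [|lin..].
under eq_sw => x y do rewrite SiK.
by rewrite (sw_antipr hopf) // eps_antip_inv.
Qed.

Lemma sw_antip_invr (W : vectType k) (G : A -> W) a : lin G ->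
  sweedler2 (fun x y => G (hmul y (Si x))) a = eps a *: G (hone A).
Proof.
move=> hG; rewrite -[in LHS](SiVK a) (sw_antip hopf); [|lin..].
under eq_sw => x y do rewrite SiK.
by rewrite (sw_antipl hopf) // eps_antip_inv.
Qed.

Lemma translateM a f g c : tr a (dual_mul f g) c =
  sweedler2 (fun a1 a2 => sweedler2 (fun c1 c2 =>
    dual_mul (tr a1 f c1) (tr a2 g c2)) c) a.
Proof.
apply/lfunP => x; rewrite -!/(ev _ x) dual_translateE dual_mulE.
rewrite (sw_lin (G := fun z : dual_space A => ev z x : k^o)); last by lin.
rewrite (sw_mul hopf); [|lin..].
rewrite (sw_mul hopf (F := fun x y => sweedler2 (fun b1 b2 => ev f (hmul x b1) * ev g (hmul
  y b2) : k^o) a)); [|lin..].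
transitivity (sweedler2 (fun a1 a2 => sweedler2 (fun c1 c2 => sweedler2 (fun x1 x2 =>
   ev f (hmul (hmul c1 x1) a1) * ev g (hmul (hmul c2 x2) a2) : k^o) x) c) a).
  rewrite [RHS]sw_exchange; apply: (eq_sw (W := k^o)) => c1 c2.
  by rewrite [RHS]sw_exchange.
apply: (eq_sw (W := k^o)) => a1 a2.
rewrite (sw_lin (G := fun z : dual_space A => ev z x : k^o)); last by lin.
apply: (eq_sw (W := k^o)) => c1 c2; rewrite dual_mulE.
by apply: (eq_sw (W := k^o)) => x1 x2; rewrite !dual_translateE.
Qed.

Lemma dblT_T c a z : dblT c (dblT a z) = dblT (hmul c a) z.
Proof.
move: z; apply: D_ext; [lin..|] => f b; rewrite !dblTE.
rewrite (sw_lin (G := fun z => dblT c z)); last by lin.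
rewrite (sw_mul hopf); [|lin..].
transitivity (sweedler2 (fun a1 s => sweedler2 (fun a2 a3 =>
  sweedler2 (fun c1 r => sweedler2 (fun c2 c3 =>
   dpair (tr (hmul c1 a1) f (Si (hmul c3 a3))) (hmul (hmul c2 a2) b)) r) c) s) a).
  apply: eq_sw => a1 s; rewrite (sw_lin (G := fun z => dblT c z)); last by lin.
  apply: eq_sw => a2 a3; rewrite dblTE; do 2!apply: eq_sw => ? ?.
  by rewrite translate_comp antip_invM (hmulA hopf).
rewrite [RHS]sw_exchange; apply: eq_sw => a1 s; rewrite sw_exchange.
apply: eq_sw => c1 r; rewrite (sw_mul hopf); [|lin..].
by rewrite sw_exchange.
Qed.

Lemma dblM_M g h z : dblM g (dblM h z) = dblM (dual_mul g h) z.
Proof.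
by move: z; apply: D_ext; [lin..|] => f b; rewrite !dblME dual_mulA.
Qed.

(** The cross relation of the double. It rests on [translateM] and on S^-1 reversing the coproduct,
    so that the outer legs of c go to g and the middle one goes on to act on z. *)
Lemma dblT_M c g z : dblT c (dblM g z) =
  sweedler2 (fun c1 r => sweedler2 (fun w c3 =>
    dblM (tr c1 g (Si c3)) (dblT w z)) r) c.
Proof.
move: z; apply: D_ext; [lin..|] => f b.
rewrite dblME dblTE.
transitivity (sweedler2 (fun p z => sweedler2 (fun q r => sweedler2 (fun c2 c3 =>
    sweedler2 (fun s t => dpair (dual_mul (tr p g (Si t)) (tr q f (Si s))) (hmul c2 b))
     c3) r) z) c).
  rewrite -[RHS](sw_coassoc hopf); [|lin..].
  apply: eq_sw => c1 r; rewrite [RHS]sw_exchange; apply: eq_sw => c2 c3.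
  rewrite translateM (sw_lin (G := fun z => dpair z _)); last by lin.
  apply: eq_sw => p q; rewrite sw_antip_inv; [|lin..].
  by rewrite (sw_lin (G := fun z => dpair z _)) //; lin.
apply: eq_sw => p z.
transitivity (sweedler2 (fun w t => sweedler2 (fun q v => sweedler2 (fun c2 s =>
  dpair (dual_mul (tr p g (Si t)) (tr q f (Si s))) (hmul c2 b)) v) w) z); last first.
  apply: eq_sw => w t; rewrite dblTE.
  rewrite (sw_lin (G := fun z => dblM _ z)); last by lin.
  apply: eq_sw => q v; rewrite (sw_lin (G := fun z => dblM _ z)); last by lin.
  by apply: eq_sw => c2 s; rewrite dblME.
rewrite [RHS](sw_coassoc hopf); [|lin..].
apply: eq_sw => q r; rewrite -(sw_coassoc hopf); [|lin..].
by [].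
Qed.

Lemma dblA (x y z : D) : hmul x (hmul y z) = hmul (hmul x y) z.
Proof.
move: x; apply: D_ext; [lin..|] => h c; move: y; apply: D_ext; [lin..|] => g a.
rewrite dmulE dmul_MT dmul_MT dblT_M.
rewrite (sw_lin (G := fun z => dblM h z)); last by lin.
rewrite (sw_lin (G := fun x => hmul x z)); last by lin.
apply: eq_sw => c1 r.
rewrite (sw_lin (G := fun z => dblM h z)); last by lin.
rewrite (sw_lin (G := fun x => hmul x z)); last by lin.
by apply: eq_sw => w c3; rewrite dmul_MT dblM_M dblT_T.
Qed.


Lemma translate1 f : tr (hone A) f (hone A) = f.
Proof.
by apply/lfunP => x; rewrite -!/(ev _ x) dual_translateE (hmul1l hopf) (hmul1r hopf).
Qed.

Lemma dblT1 z : dblT (hone A) z = z.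
Proof.
move: z; apply: D_ext; [lin..|] => f b; rewrite dblTE.
rewrite (sw_one hopf); [|lin..]; rewrite (sw_one hopf); [|lin..].
by rewrite antip_inv1 translate1 (hmul1l hopf).
Qed.

Lemma dmul_1 g z : hmul (dpair g (hone A)) z = dblM g z.
Proof. by rewrite dmul_MT dblT1. Qed.

Lemma dbl1l (z : D) : hmul (dpair ee (hone A)) z = z.
Proof.
rewrite dmul_1; move: z; apply: D_ext; [lin..|] => f b.
by rewrite dblME dual_mul1l.
Qed.

Lemma dmul_ee g a b : hmul (dpair g a) (dpair ee b) = dpair g (hmul a b).
Proof.
have trE x y : tr x ee (Si y) = (eps x * eps y) *: ee.
  apply/lfunP => z; rewrite -!/(ev _ z) dual_translateE evZl.
  rewrite -[LHS]/(eps (hmul (hmul (Si y) z) x)) -/(eps z) !(epsM hopf) eps_antip_inv.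
  by rewrite mulrC mulrA.
rewrite dmulE.
transitivity (sweedler2 (fun a1 r => eps a1 *: dpair g (hmul r b)) a); last first.
  by rewrite (sw_counitl hopf (G := fun r => dpair g (hmul r b))) //; lin.
apply: eq_sw => a1 r.
transitivity (sweedler2 (fun a2 a3 => eps a3 *: (eps a1 *: dpair g (hmul a2 b))) r).
  apply: eq_sw => a2 a3; rewrite trE scalerA [_ * eps a1]mulrC.
  rewrite -(linZ (f := fun u => dpair u _)); last by lin.
  congr (dpair _ _); rewrite (linZ (f := fun u => dual_mul g u)); last by lin.
  by rewrite dual_mul1r.
by rewrite (sw_counitr hopf (G := fun a2 => eps a1 *: dpair g (hmul a2 b))) //; lin.
Qed.

Lemma dbl1r (z : D) : hmul z (dpair ee (hone A)) = z.
Proof.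
by move: z; apply: D_ext; [lin..|] => f b; rewrite dmul_ee (hmul1r hopf).
Qed.

Lemma sw_dblM (W : vectType k) (F : D -> D -> W) g z :
  (forall y, lin (fun x => F x y)) -> (forall x, lin (F x)) ->
  sweedler2 F (dblM g z) = sweedler2 (fun z1 z2 =>
    dsw (fun g1 g2 => F (dblM g2 z1) (dblM g1 z2)) g) z.
Proof.
move=> h1 h2; move: z; apply: D_ext; [lin..|] => f b.
rewrite dblME !sw_dpair; [|lin..].
rewrite (dsw_mul hopf); [|lin..].
rewrite dsw_dsw; apply: eq_dsw => f1 f2; rewrite dsw_exchange; apply: eq_sw => b1 b2.
by apply: eq_dsw => g1 g2; rewrite !dblME.
Qed.

Lemma dsw_translate (W : vectType k) (K : dual_space A -> dual_space A -> W) a f c :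
  (forall y, lin (fun x => K x y)) -> (forall x, lin (K x)) ->
  dsw K (tr a f c) =
  dsw (fun f1 f2 => K (tr (hone A) f1 c) (tr a f2 (hone A))) f.
Proof.
move=> h1 h2; rewrite {1}/dsw (@dual_comul_sep _ _ _ (dsw (fun f1 f2 : dual_space A =>
   tr (hone A) f1 c \ox tr a f2 (hone A)) f)).
  rewrite (dsw_lin (G := fun t => tlift K t)); last by lin.
  by apply: eq_dsw => u v; rewrite tlift_tens.
move=> x y; rewrite (dsw_lin (G := fun t => tlift _ t)); last by lin.
rewrite dual_translateE !(hmulA hopf) -(hmulA hopf (hmul c x)) -dsw_ev.
apply: (eq_dsw (W := k^o)) => u v; rewrite tlift_tens; [|lin..].
by rewrite !dual_translateE (hmul1l hopf) (hmul1r hopf).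
Qed.

(** The translations by a_4 and S^-1(a_3) sit on the facing sides of f_1 and f_2, so under f they
    multiply to a_4 S^-1(a_3), which contracts to the counit. *)
Lemma dsw_translate_contract (W : vectType k) (K : dual_space A -> dual_space A -> W) a f c w :
  (forall y, lin (fun x => K x y)) -> (forall x, lin (K x)) ->
  dsw (fun f1 f2 => sweedler2 (fun a3 a4 => K (tr a4 f1 c) (tr a f2 (Si a3))) w) f =
  eps w *: dsw (fun f1 f2 => K (tr (hone A) f1 c) (tr a f2 (hone A))) f.
Proof.
move=> h1 h2.
have KE t1 t2 : dsw (fun f1 f2 => tlift K (t1 f1 \ox t2 f2)) f =
    dsw (fun f1 f2 => K (t1 f1) (t2 f2)) f.
  by apply: eq_dsw => u v; rewrite tlift_tens.
rewrite -KE -(dsw_lin (G := fun t => tlift K t)); last by lin.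
rewrite -(linZ (f := fun t => tlift K t)); last by lin.
transitivity (tlift K (dsw (fun f1 f2 => sweedler2 (fun a3 a4 =>
    tr a4 f1 c \ox tr a f2 (Si a3)) w) f)).
  rewrite (dsw_lin (G := fun t => tlift K t)); last by lin.
  apply: eq_dsw => u v; rewrite (sw_lin (G := fun t => tlift K t)); last by lin.
  by apply: eq_sw => a3 a4; rewrite tlift_tens.
congr (tlift K _); apply: tens_sep2 => x y.
rewrite (linZ (f := fun t => tlift _ t)); last by lin.
rewrite !(dsw_lin (G := fun t => tlift _ t)); [|lin..].
transitivity (eps w *: (ev f (hmul (hmul c x) (hmul y a)) : k^o)); last first.
  congr (_ *: _); rewrite -dsw_ev; apply: (eq_dsw (W := k^o)) => u v.
  rewrite tlift_tens; [|lin..].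
  by rewrite !dual_translateE (hmul1l hopf) (hmul1r hopf).
transitivity (sweedler2 (fun a3 a4 => ev f (hmul (hmul c x) (hmul (hmul a4 (Si a3)) (hmul y
  a))) : k^o) w); last first.
  rewrite (sw_antip_invr (G := fun z => ev f (hmul (hmul c x) (hmul z (hmul y a))) : k^o));
    last by lin.
  by rewrite (hmul1l hopf).
transitivity (dsw (fun f1 f2 => sweedler2 (fun a3 a4 =>
    ev f1 (hmul (hmul c x) a4) * ev f2 (hmul (hmul (Si a3) y) a) : k^o) w) f).
  apply: eq_dsw => u v; rewrite (sw_lin (G := fun t => tlift _ t)); last by lin.
  apply: (eq_sw (W := k^o)) => a3 a4; rewrite tlift_tens; [|lin..].
  by rewrite !dual_translateE.
rewrite dsw_exchange; apply: eq_sw => a3 a4; rewrite dsw_ev.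
by rewrite !(hmulA hopf).
Qed.

(** The right-hand side carries six legs of a. Legs three and four cancel by the preceding
    contraction, and the four that remain are those of the left-hand side. *)
Lemma sw_dblT (W : vectType k) (F : D -> D -> W) a z :
  (forall y, lin (fun x => F x y)) -> (forall x, lin (F x)) ->
  sweedler2 F (dblT a z) = sweedler2 (fun a1 a2 =>
    sweedler2 (fun z1 z2 => F (dblT a1 z1) (dblT a2 z2)) z) a.
Proof.
move=> h1 h2; move: z; apply: D_ext; [lin..|] => f b.
rewrite dblTE.
transitivity (sweedler2 (fun a1 z => sweedler2 (fun a2 t => sweedler2 (fun a5 a6 =>
  sweedler2 (fun b1 b2 => dsw (fun f1 f2 =>
   F (dpair (tr a1 f2 (hone A)) (hmul a2 b1)) (dpair (tr (hone A) f1 (Si a6)) (hmul a5 b2))) f)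
  b) t) z) a).
  rewrite (sw_lin (G := fun z => sweedler2 F z)); last by lin.
  apply: eq_sw => a1 r.
  rewrite (sw_lin (G := fun z => sweedler2 F z)); last by lin.
  rewrite -[RHS](sw_coassoc hopf); [|lin..].
  apply: eq_sw => m a6; rewrite sw_dpair; [|lin..].
  rewrite dsw_translate; [|lin..].
  transitivity (dsw (fun f1 f2 => sweedler2 (fun m1 m2 => sweedler2 (fun b1 b2 =>
     F (dpair (tr a1 f2 (hone A)) (hmul m1 b1)) (dpair (tr (hone A) f1 (Si a6)) (hmul m2
       b2))) b) m) f).
    by apply: eq_dsw => f1 f2; rewrite (sw_mul hopf) //; lin.
  rewrite dsw_exchange; apply: eq_sw => m1 m2; rewrite dsw_exchange.
  by [].
transitivity (sweedler2 (fun a' a'' => sweedler2 (fun a1 s => sweedler2 (fun a2 a3 =>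
  sweedler2 (fun a4 t => sweedler2 (fun a5 a6 => sweedler2 (fun b1 b2 => dsw (fun f1 f2 =>
   F (dpair (tr a1 f2 (Si a3)) (hmul a2 b1)) (dpair (tr a4 f1 (Si a6)) (hmul a5 b2))) f)
  b) t) a'') s) a') a); last first.
  apply: eq_sw => a' a''; rewrite sw_dpair; [|lin..].
  transitivity (dsw (fun f1 f2 => sweedler2 (fun a1 s => sweedler2 (fun a2 a3 =>
  sweedler2 (fun a4 t => sweedler2 (fun a5 a6 => sweedler2 (fun b1 b2 =>
   F (dpair (tr a1 f2 (Si a3)) (hmul a2 b1)) (dpair (tr a4 f1 (Si a6)) (hmul a5 b2)))
  b) t) a'') s) a') f).
    rewrite dsw_exchange; apply: eq_sw => a1 s; rewrite dsw_exchange; apply: eq_sw => a2 a3.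
    rewrite dsw_exchange; apply: eq_sw => a4 t; rewrite dsw_exchange; apply: eq_sw => a5 a6.
    by rewrite dsw_exchange.
  apply: eq_dsw => f1 f2.
  transitivity (sweedler2 (fun b1 b2 => sweedler2 (fun a1 s => sweedler2 (fun a2 a3 =>
  sweedler2 (fun a4 t => sweedler2 (fun a5 a6 =>
   F (dpair (tr a1 f2 (Si a3)) (hmul a2 b1)) (dpair (tr a4 f1 (Si a6)) (hmul a5 b2)))
  t) a'') s) a') b).
    rewrite [RHS]sw_exchange; apply: eq_sw => a1 s; rewrite [RHS]sw_exchange;
      apply: eq_sw => a2 a3.
    rewrite [RHS]sw_exchange; apply: eq_sw => a4 t; rewrite [RHS]sw_exchange; by [].
  apply: eq_sw => b1 b2; rewrite !dblTE.
  rewrite (sw_lin (G := fun z => F z _)); last by lin.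
  apply: eq_sw => a1 s; rewrite (sw_lin (G := fun z => F z _)); last by lin.
  apply: eq_sw => a2 a3; rewrite (sw_lin (G := fun z => F _ z)); last by lin.
  apply: eq_sw => a4 t; rewrite (sw_lin (G := fun z => F _ z)); last by lin.
  by [].
rewrite (sw_coassoc hopf); [|lin..].
apply: eq_sw => a1 z; rewrite (sw_coassoc hopf); [|lin..].
apply: eq_sw => a2 y.
transitivity (sweedler2 (fun w t => sweedler2 (fun a3 a4 => sweedler2 (fun a5 a6 =>
  sweedler2 (fun b1 b2 => dsw (fun f1 f2 =>
   F (dpair (tr a1 f2 (Si a3)) (hmul a2 b1)) (dpair (tr a4 f1 (Si a6)) (hmul a5 b2))) f)
  b) t) w) y); last by rewrite (sw_coassoc hopf) //; lin.
rewrite -[LHS](sw_counitl hopf (G := fun t => sweedler2 _ t)); last by lin.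
apply: eq_sw => w t; rewrite -sw_const_scale [RHS]sw_exchange; apply: eq_sw => a5 a6.
rewrite -sw_const_scale [RHS]sw_exchange; apply: eq_sw => b1 b2.
rewrite -(dsw_translate_contract (K := fun u v => F (dpair v (hmul a2 b1)) (dpair u (hmul
  a5 b2)))); [|lin..].
by rewrite dsw_exchange.
Qed.

Lemma dbl_comulM (x y : D) : comul D (hmul x y) =
  sweedler2 (fun x1 x2 => sweedler2 (fun y1 y2 => hmul x1 y1 \ox hmul x2 y2) y) x.
Proof.
rewrite [LHS](lin_tliftE (G := fun z => z)); last exact: lin_id.
rewrite -[LHS]/(sweedler2 (fun u v : D => u \ox v) (hmul x y)).
move: x; apply: D_ext; [lin..|] => g a.
rewrite dmul_MT sw_dblM; [|lin..].
rewrite sw_dblT; [|lin..].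
rewrite sw_dpair; [|lin..].
rewrite dsw_exchange; apply: eq_sw => a1 a2.
rewrite -[RHS]/(dsw _ _).
transitivity (sweedler2 (fun y1 y2 => dsw (fun g1 g2 =>
   hmul (dpair g2 a1) y1 \ox hmul (dpair g1 a2) y2) g) y); last first.
  exact: tlift_exchange.
by apply: eq_sw => y1 y2; apply: eq_dsw => g1 g2; rewrite !dmul_MT.
Qed.


Lemma dbl_comulA (x : D) :
  sweedler2 (fun x1 x2 => sweedler2 (fun x11 x12 => x11 \ox (x12 \ox x2)) x1) x =
  sweedler2 (fun x1 x2 => x1 \ox comul D x2) x.
Proof.
transitivity (sweedler2 (fun x1 x2 : D => sweedler2 (fun x21 x22 : D =>
    x1 \ox (x21 \ox x22)) x2) x); last first.
  apply: eq_sw => x1 x2; rewrite -(sw_lin (G := fun z => x1 \ox z)); last by lin.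
  by rewrite -[sweedler2 _ _](lin_tliftE (G := fun z => z)).
move: x; apply: D_ext; [lin..|] => f a.
rewrite !sw_dpair; [|lin..].
transitivity (dsw (fun f1 f2 => dsw (fun f21 f22 => sweedler2 (fun a1 a2 =>
   sweedler2 (fun a11 a12 => dpair f22 a11 \ox (dpair f21 a12 \ox dpair f1 a2)) a1) a) f2) f).
  apply: eq_dsw => f1 f2; rewrite dsw_exchange; apply: eq_sw => a1 a2.
  by rewrite sw_dpair //; lin.
rewrite -(dsw_coassoc hopf); [|lin..].
apply: eq_dsw => f1 f2.
transitivity (dsw (fun f21 f22 => sweedler2 (fun a1 a2 =>
   sweedler2 (fun a21 a22 => dpair f2 a1 \ox (dpair f22 a21 \ox dpair f21 a22)) a2) a) f1).
  by apply: eq_dsw => u v; rewrite (sw_coassoc hopf) //; lin.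
rewrite dsw_exchange; apply: eq_sw => a1 a2.
by rewrite sw_dpair //; lin.
Qed.

Lemma dbl_counitl (x : D) : sweedler2 (fun x1 x2 => eps x1 *: x2) x = x.
Proof.
move: x; apply: D_ext; [lin..|] => f a; rewrite sw_dpair; [|lin..].
transitivity (dsw (fun f1 f2 => ev f2 (hone A) *: dpair f1 a) f).
  apply: eq_dsw => f1 f2.
  rewrite -[in RHS](counitl hopf a) (sw_lin (G := fun z => dpair _ z)); last by lin.
  rewrite -sw_const_scale; apply: eq_sw => a1 a2; rewrite eps_dpair -scalerA; congr (_ *: _).
  by rewrite (linZ (f := fun z => dpair f1 z)) //; lin.
by rewrite (dsw_counitr hopf (G := fun z => dpair z a)) //; lin.
Qed.

Lemma dbl_counitr (x : D) : sweedler2 (fun x1 x2 => eps x2 *: x1) x = x.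
Proof.
move: x; apply: D_ext; [lin..|] => f a; rewrite sw_dpair; [|lin..].
transitivity (dsw (fun f1 f2 => ev f1 (hone A) *: dpair f2 a) f).
  apply: eq_dsw => f1 f2.
  rewrite -[in RHS](counitr hopf a) (sw_lin (G := fun z => dpair _ z)); last by lin.
  rewrite -sw_const_scale; apply: eq_sw => a1 a2; rewrite eps_dpair -scalerA; congr (_ *: _).
  by rewrite (linZ (f := fun z => dpair f2 z)) //; lin.
by rewrite (dsw_counitl hopf (G := fun z => dpair z a)) //; lin.
Qed.

Lemma dbl_comul1 : comul D (hone D) = hone D \ox hone D.
Proof.
rewrite [LHS](lin_tliftE (G := fun z => z)); last exact: lin_id.
rewrite -[LHS]/(sweedler2 (fun u v : D => u \ox v) (dpair ee (hone A))).
rewrite sw_dpair; [|lin..].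
rewrite /dsw (@dual_comul_sep _ _ _ (ee \ox ee)).
  by rewrite tlift_tens; [rewrite (sw_one hopf) //; lin|lin..].
by move=> x y; rewrite tlift_tens; [exact: (epsM hopf)|lin..].
Qed.

Lemma eps_dblM g z : eps (dblM g z) = ev g (hone A) * eps z.
Proof.
move: z; apply: (D_ext (X := k^o)); [lin..|] => f b.
by rewrite dblME !eps_dpair dual_mulE (sw_one hopf) ?mulrA //; lin.
Qed.

Lemma eps_dblT a z : eps (dblT a z) = eps a * eps z.
Proof.
move: z; apply: (D_ext (X := k^o)); [lin..|] => f b.
rewrite dblTE eps_dpair.
transitivity (sweedler2 (fun a1 r => ev f (hmul (Si r) a1) * eps b : k^o) a); last first.
  rewrite (sw_antip_invl (G := fun z => ev f z * eps b : k^o)) //; lin.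
rewrite (sw_lin (G := fun z : D => eps z : k^o)); last by lin.
apply: (eq_sw (W := k^o)) => a1 r.
rewrite (sw_lin (G := fun z : D => eps z : k^o)); last by lin.
transitivity (sweedler2 (fun x y => eps x *: (ev f (hmul (Si y) a1) * eps b : k^o)) r).
  apply: (eq_sw (W := k^o)) => x y.
  rewrite eps_dpair dual_translateE (hmul1r hopf) (epsM hopf).
  by rewrite mulrCA.
by rewrite (sw_counitl hopf (G := fun y => ev f (hmul (Si y) a1) * eps b : k^o)) //; lin.
Qed.

Lemma dbl_counitM (x y : D) : eps (hmul x y) = eps x * eps y.
Proof.
move: x; apply: (D_ext (X := k^o)); [lin..|] => g a.
by rewrite dmul_MT eps_dblM eps_dblT eps_dpair mulrA.
Qed.

Lemma dbl_antipE f a : antip D (dpair f a) =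
  hmul (dpair ee (S a)) (dpair (f \o antip_inv A)%VF (hone A)).
Proof.
rewrite {1}/dpair /= /double_antip tlift_tens //.
- move=> b; change (lin (fun f : dual_space A => hmul (dpair ee (S b)) (dpair (f \o
  antip_inv A)%VF (hone A)))); lin.
- move=> g; change (lin (fun b => hmul (dpair ee (S b)) (dpair (g \o antip_inv A)%VF (hone
  A)))); lin.
Qed.

Lemma dpairE f a : dpair f a = hmul (dpair f (hone A)) (dpair ee a).
Proof. by rewrite dmul_ee (hmul1l hopf). Qed.

Lemma dbl_antipl (x : D) :
  sweedler2 (fun x1 x2 => hmul (antip D x1) x2) x = eps x *: hone D.
Proof.
move: x; apply: D_ext; [lin..|] => f a; rewrite sw_dpair; [|lin..].
transitivity (dsw (fun f1 f2 => sweedler2 (fun a1 a2 =>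
   hmul (dpair ee (S a1)) (dpair (dual_mul (f2 \o antip_inv A)%VF f1) a2)) a) f).
  apply: eq_dsw => f1 f2; apply: eq_sw => a1 a2.
  by rewrite dbl_antipE -dblA dmul_1 dblME.
transitivity (sweedler2 (fun a1 a2 => ev f (hone A) *: dpair ee (hmul (S a1) a2)) a).
  rewrite dsw_exchange; apply: eq_sw => a1 a2.
  rewrite -(dsw_lin (G := fun z => hmul (dpair ee (S a1)) (dpair z a2))); last by lin.
  have -> : dsw (fun f1 f2 : dual_space A => dual_mul (f2 \o antip_inv A)%VF f1) f =
      ev f (hone A) *: ee.
    apply/lfunP => x; rewrite -!/(ev _ x).
    rewrite (dsw_lin (G := fun z : dual_space A => ev z x : k^o)); last by lin.
    transitivity (dsw (fun f1 f2 => sweedler2 (fun x y => ev f1 y * ev f2 (Si x) : k^o) x) f).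
      apply: (eq_dsw (W := k^o)) => f1 f2; rewrite dual_mulE.
      by apply: (eq_sw (W := k^o)) => y z; rewrite mulrC ev_comp.
    rewrite dsw_exchange.
    under eq_sw => y z do rewrite dsw_ev.
    rewrite (sw_antip_invr (G := fun z => ev f z : k^o)); last by lin.
    by rewrite evZl mulrC.
  rewrite (linZ (f := fun z => hmul _ (dpair z a2))); last by lin.
  by rewrite dmul_ee.
rewrite sw_const_scale (sw_antipl hopf (G := fun z => dpair ee z)); last by lin.
by rewrite scalerA -eps_dpair.
Qed.

Lemma dbl_antipr (x : D) :
  sweedler2 (fun x1 x2 => hmul x1 (antip D x2)) x = eps x *: hone D.
Proof.
move: x; apply: D_ext; [lin..|] => f a; rewrite sw_dpair; [|lin..].
transitivity (dsw (fun f1 f2 => sweedler2 (fun a1 a2 =>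
   hmul (dpair f2 (hmul a1 (S a2))) (dpair (f1 \o antip_inv A)%VF (hone A))) a) f).
  apply: eq_dsw => f1 f2; apply: eq_sw => a1 a2.
  by rewrite dbl_antipE dblA dmul_ee.
transitivity (dsw (fun f1 f2 => eps a *: dpair (dual_mul f2 (f1 \o antip_inv A)%VF) (hone
  A)) f).
  apply: eq_dsw => f1 f2.
  rewrite (sw_antipr hopf (G := fun z => hmul (dpair f2 z) _)); last by lin.
  by rewrite dmul_1 dblME.
rewrite -(dsw_lin (G := fun z => eps a *: dpair z (hone A))); last by lin.
have -> : dsw (fun f1 f2 : dual_space A => dual_mul f2 (f1 \o antip_inv A)%VF) f =
    ev f (hone A) *: ee.
  apply/lfunP => x; rewrite -!/(ev _ x).
  rewrite (dsw_lin (G := fun z : dual_space A => ev z x : k^o)); last by lin.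
  transitivity (dsw (fun f1 f2 => sweedler2 (fun x y => ev f1 (Si y) * ev f2 x : k^o) x) f).
    apply: (eq_dsw (W := k^o)) => f1 f2; rewrite dual_mulE.
    by apply: (eq_sw (W := k^o)) => y z; rewrite mulrC ev_comp.
  rewrite dsw_exchange.
  under eq_sw => y z do rewrite dsw_ev.
  rewrite (sw_antip_invl (G := fun z => ev f z : k^o)); last by lin.
  by rewrite evZl mulrC.
rewrite (linZ (f := fun z => _ *: dpair z _)); last by lin.
by rewrite scalerA -eps_dpair.
Qed.

Lemma double_hopf : is_hopf_algebra D.
Proof.
split.
- exact: dblA.
- exact: dbl1l.
- exact: dbl1r.
- exact: dbl_comulA.
- exact: dbl_counitl.
- exact: dbl_counitr.
- exact: dbl_comul1.
- exact: dbl_comulM.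
- by rewrite -[LHS]/(eps (dpair ee (hone A))) eps_dpair -[ev _ _]/(eps (hone A)) !(eps1
  hopf) mulr1.
- exact: dbl_counitM.
- exact: dbl_antipl.
- exact: dbl_antipr.
Qed.

End DoubleHopf.

(** * Representations *)

Section Reps.
Variables (k : fieldType) (H : hopf_data k).
Hypothesis hopf : is_hopf_algebra H.
Local Notation S := (antip H).
Implicit Types (M N : rep_data H).

Definition stable M (U : {vspace M}) : Prop :=
  forall (h : H) (m : M), m \in U -> rep_act M h m \in U.

Lemma act1 M m : is_rep M -> rep_act M (hone H) m = m.
Proof. by move=> [-> _]; rewrite id_lfunE. Qed.

Lemma actM M x y m : is_rep M ->
  rep_act M (hmul x y) m = rep_act M x (rep_act M y m).
Proof. by move=> [_ ->]; rewrite comp_lfunE. Qed.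

Lemma sw_memv (W : vectType k) (U : {vspace W}) (F : H -> H -> W) a :
  (forall x y, F x y \in U) -> sweedler2 F a \in U.
Proof.
move=> FU; rewrite /sweedler2 tlift_sum; apply: memv_suml => i _.
by apply: memv_suml => j _; apply: memvZ.
Qed.

Section Maschke.
Variable L : H.
Hypothesis left_L : left_integral L.
Hypothesis epsL : eps L = 1.

(** A linear projection P onto U is averaged to Q(m) = L_1 P(S(L_2) m): hL = eps(h) L makes Q
    equivariant, and eps(L) = 1 keeps it the identity on U. The complement is its kernel. *)
Lemma maschke M (U : {vspace M}) : is_rep M -> stable U ->
  exists U' : {vspace M}, [/\ stable U', (U + U')%VS = fullv & (U :&: U')%VS = 0%VS].
Proof.
move=> repM stU; pose P := projv U.
pose Q (m : M) := sweedler2 (fun l1 l2 =>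
   rep_act M l1 (P (rep_act M (S l2) m))) L.
have linQ : lin Q by rewrite /Q; lin.
have QU m : Q m \in U.
  by apply: sw_memv => x y; apply: stU; apply: memv_proj.
have Qid m : m \in U -> Q m = m.
  move=> mU; transitivity (sweedler2 (fun x y => rep_act M (hmul x (S y)) m) L).
    by apply: eq_sw => x y; rewrite actM // projv_id // stU.
  rewrite (sw_antipr hopf (G := fun z => rep_act M z m)); last by lin.
  by rewrite epsL scale1r act1.
have Qhom h m : Q (rep_act M h m) = rep_act M h (Q m).
  transitivity (sweedler2 (fun w h3 => sweedler2 (fun h1 h2 => sweedler2 (fun l1 l2 =>
    rep_act M (hmul h1 l1) (P (rep_act M (S (hmul h2 l2)) (rep_act M h3 m)))) L) w) h).
    rewrite -[LHS](sw_counitl hopf (G := fun z => Q (rep_act M z m))); last by lin.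
    apply: eq_sw => w h3; rewrite -(sw_mul hopf (F := fun x y =>
      rep_act M x (P (rep_act M (S y) (rep_act M h3 m))))); [|lin..].
    rewrite left_L (linZ (f := fun z => sweedler2 _ z)) //; lin.
  rewrite (sw_coassoc hopf); [|lin..].
  rewrite -[RHS](sw_counitr hopf (G := fun z => rep_act M z (Q m))); last by lin.
  apply: eq_sw => h1 r; rewrite sw_exchange.
  rewrite [Q m]/Q (sw_lin (G := fun z => rep_act M h1 z)); last by lin.
  rewrite -sw_const_scale; apply: eq_sw => l1 l2.
  have -> : eps r *: rep_act M h1 (rep_act M l1 (P (rep_act M (S l2) m))) =
    eps r *: rep_act M (hmul h1 l1) (P (rep_act M (hmul (S l2) (hone H)) m)).
    by rewrite (hmul1r hopf) actM.
  rewrite -(sw_antipl hopf (G := fun z => rep_act M (hmul h1 l1) (P (rep_act M (hmul (S l2)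
    z) m)))); last by lin.
  by apply: eq_sw => h2 h3; rewrite -actM // (antipM hopf) (hmulA hopf).
pose q := linfun Q : 'End(M).
have qE m : q m = Q m by rewrite lin_lfunE.
exists (lker q); split.
- move=> h m; rewrite !memv_ker !qE Qhom => /eqP ->.
  by rewrite linear0.
- apply/eqP; rewrite eqEsubv subvf /=; apply/subvP => m _.
  rewrite -[m](addrNK (Q m)) addrC; apply: memv_add; rewrite ?QU //.
  by rewrite memv_ker linearB /= !qE (Qid (Q m)) ?subrr.
- apply/eqP; rewrite -subv0; apply/subvP => m; rewrite memv_cap memv_ker qE.
  by move=> /andP[mU]; rewrite Qid // => /eqP ->; rewrite mem0v.
Qed.

Lemma integral_semisimple : semisimple_algebra H.
Proof.
move=> I idI.
pose R : rep_data H := @RepData k H H (linfun (fun h : H => linfun (fun x : H => hmul h x))).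
have RE h x : rep_act R h x = hmul h x.
  rewrite /= lin_lfunE ?lin_lfunE //; first by lin.
  move=> c u v; apply/lfunP => y; rewrite !lfun_simp !lin_lfunE; [|lin..].
  by rewrite hmulDl hmulZl.
have repR : is_rep R.
  split=> [|x y]; apply/lfunP => z; rewrite ?lfun_simp !RE.
    exact: hmul1l.
  by rewrite (hmulA hopf).
have [|J [stJ IJ1 IJ0]] := @maschke R I repR.
  by move=> h m mI; rewrite RE; exact: idI.
exists J; split=> // h x xJ.
by rewrite -RE; exact: stJ.
Qed.

End Maschke.

Lemma tensor_repE M N h m n : rep_act (tensor_rep M N) h (m \ox n) =
  sweedler2 (fun x y => rep_act M x m \ox rep_act N y n) h.
Proof.
rewrite /= comp_lfunE /tensor_act.
rewrite (lin_tlift (G := fun f : 'End(tensor M N) => f (m \ox n))); last by lin.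
by apply: eq_tlift => x y; rewrite /tmap tlift_tens //; lin.
Qed.

Lemma tensor_rep_is_rep M N : is_rep M -> is_rep N -> is_rep (tensor_rep M N).
Proof.
move=> rM rN; split=> [|x y]; apply: tens_lfun_ext => m n.
  by rewrite tensor_repE (sw_one hopf) ?act1 ?id_lfunE //; lin.
rewrite tensor_repE [RHS]comp_lfunE tensor_repE (sw_mul hopf); [|lin..].
rewrite (sw_lin (G := fun z => rep_act (tensor_rep M N) x z)); last by lin.
rewrite sw_exchange; apply: eq_sw => y1 y2; rewrite tensor_repE.
by apply: eq_sw => x1 x2; rewrite !actM.
Qed.

Lemma unit_repE h (c : unit_rep H) : rep_act (unit_rep H) h c = eps h *: c.
Proof.
rewrite /= lin_lfunE; first by rewrite !lfun_simp.
by move=> a u v; rewrite linearP /= scalerDl scalerA.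
Qed.

Lemma unit_rep_is_rep : is_rep (unit_rep H).
Proof.
split=> [|x y]; apply/lfunP => c; rewrite ?lfun_simp !unit_repE.
  by rewrite (eps1 hopf) scale1r.
by rewrite (epsM hopf) scalerA.
Qed.

Lemma dual_repE M h (f : dual_rep M) m :
  (rep_act (dual_rep M) h f : 'Hom(M, k^o)) m = (f : 'Hom(M, k^o)) (rep_act M (S h) m).
Proof.
have l1 h' : lin (fun f : 'Hom(M, k^o) => (f \o rep_act M (S h'))%VF).
  by move=> a u v; rewrite comp_lfunDl comp_lfunZl.
rewrite /= lin_lfunE; first by rewrite lin_lfunE // comp_lfunE.
move=> a u v; apply/lfunP => g; rewrite !lfun_simp !lin_lfunE //.
by rewrite !linearP /= comp_lfunDr comp_lfunZr.
Qed.

Lemma dual_rep_is_rep M : is_rep M -> is_rep (dual_rep M).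
Proof.
move=> rM; split=> [|x y]; apply/lfunP => f; apply/lfunP => m.
  by rewrite dual_repE (antip1 hopf) act1 // id_lfunE.
by rewrite comp_lfunE !dual_repE (antipM hopf) actM.
Qed.

Lemma sum_repE M N h (p : sum_rep M N) :
  rep_act (sum_rep M N) h p = (rep_act M h p.1, rep_act N h p.2).
Proof.
have l1 h' : lin (fun p : M * N => (rep_act M h' p.1, rep_act N h' p.2)).
  by move=> a u v /=; rewrite !linearP.
rewrite /= lin_lfunE; first by rewrite lin_lfunE.
move=> a u v; apply/lfunP => q; rewrite !lfun_simp !lin_lfunE //.
by rewrite !linearP /= !lfun_simp.
Qed.

Lemma sum_rep_is_rep M N : is_rep M -> is_rep N -> is_rep (sum_rep M N).
Proof.
move=> rM rN; split=> [|x y]; apply/lfunP => p.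
  by rewrite sum_repE !act1 // id_lfunE -surjective_pairing.
by rewrite comp_lfunE !sum_repE !actM.
Qed.

Definition sub_rep M (U : {vspace M}) : rep_data H :=
  @RepData k H (subvs_of U) (linfun (fun h : H => linfun (fun x : subvs_of U =>
    vsproj U (rep_act M h (vsval x))))).

Lemma sub_repE M (U : {vspace M}) h (x : sub_rep U) : stable U ->
  vsval (rep_act (sub_rep U) h x) = rep_act M h (vsval x).
Proof.
move=> stU.
have l1 h' : lin (fun x : subvs_of U => vsproj U (rep_act M h' (vsval x))).
  by move=> a u v; rewrite !linearP.
rewrite /= lin_lfunE; first by rewrite lin_lfunE // vsprojK // stU // subvsP.
move=> a u v; apply/lfunP => q; rewrite !lfun_simp !lin_lfunE //.
by rewrite !linearP /= !lfun_simp linearP.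
Qed.

Lemma sub_rep_is_rep M (U : {vspace M}) : is_rep M -> stable U -> is_rep (sub_rep U).
Proof.
move=> rM stU; split=> [|x y]; apply/lfunP => m; apply: val_inj.
  by rewrite /= -/(vsval _) sub_repE // act1 // id_lfunE.
by rewrite /= -!/(vsval _) comp_lfunE !sub_repE // actM.
Qed.

End Reps.

(** * Trivial representations and the braiding *)

Section Decomposition.
Variables (k : fieldType) (H : hopf_data k).
Hypothesis hopf : is_hopf_algebra H.
Variable L : H.
Hypothesis left_L : left_integral L.
Hypothesis epsL : eps L = 1.
Variables (B : {vspace H}) (C : rep_data H -> Prop).
Hypothesis fusC : fusion_subcategory C.
Hypothesis simpleC : forall X, trivial_on B X -> simple_rep X -> C X.

Lemma trivial_sub_rep (M : rep_data H) (U : {vspace M}) :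
  trivial_on B M -> stable U -> trivial_on B (sub_rep U).
Proof.
move=> [rM tM] stU; split; first exact: sub_rep_is_rep.
by move=> b m bB; apply: val_inj; rewrite /= -/(vsval _) sub_repE // tM.
Qed.

Lemma stable_summand (M : rep_data H) (U V : {vspace M}) :
  is_rep M -> stable U -> stable V -> (U + V)%VS = fullv -> (U :&: V)%VS = 0%VS ->
  C (sub_rep U) -> C (sub_rep V) -> C M.
Proof.
move=> rM stU stV UV1 UV0 CU CV.
pose p := linfun (fun x : sum_rep (sub_rep U) (sub_rep V) => vsval x.1 + vsval x.2) :
  'Hom(_, M).
have pE x : p x = vsval x.1 + vsval x.2.
  by rewrite lin_lfunE // => a u v /=; rewrite scalerDr addrACA.
pose i := linfun (fun m : M => (vsproj U (daddv_pi U V m), vsproj V (daddv_pi V U m))) :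
  'Hom(M, sum_rep (sub_rep U) (sub_rep V)).
have iE m : i m = (vsproj U (daddv_pi U V m), vsproj V (daddv_pi V U m)).
  by rewrite lin_lfunE // => a u v /=; rewrite !linearP.
have pi m : p (i m) = m.
  rewrite pE iE /= !vsprojK ?memv_pi //; apply: daddv_pi_add => //.
  by rewrite UV1 memvf.
have p_inj x y : p x = p y -> x = y.
  rewrite !pE => xy.
  have E : vsval x.1 - vsval y.1 = vsval y.2 - vsval x.2.
    by apply/eqP; rewrite subr_eq addrAC eq_sym subr_eq xy addrC.
  have : vsval x.1 - vsval y.1 \in (U :&: V)%VS.
    by rewrite memv_cap {2}E !memvB ?subvsP.
  rewrite UV0 memv0 => E1; move: (E1); rewrite E subr_eq0 => /eqP E2.
  move: E1; rewrite subr_eq0 => /eqP E1.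
  by rewrite [x]surjective_pairing [y]surjective_pairing; congr (_, _); apply: val_inj.
have hom_p : rep_hom p.
  move=> h x; rewrite sum_repE !pE !sub_repE // /=.
  by rewrite linearD.
have hom_i : rep_hom i.
  by move=> h m; apply: p_inj; rewrite hom_p !pi.
apply: (fusion_summand fusC (fusion_sum fusC CU CV) rM hom_i hom_p).
by apply/lfunP => m; rewrite comp_lfunE pi id_lfunE.
Qed.

Lemma trivial_on_generated (M : rep_data H) : trivial_on B M -> C M.
Proof.
have [n] := ubnP (\dim {:M}); elim: n M => // n IHn M dimM tM.
have [rM _] := tM.
(* The zero representation is not simple and is not reached by splitting; it is a summand of the
   unit object, through zero maps. *)
have [d0|d0] := eqVneq (\dim {:M}) 0%N.
  have M0 (m : M) : m = 0.
    by apply/eqP; rewrite -memv0; have /eqP := d0; rewrite dimv_eq0 => /eqP <-; rewrite memvf.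
  apply: (fusion_summand fusC (M := unit_rep H) (i := 0) (p := 0)) => //.
  - exact: fusion_unit.
  - by move=> h m; rewrite !lfun_simp linear0.
  - by move=> h m; rewrite !lfun_simp linear0.
  by apply/lfunP => m; rewrite [RHS]M0 [LHS]M0.
have [sM|nsM] := classic (simple_rep M); first exact: simpleC.
have [U [stU U0 U1]] : exists U : {vspace M}, [/\ stable U, U <> 0%VS & U <> fullv].
  apply: NNPP => N; apply: nsM; split=> // U stU.
  apply: NNPP => NU; apply: N; exists U; split=> // UE; apply: NU; [by left|by right].
have [V [stV UV1 UV0]] := maschke hopf left_L epsL rM stU.
have dimUV : (\dim U + \dim V = \dim {:M})%N by rewrite -UV1 dimv_disjoint_sum.
have dimU : (0 < \dim U)%N by rewrite lt0n dimv_eq0; apply/eqP.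
have dimV : (0 < \dim V)%N.
  rewrite lt0n dimv_eq0; apply/eqP => V0; apply: U1.
  by rewrite -UV1 V0 addv0.
have dim_sub (W : {vspace M}) : \dim {:sub_rep W} = \dim W by rewrite dimvf.
apply: (stable_summand rM stU stV UV1 UV0); apply: IHn; rewrite ?dim_sub.
- rewrite -ltnS; apply: leq_trans dimM; rewrite ltnS -dimUV -[X in (X < _)%N]addn0.
  by rewrite ltn_add2l.
- exact: trivial_sub_rep.
- rewrite -ltnS; apply: leq_trans dimM; rewrite ltnS -dimUV -[X in (X < _)%N]add0n.
  by rewrite ltn_add2r.
- exact: trivial_sub_rep.
Qed.

End Decomposition.

Section Braiding.
Variables (k : fieldType) (A : hopf_data k).
Hypothesis hopf : is_hopf_algebra A.
Local Notation D := (drinfeld_double A).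
Local Notation S := (antip A).
Local Notation Si := (antip_inv A).
Local Notation tr := dual_translate.
Hypothesis SiK : forall a, Si (S a) = a.
Hypothesis SiVK : forall a, S (Si a) = a.
Local Notation ee := (counit A : dual_space A).
Local Notation cbd i := (cb i : dual_space A).
Implicit Types (M N X Y : rep_data D).

Definition actA M (a : A) (m : M) : M := rep_act M (dpair ee a) m.
Definition actF M (f : dual_space A) (m : M) : M := rep_act M (dpair f (hone A)) m.

Lemma lin_actAl (U : lmodType k) M (E : U -> A) (m : M) :
  lin E -> lin (fun x => actA (E x) m).
Proof. by move=> hE; rewrite /actA; lin. Qed.
Lemma lin_actAr (U : lmodType k) M a (E : U -> M) :
  lin E -> lin (fun x => actA a (E x)).
Proof. by move=> hE; rewrite /actA; lin. Qed.
Lemma lin_actFl (U : lmodType k) M (E : U -> dual_space A) (m : M) :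
  lin E -> lin (fun x => actF (E x) m).
Proof. by move=> hE; rewrite /actF; lin. Qed.
Lemma lin_actFr (U : lmodType k) M f (E : U -> M) :
  lin E -> lin (fun x => actF f (E x)).
Proof. by move=> hE; rewrite /actF; lin. Qed.

Ltac lin_act := match goal with
  | |- lin (fun x => actA (@?l_f x) ?l_b) => refine (lin_actAl (E := l_f) l_b _)
  | |- lin (fun x => actA ?l_b (@?l_f x)) => refine (lin_actAr l_b (E := l_f) _)
  | |- lin (fun x => actF (@?l_f x) ?l_b) => refine (lin_actFl (E := l_f) l_b _)
  | |- lin (fun x => actF ?l_b (@?l_f x)) => refine (lin_actFr l_b (E := l_f) _)
  end.
Ltac lina := intros; repeat first [lin_act | lin1].

Lemma actA_M M a b (m : M) : is_rep M -> actA (hmul a b) m = actA a (actA b m).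
Proof. by move=> rM; rewrite /actA -actM // (dmul_ee hopf SiVK). Qed.

Lemma actF_M M f g (m : M) : is_rep M -> actF (dual_mul f g) m = actF f (actF g m).
Proof.
move=> rM; rewrite /actF -actM // (dmul_1 hopf SiK) dblME.
by [].
Qed.

Lemma actA1 M (m : M) : is_rep M -> actA (hone A) m = m.
Proof. by move=> rM; exact: act1. Qed.

Lemma actF1 M (m : M) : is_rep M -> actF ee m = m.
Proof. by move=> rM; exact: act1. Qed.

Lemma act_dpair M f a (m : M) : is_rep M ->
  rep_act M (dpair f a) m = actF f (actA a m).
Proof.
by move=> rM; rewrite (dpairE hopf SiVK) actM.
Qed.

Lemma tensor_act_tens M N (x y : D) (m : M) (n : N) :
  tensor_act M N (x \ox y) (m \ox n) = rep_act M x m \ox rep_act N y n.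
Proof.
have lM : forall y, lin (fun x : D => tmap (rep_act M x) (rep_act N y)).
  move=> y' a u v; apply: tens_lfun_ext => m' n'.
  rewrite !lfun_simp /tmap !tlift_tens; [|lin..].
  rewrite linearP !lfun_simp.
  by rewrite (linD (f := fun z => z \ox _)) ?(linZ (f := fun z => z \ox _)) //; lin.
have lN : forall x, lin (fun y : D => tmap (rep_act M x) (rep_act N y)).
  move=> x' a u v; apply: tens_lfun_ext => m' n'.
  rewrite !lfun_simp /tmap !tlift_tens; [|lin..].
  rewrite linearP !lfun_simp.
  by rewrite (linD (f := fun z => _ \ox z)) ?(linZ (f := fun z => _ \ox z)) //; lin.
by rewrite /tensor_act tlift_tens // /tmap tlift_tens //; lin.
Qed.

Lemma braidingE X Y (x : X) (y : Y) :
  braiding (double_R A) X Y (x \ox y) = \sum_i actF (cbd i) y \ox actA (vb i) x.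
Proof.
rewrite /braiding comp_lfunE /tflip tlift_tens; [|lin..].
rewrite /double_R linear_sum /= linear_sum sum_lfunE; apply: eq_bigr => i _.
rewrite tlift_tens; [|lin..].
exact: tensor_act_tens.
Qed.

Lemma double_braidingE X Y (x : X) (y : Y) :
  (braiding (double_R A) Y X \o braiding (double_R A) X Y)%VF (x \ox y) =
  \sum_i \sum_j actF (cbd j) (actA (vb i) x) \ox actA (vb j) (actF (cbd i) y).
Proof.
rewrite comp_lfunE braidingE linear_sum; apply: eq_bigr => i _.
by rewrite /= braidingE.
Qed.


Lemma functional_sum (V : vectType k) (W : vectType k) (F : 'Hom(V, k^o) -> W) (f : 'Hom(V,
  k^o)) :
  lin F -> F f = \sum_i ev f (vb i) *: F (cb i).
Proof.
move=> hF; have {1}-> : f = \sum_i ev f (vb i) *: cb i.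
  apply/lfunP => v; rewrite -!/(ev _ v).
  rewrite (lin_sum (f := fun g : 'Hom(V, k^o) => ev g v : k^o)); last by lin.
  rewrite (lin_vb_sum (F := fun v => ev f v : k^o)); last by lin.
  by apply: eq_bigr => i _; rewrite evZl /GRing.scale /= mulrC.
by rewrite (lin_sum _ hF); apply: eq_bigr => i _; rewrite (linZ _ _ hF).
Qed.

(** Expanding the second leg in the dual basis makes the first leg an explicit translate of f, whose
    membership in [dual_quotient] can be tested. *)
Lemma dsw_sum (W : vectType k) (F : dual_space A -> dual_space A -> W) f :
  (forall y, lin (fun x => F x y)) -> (forall x, lin (F x)) ->
  dsw F f = \sum_j F (tr (vb j) f (hone A)) (cbd j).
Proof.
move=> h1 h2; rewrite /dsw dual_comul_sum exchange_big linear_sum; apply: eq_bigr => j _ /=.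
rewrite linear_sum (functional_sum (F := fun x => F x (cbd j))) //; apply: eq_bigr => i _.
by rewrite linearZ /= tlift_tens // dual_translateE (hmul1l hopf).
Qed.

Section Subcategory.
Variables K L : {vspace A}.

Lemma ee_dual_quotient : ee \in dual_quotient L.
Proof. by apply/dual_quotientP => a x _; exact: (counitM hopf). Qed.

(** f >< a acts as f >< 1 after eps >< a, so triviality can be tested on the two factors; both embed
    in the subspace since 1 is in K and eps in (A//L)^*. *)
Lemma trivial_double M : hopf_subalgebra K -> trivial_on (double_sub L K) M <->
  [/\ is_rep M, forall f (m : M), f \in dual_quotient L -> actF f m = ev f (hone A) *: m &
     forall a (m : M), a \in K -> actA a m = eps a *: m].
Proof.
move=> [oneK _ _ _]; split=> [[rM tM]|[rM tF tA]].
  split=> // [f m fL|a m aK].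
    have := tM (dpair f (hone A)) m (tens_tensv fL oneK).
    by rewrite -[counit D _]/(eps _) eps_dpair (eps1 hopf) mulr1.
  have := tM (dpair ee a) m (tens_tensv ee_dual_quotient aK).
  by rewrite -[counit D _]/(eps _) eps_dpair -[ev ee _]/(eps _) (eps1 hopf) mul1r.
split=> // b m bB.
pose F := linfun (fun b : D => rep_act M b m) : 'Hom(tensor (dual_space A) A, M).
pose G := linfun (fun b : D => eps b *: m) : 'Hom(tensor (dual_space A) A, M).
have FE (x : D) : F x = rep_act M x m by rewrite /F lin_lfunE //; lin.
have GE (x : D) : G x = eps x *: m by rewrite /G lin_lfunE //; lin.
rewrite -FE -[RHS]GE; apply: tensv_ext bB => f a fL aK.
rewrite FE GE -/(dpair f a) act_dpair // tA // tF // eps_dpair.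
by rewrite scalerA.
Qed.

Lemma double_cat_fusion : hopf_subalgebra K -> normal_hopf_subalgebra L ->
  fusion_subcategory (double_cat L K).
Proof.
move=> subK nL; have Dhopf := double_hopf hopf SiK SiVK.
have lkerS : lker S == 0%VS.
  rewrite -subv0; apply/subvP => x; rewrite memv_ker memv0 => /eqP Sx.
  by rewrite -(SiK x) Sx linear0.
have TP M := @trivial_double M subK.
split.
- by move=> M [].
- split; first exact: unit_rep_is_rep.
  by move=> b m _; rewrite unit_repE.
- move=> M N /TP[rM FM AM] /TP[rN FN AN].
  have rMN := tensor_rep_is_rep Dhopf rM rN.
  apply/TP; split=> // [f t fL|a t aK].
  + move: t; apply: tens_ext; [by lina|by lin|] => m n.
    rewrite /actF tensor_repE sw_dpair; [|lin..].
    transitivity (dsw (fun f1 f2 => actF f2 m \ox actF f1 n) f).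
      by apply: eq_dsw => f1 f2; rewrite (sw_one hopf) //; lin.
    (* By normality of L, the translates of f stay in (A//L)^* and act on N by the scalars f(b_j);
       the sum then reassembles f on M. *)
    rewrite dsw_sum; [|lina..].
    transitivity (\sum_j ev f (vb j) *: (actF (cbd j) m \ox n)).
      apply: eq_bigr => j _; rewrite FN.
        rewrite dual_translateE !(hmul1l hopf) (linZ (f := fun z => _ \ox z)) //; lin.
      apply/dual_quotientP => a x xL; rewrite -!/(ev _ _) -/(eps x) !dual_translateE.
      by rewrite !(hmul1l hopf) (dual_quotient_mid hopf lkerS _ _ nL fL xL) mulrC.
    rewrite -(functional_sum (F := fun g => actF g m \ox n)); last by lina.
    by rewrite FM // (linZ (f := fun z => z \ox n)) //; lin.
  + move: t; apply: tens_ext; [by lina|by lin|] => m n.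
    rewrite /actA tensor_repE sw_dpair; [|lin..].
    rewrite dsw_exchange.
    transitivity (sweedler2 (fun a1 a2 => actA a1 m \ox actA a2 n) a).
      apply: eq_sw => a1 a2; rewrite /dsw (@dual_comul_sep _ _ _ (ee \ox ee)).
        by rewrite tlift_tens //; lin.
      by move=> x y; rewrite tlift_tens; [exact: (epsM hopf)|lin..].
    transitivity (sweedler2 (fun a1 a2 => eps a1 *: (eps a2 *: (m \ox n))) a).
      apply: (sw_sub subK aK); [lina..|] => a1 a2 a1K a2K.
      rewrite AM // AN // (linZ (f := fun z => z \ox _)); last by lin.
      by rewrite (linZ (f := fun z => _ \ox z)) //; lin.
    by rewrite (sw_counitl hopf (G := fun z => eps z *: (m \ox n))) //; lin.
- move=> M /TP[rM FM AM]; apply/TP; split; first exact: dual_rep_is_rep.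
  + move=> f p fL; apply/lfunP => m; rewrite /actF dual_repE // dbl_antipE.
    rewrite (antip1 hopf) (dbl1l hopf SiK) // lfun_simp.
    rewrite -/(actF _ m) FM ?linearZ /= ?ev_comp ?(antip_inv1 hopf SiK) //.
    apply/dual_quotientP => a x xL; rewrite -!/(ev _ _) -/(eps x) !ev_comp.
    rewrite (antip_invM hopf SiK SiVK) -[Si x]( hmul1l hopf).
    rewrite (dual_quotient_mid hopf lkerS _ _ nL fL).
      by rewrite (hmul1l hopf) (eps_antip_inv hopf SiVK) mulrC.
    apply: (antip_sub_inv lkerS); last by rewrite SiVK.
    by case: nL.
  + move=> a p aK; apply/lfunP => m; rewrite /actA dual_repE // dbl_antipE.
    have -> : (ee \o Si)%VF = ee :> dual_space A.
      by apply/lfunP => x; rewrite comp_lfunE; exact: (eps_antip_inv hopf SiVK).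
    rewrite (dbl1r hopf SiVK) lfun_simp -/(actA _ m) AM ?linearZ ?(epsS hopf) //.
    by case: subK => _ _ _; exact.
- move=> M N [rM tM] [rN tN]; split; first exact: sum_rep_is_rep.
  by move=> b [m n] bB; rewrite sum_repE tM // tN.
- move=> M N i p [rM tM] rN hi hp pi; split=> // b n bB.
  have pin x : p (i x) = x by rewrite -comp_lfunE pi id_lfunE.
  by rewrite -[LHS]pin hi tM // linearZ /= pin.
Qed.

End Subcategory.

Lemma braid_trivial X Y (x : X) (y : Y) (K : {vspace A}) : is_rep X ->
  (forall a (m : X), a \in K -> actA a m = eps a *: m) ->
  (forall f (m : Y), f \in dual_quotient K -> actF f m = ev f (hone A) *: m) ->
  \sum_i actA (vb i) x \ox actF (cbd i) y = x \ox y.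
Proof.
move=> rX tX tY; apply: tens_sep => p q.
rewrite linear_sum tlift_tens /=; [|lin..].
pose f : dual_space A := linfun (fun a => ev p (actA a x) : k^o).
have fE a : ev f a = ev p (actA a x) by rewrite {1}/ev lin_lfunE //; lina.
transitivity (ev q (actF f y)).
  rewrite (functional_sum (F := fun g => ev q (actF g y) : k^o)); last by lina.
  by apply: eq_bigr => i _; rewrite tlift_tens ?fE //; lin.
rewrite tY ?evZ ?fE ?actA1 //.
apply/dual_quotientP => a b bK; rewrite -!/(ev _ _) -/(eps b) !fE actA_M // (tX b) //.
by rewrite (linZ (f := fun z => ev p (actA a z) : k^o)) 1?mulrC //; lina.
Qed.

Lemma braid_trivial_op X Y (x : X) (y : Y) (L : {vspace A}) : is_rep Y ->
  (forall a (m : Y), a \in L -> actA a m = eps a *: m) ->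
  (forall f (m : X), f \in dual_quotient L -> actF f m = ev f (hone A) *: m) ->
  \sum_i actF (cbd i) x \ox actA (vb i) y = x \ox y.
Proof.
move=> rY tY tX; apply: tens_sep => p q.
rewrite linear_sum tlift_tens /=; [|lin..].
pose f : dual_space A := linfun (fun a => ev q (actA a y) : k^o).
have fE a : ev f a = ev q (actA a y) by rewrite {1}/ev lin_lfunE //; lina.
transitivity (ev p (actF f x)).
  rewrite (functional_sum (F := fun g => ev p (actF g x) : k^o)); last by lina.
  by apply: eq_bigr => i _; rewrite tlift_tens ?fE 1?mulrC //; lin.
rewrite tX ?evZ ?fE ?actA1 1?mulrC //.
apply/dual_quotientP => a b bL; rewrite -!/(ev _ _) -/(eps b) !fE actA_M // (tY b) //.
by rewrite (linZ (f := fun z => ev q (actA a z) : k^o)) 1?mulrC //; lina.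
Qed.

Lemma double_braiding_trivial (K L : {vspace A}) X Y :
  hopf_subalgebra K -> hopf_subalgebra L ->
  double_cat L K X -> double_cat K L Y ->
  (braiding (double_R A) Y X \o braiding (double_R A) X Y)%VF = \1%VF.
Proof.
move=> subK subL /(trivial_double _ _ subK)[rX FX AX] /(trivial_double _ _ subL)[rY FY AY].
apply: tens_lfun_ext => x y; rewrite double_braidingE id_lfunE.
rewrite -[RHS](braid_trivial x y rX AX FY); apply: eq_bigr => i _.
exact: (braid_trivial_op _ _ rY AY FX).
Qed.

(* [\sum_l (b_l^* \o S) (x) b_l] is a left inverse of [R_21]. *)
Lemma R21_inverse X Y (x : X) (y : Y) : is_rep X -> is_rep Y ->
  \sum_l \sum_j actF (cbd l \o S)%VF (actF (cbd j) x) \ox actA (vb l) (actA (vb j) y) =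
  x \ox y.
Proof.
move=> rX rY; apply: tens_sep => p q.
pose r : dual_space A := linfun (fun a => ev q (actA a y) : k^o).
have rE a : ev r a = ev q (actA a y) by rewrite {1}/ev lin_lfunE //; lina.
have E : dsw (fun r1 r2 : dual_space A => dual_mul (r1 \o S)%VF r2) r = ev r (hone A) *: ee.
  apply/lfunP => h; rewrite -!/(ev _ h).
  rewrite (dsw_lin (G := fun z : dual_space A => ev z h : k^o)); last by lin.
  transitivity (dsw (fun r1 r2 => sweedler2 (fun x y => ev r1 (S x) * ev r2 y : k^o) h) r).
    apply: (eq_dsw (W := k^o)) => r1 r2; rewrite dual_mulE.
    by apply: (eq_sw (W := k^o)) => a b; rewrite ev_comp.
  rewrite dsw_exchange; under eq_sw => a b do rewrite dsw_ev.
  rewrite (sw_antipl hopf (G := fun z => ev r z : k^o)); last by lin.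
  by rewrite evZl mulrC.
rewrite tlift_tens; [|lin..].
transitivity (ev p (actF (dsw (fun r1 r2 : dual_space A => dual_mul (r1 \o S)%VF r2) r) x));
  last first.
  by rewrite E (linZ (f := fun z => ev p (actF z x) : k^o)) ?actF1 ?rE ?actA1 1?mulrC //; lina.
rewrite (dsw_lin (G := fun z => ev p (actF z x) : k^o)); last by lina.
rewrite /dsw dual_comul_sum !linear_sum; apply: eq_bigr => l _ /=.
rewrite !linear_sum; apply: eq_bigr => j _ /=.
rewrite linearZ /= !tlift_tens; [|lina..].
by rewrite actF_M // rE actA_M // /GRing.scale /= mulrC.
Qed.

(** [Q] is the left inverse of R_21 found above; applied to R_21 R = id it leaves two single sums,
    one over R and one over its counterpart. *)
Lemma centralizer_exchange X Y (x : X) (y : Y) : is_rep X -> is_rep Y ->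
  (braiding (double_R A) Y X \o braiding (double_R A) X Y)%VF = \1%VF ->
  \sum_i actA (vb i) x \ox actF (cbd i) y =
  \sum_l actF (cbd l \o S)%VF x \ox actA (vb l) y.
Proof.
move=> rX rY br.
pose Q := tlift (fun (u : X) (v : Y) => \sum_l actF (cbd l \o S)%VF u \ox actA (vb l) v).
have QE u v : Q (u \ox v) = \sum_l actF (cbd l \o S)%VF u \ox actA (vb l) v.
  by rewrite /Q tlift_tens //; lina.
rewrite -QE -[x \ox y]id_lfunE -br double_braidingE linear_sum.
apply: eq_bigr => i _; rewrite linear_sum.
rewrite -[LHS](R21_inverse _ _ rX rY) exchange_big; apply: eq_bigr => j _.
by rewrite /= QE.
Qed.

End Braiding.

(** * The centralizer *)

Lemma hopf_subalgebra_full (k : fieldType) (H : hopf_data k) :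
  hopf_subalgebra (fullv : {vspace H}).
Proof.
split=> *; rewrite ?memvf //.
rewrite [comul _ _]tens_sum; apply: memv_suml => i _; apply: memv_suml => j _.
by apply: memvZ; apply: tens_tensv; exact: memvf.
Qed.

Section SemisimpleHopf.
Variables (k : closedFieldType) (char_k : [pchar k] =i pred0).
Variable A : hopf_data k.
Hypothesis hopf : is_hopf_algebra A.
Hypothesis semisimple_A : semisimple_algebra A.
Local Notation S := (antip A).
Local Notation lam := (tr_int A).

Lemma semisimple_antip_lker : lker S == 0%VS.
Proof.
have [L [lL rL L1]] := semisimple_integral hopf semisimple_A.
exact: (antip_lker hopf rL L1).
Qed.

Lemma tr_int1_neq0 : ev lam (hone A) != 0.
Proof.
have [L [lL rL L1]] := semisimple_integral hopf semisimple_A.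
have := trace_antip2_neq0 char_k hopf (semisimple_regular hopf semisimple_A) lL rL L1.
by rewrite tr_intE; congr (_ != 0); apply: eq_ltrace => x; rewrite (hmul1l hopf).
Qed.

(** At h = 1 the relation lam(h_1) h_2 = lam(h) g reads lam(1) 1 = lam(1) g, so lam(1) != 0 gives g
    = 1. *)
Lemma tr_int_right h :
  sweedler2 (fun h1 h2 => ev lam h1 *: h2) h = ev lam h *: hone A.
Proof.
have [L [lL rL L1]] := semisimple_integral hopf semisimple_A.
have lam_r := lam_right hopf lL rL L1.
rewrite lam_r; congr (_ *: _).
apply: (scalerI tr_int1_neq0).
by rewrite -lam_r (sw_one hopf) //; lin.
Qed.

End SemisimpleHopf.

(** * Integrals in the double *)

Section DoubleIntegral.
Variables (k : fieldType) (A : hopf_data k).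
Hypothesis hopf : is_hopf_algebra A.
Local Notation D := (drinfeld_double A).
Local Notation S := (antip A).
Local Notation Si := (antip_inv A).
Hypothesis SiK : forall a, Si (S a) = a.
Hypothesis SiVK : forall a, S (Si a) = a.
Local Notation lam := (tr_int A).
Local Notation ee := (counit A : dual_space A).

(** For z an integral of K this is an integral of (A//K)^*, the f_0 of the overview. *)
Definition tr_int_mul (z : A) : dual_space A :=
  linfun (fun x : A => ev lam (hmul x z) : k^o).

Lemma tr_int_mulE z x : ev (tr_int_mul z) x = ev lam (hmul x z).
Proof. by rewrite {1}/ev lin_lfunE //; lin. Qed.

(** The middle leg of l is absorbed by e. The outer legs give lam(S^-1(l_3) x l_1 z), which the
    Nakayama automorphism S^2 and centrality of z turn into lam(x z l_1 S(l_3)). *)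
Lemma dblT_integral (L : {vspace A}) (e z l : A) : hopf_subalgebra L ->
  (forall b, b \in L -> hmul b e = eps b *: e) ->
  (forall d, hmul d z = hmul z d) -> l \in L ->
  dblT l (dpair (tr_int_mul z) e) = eps l *: dpair (tr_int_mul z) e.
Proof.
move=> subL le zc lL; rewrite dblTE.
transitivity (sweedler2 (fun l1 l3 => dpair (dual_translate l1 (tr_int_mul z) (Si l3)) e) l).
  apply: (sw_sub subL lL); [lin..|] => l1 r l1L rL.
  transitivity (sweedler2 (fun l2 l3 => eps l2 *: dpair (dual_translate l1 (tr_int_mul z)
    (Si l3)) e) r).
    apply: (sw_sub subL rL); [lin..|] => l2 l3 l2L l3L.
    by rewrite le // (linZ (f := fun x => dpair _ x)) //; lin.
  by rewrite (sw_counitl hopf (G := fun l3 => dpair (dual_translate l1 (tr_int_mul z) (Si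
    l3)) e)) //; lin.
rewrite -(sw_lin (G := fun f => dpair f e)); last by lin.
rewrite -(linZ (f := fun f => dpair f e)); last by lin.
congr (dpair _ _); apply/lfunP => x; rewrite -!/(ev _ x) evZl.
rewrite (sw_lin (G := fun f : dual_space A => ev f x : k^o)); last by lin.
transitivity (sweedler2 (fun l1 l3 => ev lam (hmul (hmul x z) (hmul l1 (S l3))) : k^o) l).
  apply: (eq_sw (W := k^o)) => l1 l3.
  rewrite dual_translateE tr_int_mulE -!(hmulA hopf) [LHS](lam_mulC hopf) SiVK.
  by rewrite -!(hmulA hopf) (hmulA hopf l1 z) zc -(hmulA hopf).
rewrite (sw_antipr hopf (G := fun y => ev lam (hmul (hmul x z) y) : k^o)); last by lin.
by rewrite (hmul1r hopf) tr_int_mulE.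
Qed.

(** As g ignores factors of K on the right, g(h_1) lam(h_2 z) equals g(h_1 z_1) lam(h_2 z_2), and
    lam is a left integral at hz. *)
Lemma dual_mul_tr_int (K : {vspace A}) (g : dual_space A) z : hopf_subalgebra K ->
  z \in K -> g \in dual_quotient K ->
  dual_mul g (tr_int_mul z) = ev g (hone A) *: tr_int_mul z.
Proof.
move=> subK zK /dual_quotientP gK.
have {}gK a x : x \in K -> ev g (hmul a x) = ev g a * eps x by exact: gK.
apply/lfunP => h; rewrite -!/(ev _ h) dual_mulE evZl tr_int_mulE.
transitivity (sweedler2 (fun h1 h2 => ev g h1 * ev lam h2 : k^o) (hmul h z)); last first.
  transitivity (ev g (ev lam (hmul h z) *: hone A)); last by rewrite evZ mulrC.
  rewrite -(tr_int_left hopf) (sw_lin (G := fun x => ev g x : k^o)); last by lin.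
  by apply: (eq_sw (W := k^o)) => h1 h2; rewrite evZ mulrC.
rewrite (sw_mul hopf); [|lin..].
apply: (eq_sw (W := k^o)) => h1 h2.
transitivity (sweedler2 (fun z1 z2 => eps z1 *: (ev g h1 * ev lam (hmul h2 z2) : k^o)) z).
  rewrite (sw_counitl hopf (G := fun z2 => ev g h1 * ev lam (hmul h2 z2) : k^o)); last by lin.
  by rewrite tr_int_mulE.
apply: (sw_sub subK zK); [lin..|] => z1 z2 z1K _.
by rewrite gK // /GRing.scale /= mulrA [_ * ev g h1]mulrC.
Qed.

Lemma double_left_integral (e : A) : left_integral e ->
  left_integral (dpair lam e : D).
Proof.
move=> le.
have lamE : lam = tr_int_mul (hone A).
  by apply/lfunP => x; rewrite -!/(ev _ x) tr_int_mulE (hmul1r hopf).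
move=> x; move: x; apply: D_ext; [lin..|] => g a.
rewrite dmul_MT {1}lamE (dblT_integral (L := fullv)) ?memvf //; first last.
- by move=> d; rewrite (hmul1l hopf) (hmul1r hopf).
- exact: hopf_subalgebra_full.
rewrite -lamE (linZ (f := fun z => dblM g z)); last by lin.
rewrite dblME eps_dpair.
have -> : dual_mul g lam = ev g (hone A) *: (lam : dual_space A).
  apply/lfunP => h; rewrite -!/(ev _ h) dual_mulE evZl.
  transitivity (ev g (ev lam h *: hone A)); last by rewrite evZ mulrC.
  rewrite -(tr_int_left hopf) (sw_lin (G := fun x => ev g x : k^o)); last by lin.
  by apply: (eq_sw (W := k^o)) => h1 h2; rewrite evZ mulrC.
rewrite (linZ (f := fun f => dpair f e)); last by lin.
by rewrite scalerA mulrC.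
Qed.

End DoubleIntegral.

Section Centralizer.
Variables (k : closedFieldType) (char_k : [pchar k] =i pred0).
Variable A : hopf_data k.
Hypothesis hopf : is_hopf_algebra A.
Hypothesis semisimple_A : semisimple_algebra A.
Variables K L : {vspace A}.
Hypothesis normal_K : normal_hopf_subalgebra K.
Hypothesis normal_L : normal_hopf_subalgebra L.
Hypothesis normal_B : normal_hopf_subalgebra (double_sub K L).
Local Notation D := (drinfeld_double A).
Local Notation S := (antip A).
Local Notation Si := (antip_inv A).
Local Notation lam := (tr_int A).
Local Notation ee := (counit A : dual_space A).
Local Notation B := (double_sub K L).

Let lkerS := semisimple_antip_lker hopf semisimple_A.
Let SiK a : Si (S a) = a.
Proof. by rewrite /antip_inv lker0_lfunK. Qed.
Let SiVK a : S (Si a) = a.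
Proof. by rewrite /antip_inv lker0_lfunVK. Qed.
Let Dhopf := double_hopf hopf SiK SiVK.
Let subK : hopf_subalgebra K := proj1 normal_K.
Let subL : hopf_subalgebra L := proj1 normal_L.

Lemma double_integral : exists e : D, left_integral e /\ eps e = 1.
Proof.
have [e [le re e1]] := semisimple_integral hopf semisimple_A.
have l1 := tr_int1_neq0 char_k hopf semisimple_A.
exists ((ev lam (hone A))^-1 *: dpair lam e); split.
  move=> x; rewrite hmulZr (double_left_integral hopf SiVK le) !scalerA.
  by rewrite mulrC.
by rewrite epsZ eps_dpair e1 mulr1 mulVf.
Qed.

Lemma double_semisimple : semisimple_algebra D.
Proof. by have [e [le e1]] := double_integral; exact: (integral_semisimple Dhopf le e1). Qed.

(** The results on normal Hopf subalgebras use an injective antipode of D; the theory of integrals,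
    applied now to D itself, supplies it. *)
Let lkerSD := semisimple_antip_lker Dhopf double_semisimple.

(* For [kap] in [K] and [eta] in [(A//L)^*], the functional [f >< a |-> f(kap) eta(a)]
   on [D] factors through [D//B]: it is invariant under the central integral
   [e] of [B]. *)
Definition ev_pair (kap : A) (eta : dual_space A) : dual_space D :=
  tlift (fun (f : dual_space A) (a : A) => ev f kap * ev eta a : k^o).

Lemma ev_pairE kap eta f a : ev (ev_pair kap eta) (dpair f a) = ev f kap * ev eta a.
Proof. by rewrite {1}/ev /ev_pair tlift_tens //; lin. Qed.

Lemma ev_pair_dual_quotient kap eta : kap \in K -> eta \in dual_quotient L ->
  ev_pair kap eta \in dual_quotient B.
Proof.
move=> kK etaL.
have regA := semisimple_regular hopf semisimple_A.
have right_lam := tr_int_right char_k hopf semisimple_A.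
have lam1 := tr_int1_neq0 char_k hopf semisimple_A.
have [z [zK lz zc z1 lamz]] := sub_integral_exists hopf lkerS normal_K regA right_lam lam1.
have [u [uL lu uc u1 _]] := sub_integral_exists hopf lkerS normal_L regA right_lam lam1.
pose f0 := tr_int_mul z.
have f0K : f0 \in dual_quotient K.
  apply/dual_quotientP => a x xK; rewrite -!/(ev _ _) -/(eps x) !tr_int_mulE.
  by rewrite -(hmulA hopf) lz // hmulZr evZ mulrC.
have f01 : ev f0 (hone A) = ev lam z by rewrite tr_int_mulE (hmul1l hopf).
pose e : D := (ev lam z)^-1 *: dpair f0 u.
have eB : e \in B by apply: memvZ; exact: tens_tensv.
have e1 : eps e = 1 by rewrite epsZ eps_dpair f01 u1 mulr1 mulVf.
have le b : b \in B -> hmul b e = eps b *: e.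
  pose F := linfun (fun b : D => hmul b e) : 'Hom(tensor (dual_space A) A, D).
  pose G := linfun (fun b : D => eps b *: e) : 'Hom(tensor (dual_space A) A, D).
  have FE (x : D) : F x = hmul x e by rewrite /F lin_lfunE //; lin.
  have GE (x : D) : G x = eps x *: e by rewrite /G lin_lfunE //; lin.
  move=> bB; rewrite -FE -GE; apply: tensv_ext bB => f l fK lL.
  rewrite FE GE -/(dpair f l) /e hmulZr dmul_MT.
  rewrite (dblT_integral hopf SiVK subL lu zc lL).
  rewrite (linZ (f := fun z => dblM f z)); last by lin.
  rewrite dblME (dual_mul_tr_int hopf subK zK fK).
  rewrite (linZ (f := fun f => dpair f u)); last by lin.
  rewrite eps_dpair !scalerA; congr (_ *: _). by rewrite mulrC [eps l * _]mulrC.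
have ec d : hmul d e = hmul e d.
  apply: (normal_integral_central Dhopf lkerSD d normal_B eB le _ e1).
  by apply: (sub_integral_right Dhopf lkerSD) => //; case: normal_B.
(* Centrality lets e be placed between g and a, giving g f_0 >< ua up to the normalizing scalar.
   Then eta(ua) = eta(a), and g(kap_1) lam(kap_2 z) = g(kap) lam(z). *)
have phi_e x : ev (ev_pair kap eta) (hmul x e) = ev (ev_pair kap eta) x.
  move: x; apply: (D_ext (X := k^o)); [by lin | by apply: lin_lfun; exact: lin_id |] => g a.
  rewrite (dpairE hopf SiVK g a) -(dblA hopf SiK SiVK) ec /e hmulZl hmulZr.
  rewrite (dmul_ee hopf SiVK) !(dmul_1 hopf SiK) !dblME evZ !ev_pairE.
  rewrite (dual_mul1r hopf) -[hmul u a](hmul1l hopf) (hmulA hopf).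
  rewrite (dual_quotient_mid hopf lkerS _ _ normal_L etaL uL) u1 mul1r (hmul1l hopf).
  rewrite dual_mulE mulrA; congr (_ * _).
  transitivity ((ev lam z)^-1 * (sweedler2 (fun x y => eps y *: (ev g x * ev lam z : k^o))
    kap : k)).
    congr (_ * _); apply: (sw_sub subK kK); [lin..|] => x y _ yK.
    rewrite tr_int_mulE lz // evZ /GRing.scale /=.
    by rewrite mulrCA.
  rewrite (sw_counitr hopf (G := fun x => ev g x * ev lam z : k^o)); last by lin.
  by rewrite mulrC mulfK.
apply/dual_quotientP => x b bB; rewrite -!/(ev _ _) -/(eps b).
rewrite -phi_e -(dblA hopf SiK SiVK) le // hmulZr evZ phi_e.
by rewrite mulrC.
Qed.

(* Its subrepresentation on [dual_quotient B] is the dual of [D//B]. *)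
Definition translation_rep : rep_data D :=
  @RepData k D (dual_space D) (linfun (fun d : D =>
    linfun (fun phi : dual_space D => dual_translate d phi (hone D)))).

Lemma translation_repE (d x : D) (phi : translation_rep) :
  ev (rep_act translation_rep d phi : dual_space D) x =
  ev (phi : dual_space D) (hmul x d).
Proof.
cbv beta iota delta [rep_act translation_rep]; rewrite lin_lfunE.
  by rewrite lin_lfunE; [rewrite dual_translateE (hmul1l Dhopf)|lin].
move=> c u v; apply/lfunP => f; rewrite !lfun_simp !lin_lfunE; [|lin..].
by apply: (lin_translatel (E := fun x => x)); exact: lin_id.
Qed.

Lemma translation_rep_is_rep : is_rep translation_rep.
Proof.
split=> [|d d']; apply/lfunP => phi; apply/lfunP => x.
  by rewrite -!/(ev _ x) translation_repE (hmul1r Dhopf) id_lfunE.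
rewrite -!/(ev _ x) comp_lfunE translation_repE.
by rewrite !translation_repE (hmulA Dhopf).
Qed.

Lemma dual_quotient_stable :
  @stable k D translation_rep (dual_quotient B : {vspace dual_space D}).
Proof.
move=> d phi phiB; apply/dual_quotientP => x b bB; rewrite -!/(ev _ _) -/(eps b).
by rewrite !translation_repE (dual_quotient_mid Dhopf lkerSD _ _ normal_B phiB bB) mulrC.
Qed.

Lemma centralizer_double_cat (X : rep_data D) : is_rep X ->
  (forall Y, double_cat K L Y ->
    (braiding (double_R A) Y X \o braiding (double_R A) X Y)%VF = \1%VF) ->
  double_cat L K X.
Proof.
move=> rX brX.
pose W : {vspace translation_rep} := dual_quotient B.
pose Y := sub_rep W.
have stW : stable W := dual_quotient_stable.
have rY : is_rep Y by apply: sub_rep_is_rep => //; exact: translation_rep_is_rep.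
have catY : double_cat K L Y.
  split=> // b m bB; apply: val_inj; change (vsval (rep_act Y b m) = vsval (counit D b *:
    m)); rewrite (sub_repE b m stW).
  apply/lfunP => x; change (ev (rep_act translation_rep b (vsval m) : dual_space D) x =
    (vsval (counit D b *: m) : dual_space D) x); rewrite translation_repE.
  have /dual_quotientP mB : (vsval m : dual_space D) \in dual_quotient B by exact: subvsP.
  rewrite /ev mB // linearZ /= lfun_simp.
  by rewrite mulrC.
have key kap eta (x : X) : kap \in K -> eta \in dual_quotient L ->
    ev eta (hone A) *: actA kap x = eps kap *: actF (eta \o S)%VF x.
  move=> kK etaL.
  pose y : Y := vsproj W (ev_pair kap eta).
  have yE : vsval y = ev_pair kap eta by rewrite vsprojK // ev_pair_dual_quotient.
  have := centralizer_exchange hopf SiK SiVK x y rX rY (brX Y catY).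
  (* [G] evaluates the functional in [Y] at 1. Since D acts by translation, d y takes there the
     value of [ev_pair kap eta] at d, and the two sums become basis expansions of kap and of eta. *)
  pose G := tlift (fun (u : X) (v : Y) => ev (vsval v : dual_space D) (hone D) *: u).
  have GE u (v : Y) : G (u \ox v) = ev (vsval v : dual_space D) (hone D) *: u.
    rewrite /G tlift_tens // => [v'|u']; first by lin.
    apply: (lin_scalel (E := fun v : Y => ev (vsval v : dual_space D) (hone D) : k^o)).
    by apply: lin_evl => c v1 v2; rewrite linearP.
  have yact d : ev (vsval (rep_act Y d y) : dual_space D) (hone D) = ev (ev_pair kap eta) d.
    by rewrite sub_repE // translation_repE yE (hmul1l Dhopf).
  move=> /(congr1 G); rewrite !linear_sum /= => E.
  transitivity (\sum_i G (actA (vb i) x \ox actF (cb i : dual_space A) y)).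
    rewrite [LHS](lin_vb_sum (F := fun a => ev eta (hone A) *: actA a x));
      last by rewrite /actA; lin.
    apply: eq_bigr => i _; rewrite GE yact ev_pairE scalerA.
    by [].
  rewrite E (functional_sum (F := fun g : 'Hom(A, k^o) => eps kap *: actF (g \o S)%VF x));
    last first.
    by rewrite /actF; lin.
  apply: eq_bigr => l _; rewrite GE yact ev_pairE scalerA mulrC.
  by [].
(* The case kap = 1, eta = f o S^-1 gives triviality of (A//L)^*; the case eta = eps gives
   triviality of K. *)
apply/(trivial_double hopf SiVK L X subK); split=> // [f x fL|a x aK].
- have [oneK _ _ _] := subK.
  have etaL : (f \o Si)%VF \in dual_quotient L.
    apply/dual_quotientP => a l lL; rewrite -!/(ev _ _) -/(eps l) !ev_comp.
    rewrite (antip_invM hopf SiK SiVK) -[Si l](hmul1l hopf).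
    rewrite (dual_quotient_mid hopf lkerS _ _ normal_L fL).
      by rewrite (hmul1l hopf) (eps_antip_inv hopf SiVK) mulrC.
    by apply: (antip_sub_inv lkerS subL); rewrite SiVK.
  have := key _ _ x oneK etaL.
  rewrite (eps1 hopf) scale1r actA1 // ev_comp (antip_inv1 hopf SiK) => ->.
  by congr (actF _ x); apply/lfunP => a; rewrite !comp_lfunE SiK.
- have := key _ _ x aK (ee_dual_quotient hopf L).
  rewrite -[ev ee _]/(eps _) (eps1 hopf) scale1r => ->; congr (_ *: _).
  rewrite -[RHS](actF1 x rX); congr (actF _ x); apply/lfunP => b.
  by rewrite comp_lfunE; exact: (epsS hopf).
Qed.

(** One inclusion takes D(L,K) itself as the test fusion subcategory; for the other, each object of
    D(L,K) splits into simple ones, which centralize D(K,L). *)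
Lemma mueger_double_cat (M : rep_data D) :
  mueger_centralizer (double_R A) (double_cat K L) M <-> double_cat L K M.
Proof.
split=> [genM|catM].
  apply: genM; first exact: double_cat_fusion.
  by move=> X [rX _ brX]; exact: centralizer_double_cat.
have [e [le e1]] := double_integral.
move=> C fusC simC; apply: (trivial_on_generated Dhopf le e1 fusC _ catM).
move=> X catX simX; apply: simC; split=> //; first by case: catX.
by move=> Y catY; exact: (double_braiding_trivial hopf SiVK subK subL).
Qed.

End Centralizer.

Theorem theorem1p1 (k : closedFieldType) (char_k : [pchar k]%R =i pred0)
    (A : hopf_data k) (hopf_A : is_hopf_algebra A)
    (semisimple_A : semisimple_algebra A)
    (K L : {vspace A})
    (normal_K : normal_hopf_subalgebra K)
    (normal_L : normal_hopf_subalgebra L)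
    (normal_B : normal_hopf_subalgebra (double_sub K L)) :
  forall M : rep_data (drinfeld_double A),
    mueger_centralizer (double_R A) (double_cat K L) M <-> double_cat L K M.
Proof. exact: mueger_double_cat. Qed.
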